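(* Let $N\ge1$ be an integer, $\gamma>0$ and $\beta>0$. For $u\in H^2(\mathbb{R}^N)$ let $$I(u)=\frac{\gamma}{2}\int_{\mathbb{R}^N}|\Delta u|^2\,dx-\frac{\beta}{2}\int_{\mathbb{R}^N}|\nabla u|^2\,dx,$$ and for $c>0$ let $m_I(c)=\inf_{u\in S(c)}I(u)$. For all $c>0$ it follows that: (i) $m_I(c)=-\frac{\beta^2}{8\gamma}\,c$. (ii) The infimum is never achieved. (iii) All minimizing sequences are vanishing.
   Context: Functions in $H^2(\mathbb{R}^N)$ are complex-valued. For $c>0$, $S(c)=\{u\in H^2(\mathbb{R}^N):\int_{\mathbb{R}^N}|u|^2\,dx=c\}$. A minimizing sequence of $m_I(c)$ is a sequence $\{u_n\}\subset S(c)$ with $I(u_n)\to m_I(c)$. A sequence $\{u_n\}$ is vanishing if for all $R>0$, $\lim_{n\to\infty}\sup_{y\in\mathbb{R}^N}\int_{B_R(y)}|u_n|^2\,dx=0$, where $B_R(y)$ is the ball of center $y$ and radius $R$. *)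

(* Defs.v *)
From HB Require Import structures.
From mathcomp Require Import all_boot all_order all_algebra.
From mathcomp Require Import all_classical all_reals all_analysis.
From mathcomp.real_closed Require Import complex.

Set Implicit Arguments.
Unset Strict Implicit.
Unset Printing Implicit Defensive.

Import Order.TTheory GRing.Theory Num.Theory.
Import numFieldNormedType.Exports.

Local Open Scope classical_set_scope.
Local Open Scope ring_scope.
Local Open Scope complex_scope.

(* The sigma-algebra generated by the coordinates; for [T] the real line it is
   the Borel sigma-algebra of R^n. *)
Section measurable_rV.
Context {d} {T : measurableType d} (n : nat).

Let coord (i : 'I_n) (x : 'rV[T]_n) : T := x ord0 i.

Let rV_set0 : g_sigma_preimage coord set0.
Proof. exact: sigma_algebra0. Qed.

Let rV_setC A : g_sigma_preimage coord A -> g_sigma_preimage coord (~` A).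
Proof. exact: sigma_algebraC. Qed.

Let rV_bigcup (F : (set 'rV[T]_n)^nat) :
  (forall i, g_sigma_preimage coord (F i)) ->
  g_sigma_preimage coord (\bigcup_i F i).
Proof. exact: sigma_algebra_bigcup. Qed.

HB.instance Definition _ := @isMeasurable.Build (measure_tuple_display d)
  'rV[T]_n (g_sigma_preimage coord) rV_set0 rV_setC rV_bigcup.

End measurable_rV.

Lemma measurable_rV_coord d (T : measurableType d) n (i : 'I_n) :
  measurable_fun [set: 'rV[T]_n] (fun x : 'rV[T]_n => x ord0 i).
Proof.
move=> _ Y mY; rewrite setTI; apply: sub_sigma_algebra => /=.
rewrite -bigcup_seq/=; exists i => /=; first by rewrite mem_index_enum.
by exists Y => //; rewrite setTI.
Qed.

Lemma measurable_fun_rVP d1 d2 (T1 : measurableType d1)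
    (T2 : measurableType d2) n (f : T1 -> 'rV[T2]_n) :
  measurable_fun [set: T1] f <->
  forall i, measurable_fun [set: T1] (fun x => f x ord0 i).
Proof.
split=> [mf i|mf].
  by apply: (measurableT_comp (measurable_rV_coord i)).
apply: (@measurability _ _ _ _ _ _
  (\big[setU/set0]_(i < n) preimage_set_system setT
     (fun x : 'rV[T2]_n => x ord0 i) measurable)) => //.
move=> _ [A + <-]; rewrite -bigcup_seq => -[i /= _ [B mB <-]].
by rewrite !setTI -comp_preimage -[X in measurable X]setTI; exact: mf.
Qed.

Section lebesgue_rV.
Context {R : realType}.
Local Open Scope ereal_scope.

Definition cons_rV n (p : measurableTypeR R * 'rV[R]_n) : 'rV[R]_n.+1 :=
  \row_i (if unlift ord0 i is Some j then p.2 ord0 j else p.1).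

Lemma measurable_cons_rV n : measurable_fun setT (@cons_rV n).
Proof.
apply/measurable_fun_rVP => i.
have [j ->|->] := unliftP ord0 i.
  rewrite [X in measurable_fun _ X](_ : _ = (fun x : 'rV[R]_n => x ord0 j) \o snd).
    exact: measurableT_comp (measurable_rV_coord j) measurable_snd.
  by apply/funext => p; rewrite /= mxE liftK.
rewrite [X in measurable_fun _ X](_ : _ = fst); first exact: measurable_fst.
by apply/funext => p; rewrite /= mxE unlift_none.
Qed.

(* Lebesgue measure on R^n as an iterated product, transported along
   R * R^n = R^(n+1); [lebesgue_rV_box] below characterizes it. *)
Fixpoint lebesgue_rV n : set 'rV[R]_n -> \bar R :=
  if n is n'.+1
  then pushforward (lebesgue_measure \x @lebesgue_rV n') (@cons_rV n')
  else \d_(0%R : 'rV[R]_0).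

Let lebesgue_rV_sigma_finite_measure n :
  exists m : {sigma_finite_measure set 'rV[R]_n -> \bar R},
    @lebesgue_rV n = m :> (set _ -> _).
Proof.
elim: n => [|n [m mE]]; first by exists \d_(0%R : 'rV[R]_0).
pose p : {measure set 'rV[R]_n.+1 -> \bar R} :=
  measure_function_pushforward__canonical__measure_function_Measure
    ((@lebesgue_measure R) \x m) (@measurable_cons_rV n).
have sfp : sigma_finite setT p.
  have [F FT mF] : sigma_finite setT ((@lebesgue_measure R) \x m).
    have /sigma_finiteP[G [GT ndG Goo]] := sigma_finiteT (@lebesgue_measure R).
    have /sigma_finiteP[H [HT ndH Hoo]] := sigma_finiteT m.
    exists (fun k => G k `*` H k).
      rewrite -setXTT GT HT predeqE => -[x y]; split.
        move=> [/= [k _ Gkx] [l _ Hly]]; exists (maxn k l) => //; split.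
        - by move: x Gkx; exact/subsetPset/ndG/leq_maxl.
        - by move: y Hly; exact/subsetPset/ndH/leq_maxr.
      by move=> [k _ []/= ? ?]; split; exists k.
    move=> k; have [? ?] := Goo k; have [? ?] := Hoo k.
    split; first exact: measurableX.
    by rewrite product_measure1E// lte_mul_pinfty// ge0_fin_numE.
  pose dec (x : 'rV[R]_n.+1) : measurableTypeR R * 'rV[R]_n :=
    (x ord0 ord0, \row_j x ord0 (lift ord0 j)).
  have decK : cancel (@cons_rV n) dec.
    move=> [a v]; rewrite /dec /cons_rV mxE unlift_none; congr pair.
    by apply/rowP => j; rewrite !mxE liftK.
  have mdec : measurable_fun setT dec.
    apply/measurable_fun_pairP; split; first exact: measurable_rV_coord.
    apply/measurable_fun_rVP => j.
    rewrite [X in measurable_fun _ X](_ : _ = fun x : 'rV[R]_n.+1 => x ord0 (lift ord0 j)).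
      exact: measurable_rV_coord.
    by apply/funext => x; rewrite /= mxE.
  exists (fun k => dec @^-1` F k).
    by rewrite -preimage_bigcup -FT preimage_setT.
  move=> k; have [mFk Fk] := mF k; split.
    by rewrite -[X in measurable X]setTI; exact: mdec.
  rewrite /p /= /pushforward -comp_preimage.
  by rewrite (_ : dec \o _ = id)//; apply/funext => x; exact: decK.
pose sf := Measure_isSigmaFinite.Build _ _ _ p sfp.
pose q : {sigma_finite_measure set 'rV[R]_n.+1 -> \bar R} := HB.pack (p : set _ -> _) p sf.
by exists q; rewrite /= mE.
Qed.

Let lebesgue_rV0 n : @lebesgue_rV n set0 = 0.
Proof. by have [m ->] := lebesgue_rV_sigma_finite_measure n. Qed.

Let lebesgue_rV_ge0 n A : 0 <= @lebesgue_rV n A.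
Proof. by have [m ->] := lebesgue_rV_sigma_finite_measure n. Qed.

Let lebesgue_rV_semi_sigma_additive n : semi_sigma_additive (@lebesgue_rV n).
Proof.
have [m ->] := lebesgue_rV_sigma_finite_measure n.
exact: measure_semi_sigma_additive.
Qed.

HB.instance Definition _ n := isMeasure.Build _ _ _ (@lebesgue_rV n)
  (@lebesgue_rV0 n) (@lebesgue_rV_ge0 n) (@lebesgue_rV_semi_sigma_additive n).

Let lebesgue_rV_sigma_finite n : sigma_finite setT (@lebesgue_rV n).
Proof.
have [m ->] := lebesgue_rV_sigma_finite_measure n.
exact: sigma_finiteT.
Qed.

HB.instance Definition _ n := Measure_isSigmaFinite.Build _ _ _ (@lebesgue_rV n)
  (@lebesgue_rV_sigma_finite n).

Lemma lebesgue_rV_box n (A : 'I_n -> set R) : (forall i, measurable (A i)) ->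
  lebesgue_rV [set x : 'rV[R]_n | forall i, A i (x ord0 i)] =
  \prod_(i < n) lebesgue_measure (A i).
Proof.
elim: n A => [|n IH] A mA.
  by rewrite big_ord0 /= diracE mem_set//= => -[].
rewrite big_ord_recl /= /pushforward -IH//.
rewrite -product_measure1E//=; last first.
  rewrite (_ : mkset _ = \bigcap_(i in [set: 'I_n])
    (fun x : 'rV[R]_n => x ord0 i) @^-1` A (lift ord0 i)).
    apply: fin_bigcap_measurable => // i _; rewrite -[X in measurable X]setTI.
    exact: measurable_rV_coord.
  by apply/seteqP; split=> x /= h i; [move=> _; exact: h|exact: h].
  exact: mA.
congr (_ _); apply/seteqP; split=> -[a v] /=.
  move=> h; split=> [|i].
    by have := h ord0; rewrite mxE unlift_none.
  by have := h (lift ord0 i); rewrite mxE liftK.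
move=> [h0 h] i; rewrite mxE.
by case: unliftP => [j ->|->//]; exact: h.
Qed.

End lebesgue_rV.
Arguments lebesgue_rV {R} n.

Section sobolev.
Context {R : realType} {n : nat}.
Implicit Types (x y : 'rV[R]_n) (phi : 'rV[R]_n -> R) (u v : 'rV[R]_n -> R[i]).
Implicit Types (alpha : seq 'I_n) (r c : R).

Local Notation mu := (@lebesgue_rV R n).

(* The library norm and balls on ['rV[R]_n] are those of the sup norm. *)
Definition euclidean_norm x : R := Num.sqrt (\sum_i x ord0 i ^+ 2).

Definition euclidean_ball y r : set 'rV[R]_n :=
  [set x | euclidean_norm (x - y) < r].

Definition sqr_norm (z : R[i]) : R := Normc.normc z ^+ 2.

Definition partial (i : 'I_n) phi x : R := 'D_(delta_mx ord0 i) phi x.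

Definition partials alpha phi := foldr partial phi alpha.

Definition smooth phi :=
  forall alpha, continuous (partials alpha phi) /\
    forall i x, derivable (partials alpha phi) x (delta_mx ord0 i).

Definition test_function phi :=
  smooth phi /\ compact (closure [set x | phi x != 0]).

Definition Cintegral u : R[i] :=
  (\int[mu]_x complex.Re (u x)) +i* (\int[mu]_x complex.Im (u x)).

Definition L2 u :=
  [/\ measurable_fun setT (fun x => complex.Re (u x)),
      measurable_fun setT (fun x => complex.Im (u x)) &
      (\int[mu]_x (sqr_norm (u x))%:E < +oo)%E].

(* The multi-index is given as a list of directions. Real-valued test functions
   suffice, the identity being complex-linear in [phi]. *)
Definition is_weak_derivative alpha u v :=
  L2 v /\ forall phi, test_function phi ->
    Cintegral (fun x => u x * (partials alpha phi x)%:C) =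
    (-1) ^+ size alpha * Cintegral (fun x => v x * (phi x)%:C).

Definition H2 : set ('rV[R]_n -> R[i]) := [set u | L2 u /\
  forall alpha, (size alpha <= 2)%N -> exists v, is_weak_derivative alpha u v].

(* For [u] in H^2 and [size alpha <= 2], a representative of the derivative,
   which is unique up to a null set; only its integrals are used. *)
Definition weak_derivative alpha u : 'rV[R]_n -> R[i] :=
  xget (fun=> 0) [set v | is_weak_derivative alpha u v].

Definition laplacian u x : R[i] := \sum_i weak_derivative [:: i; i] u x.

Definition sqr_norm_grad u x : R := \sum_i sqr_norm (weak_derivative [:: i] u x).

Definition energy (gamma beta : R) u : R :=
  gamma / 2 * (\int[mu]_x sqr_norm (laplacian u x)) -
  beta / 2 * (\int[mu]_x sqr_norm_grad u x).

Definition mass_sphere c : set ('rV[R]_n -> R[i]) :=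
  H2 `&` [set u | \int[mu]_x sqr_norm (u x) = c].

Definition min_energy (gamma beta c : R) : \bar R :=
  ereal_inf [set (energy gamma beta u)%:E | u in mass_sphere c].

Definition minimizing_sequence (gamma beta c : R)
    (u_ : nat -> 'rV[R]_n -> R[i]) :=
  (forall k, mass_sphere c (u_ k)) /\
  (energy gamma beta (u_ k))%:E @[k --> \oo] --> min_energy gamma beta c.

Definition vanishing_sequence (u_ : nat -> 'rV[R]_n -> R[i]) :=
  forall r, 0 < r ->
    ereal_sup [set (\int[mu]_(x in euclidean_ball y r) (sqr_norm (u_ k x))%:E)%E
      | y in [set: 'rV[R]_n]] @[k --> \oo] --> 0%E.

End sobolev.
Arguments mass_sphere {R} n c.
Arguments min_energy {R} n gamma beta c.
Arguments energy {R n} gamma beta u.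

(* Main.v *)
(* With k2 = beta / (2 gamma), completing the square and integrating by parts
   give energy(u) + beta^2 c / (8 gamma) = (gamma / 2) ||F||^2 on the sphere of
   mass c, where F = Lap u + k2 u. This yields the lower bound. It is sharp on
   the wave packets Phi(x) exp(i sqrt(k2) x_0), where Phi is the product of the
   1 / (1 + d^2 x_j^2) with d -> 0, since the derivatives of Phi are O(d) Phi.

   Vanishing is the local estimate
     \int Phi(. - y) |u|^2 <= eps ||u||^2 + K ||F||^2,  uniformly in y.
   Multiplying F by a(x_p) d_p u + (1/2) a'(x_p) u with a = atan cancels all terms
   of the commutator except \int a' |d_p u|^2 - (1/4) \int a''' |u|^2, and on the
   scale 1/d the last one is O(d^2) ||u||^2 after division by d; so every
   |d_p u|^2 is locally small. Multiplying F by Phi u then bounds k2 \int Phi |u|^2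
   by \int Phi |grad u|^2 up to errors of the same kind.

   A minimizer would be a constant, hence vanishing, minimizing sequence.

   Integration by parts for weak derivatives uses difference quotients: they are
   bounded in L^2 and converge weakly, because test functions are dense. *)
Require Import Defs.
From HB Require Import structures.
From mathcomp Require Import all_boot all_order all_algebra.
From mathcomp Require Import all_classical all_reals all_analysis.
From mathcomp Require Import measurable_realfun.
From mathcomp.real_closed Require Import complex.
From mathcomp Require Import ring lra.

Set Implicit Arguments.
Unset Strict Implicit.
Unset Printing Implicit Defensive.

Import Order.TTheory GRing.Theory Num.Theory.
Import numFieldNormedType.Exports.
Local Open Scope classical_set_scope.
Local Open Scope ring_scope.
(** * Smooth functions and test functions *)

(** On the Fourier side the result is visible at once: the energy has symbol [(gamma / 2) (|xi|^2 -
    k2)^2 - beta^2 / (8 gamma)], whose minimum is taken on a sphere, a null set. The proof stays in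
    physical space instead. The obstacle there is that [k2] lies in the spectrum of minus the
    Laplacian: a small [F] gives no smallness of [u] in the global L^2 norm, so only a weighted
    bound can hold, and it has to be uniform in the centre [y]. In it the global mass must carry an
    arbitrarily small coefficient, while the one of [||F||^2] may be as large as needed, since
    [||F||^2] tends to 0.

    The operator has real coefficients, so the estimates are made for a real function with its weak
    derivatives, then applied to the real and the imaginary part. The weights are not compactly
    supported: as integration by parts holds for any two weakly differentiable L^2 functions, smooth
    multipliers with bounded derivatives are enough. They are built from [atan] and its derivatives
    because these control one another pointwise. *)

Section smooth_functions.
Context {R : realType} {n : nat}.
Implicit Types (f g phi : 'rV[R]_n -> R) (x v : 'rV[R]_n) (i j : 'I_n).

Definition C1 f := continuous f /\ forall i x, derivable f x (delta_mx ord0 i).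

Definition bounded f := exists C : R, forall x, `|f x| <= C.

Lemma partial_cst i (c : R) : partial i (fun=> c) = (fun=> 0 : R) :> ('rV[R]_n -> R).
Proof. by apply/funext => x; rewrite /partial derive_cst. Qed.

Lemma partialD i f g : C1 f -> C1 g ->
  partial i (fun x => f x + g x) = (fun x => partial i f x + partial i g x).
Proof. by move=> [_ df] [_ dg]; apply/funext => x; rewrite /partial deriveD. Qed.

Lemma partialM i f g : C1 f -> C1 g ->
  partial i (fun x => f x * g x) =
  (fun x => f x * partial i g x + g x * partial i f x).
Proof. by move=> [_ df] [_ dg]; apply/funext => x; rewrite /partial deriveM. Qed.

Lemma C1_cst (c : R) : C1 (fun=> c).
Proof. by split=> [|i x]; [exact: cst_continuous|exact: derivable_cst]. Qed.

Lemma C1D f g : C1 f -> C1 g -> C1 (fun x => f x + g x).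
Proof.
move=> [cf df] [cg dg]; split=> [x|i x]; first exact: (cvgD (cf x) (cg x)).
exact: derivableD.
Qed.

Lemma C1M f g : C1 f -> C1 g -> C1 (fun x => f x * g x).
Proof.
move=> [cf df] [cg dg]; split=> [x|i x]; first exact: (cvgM (cf x) (cg x)).
exact: derivableM.
Qed.

Lemma bounded_cst (c : R) : bounded (fun=> c).
Proof. by exists `|c|. Qed.

Lemma boundedD f g : bounded f -> bounded g -> bounded (fun x => f x + g x).
Proof.
move=> [C fC] [D gD]; exists (C + D) => x.
exact: le_trans (ler_normD _ _) (lerD (fC x) (gD x)).
Qed.

Lemma boundedM f g : bounded f -> bounded g -> bounded (fun x => f x * g x).
Proof.
by move=> [C fC] [D gD]; exists (C * D) => x; rewrite normrM ler_pM.
Qed.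

(* If the partial derivatives of the generators lie in the generated algebra,
   all its elements are smooth: this replaces Leibniz's formula of order
   [size alpha]. *)
Inductive alg (G : ('rV[R]_n -> R) -> Prop) : ('rV[R]_n -> R) -> Prop :=
| alg_cst c : alg G (fun=> c)
| alg_gen g : G g -> alg G g
| alg_add f g : alg G f -> alg G g -> alg G (fun x => f x + g x)
| alg_mul f g : alg G f -> alg G g -> alg G (fun x => f x * g x).

Lemma alg_C1 G : (forall g, G g -> C1 g) -> forall f, alg G f -> C1 f.
Proof.
move=> GC f; elim=> [c|g Gg|g h _ IHg _ IHh|g h _ IHg _ IHh].
- exact: C1_cst.
- exact: GC.
- exact: C1D.
- exact: C1M.
Qed.

Lemma alg_bounded G : (forall g, G g -> bounded g) ->
  forall f, alg G f -> bounded f.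
Proof.
move=> GC f; elim=> [c|g Gg|g h _ IHg _ IHh|g h _ IHg _ IHh].
- exact: bounded_cst.
- exact: GC.
- exact: boundedD.
- exact: boundedM.
Qed.

Lemma alg_partials G : (forall g, G g -> C1 g) ->
  (forall g, G g -> forall i, alg G (partial i g)) ->
  forall f, alg G f -> forall alpha, alg G (partials alpha f).
Proof.
move=> GC GP f Gf alpha.
have step i h : alg G h -> alg G (partial i h).
  elim=> [c|g Gg|f1 g Gf1 IHf Gg IHg|f1 g Gf1 IHf Gg IHg].
  - by rewrite partial_cst; exact: alg_cst.
  - exact: GP.
  - by rewrite partialD; [exact: alg_add|exact: (alg_C1 GC)..].
  - rewrite partialM; [|exact: (alg_C1 GC)..].
    by apply: alg_add; exact: alg_mul.
by elim: alpha => //= i alpha IH; exact: step.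
Qed.

Lemma alg_smooth G : (forall g, G g -> C1 g) ->
  (forall g, G g -> forall i, alg G (partial i g)) ->
  forall f, alg G f -> smooth f.
Proof. by move=> GC GP f Gf alpha; exact/(alg_C1 GC)/alg_partials. Qed.

Lemma smooth_C1 f : smooth f -> C1 f.
Proof. by move=> /(_ [::]). Qed.

Lemma partials_rcons alpha i f :
  partials (rcons alpha i) f = partials alpha (partial i f).
Proof. by rewrite /partials foldr_rcons. Qed.

Lemma smooth_partial i f : smooth f -> smooth (partial i f).
Proof. by move=> sf alpha; rewrite -partials_rcons; exact: sf. Qed.

(** Taking [smooth] itself as the set of generators turns stability under sums and products into the
    constructors of [alg]. *)
Lemma smooth_algP f : alg (@smooth R n) f -> smooth f.
Proof.
apply: alg_smooth => [g|g sg i]; first exact: smooth_C1.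
exact/alg_gen/smooth_partial.
Qed.

Lemma smooth_cst (c : R) : smooth ((fun=> c) : 'rV[R]_n -> R).
Proof. exact/smooth_algP/alg_cst. Qed.

Lemma smoothD f g : smooth f -> smooth g -> smooth (fun x => f x + g x).
Proof. by move=> sf sg; apply/smooth_algP/alg_add; exact: alg_gen. Qed.

Lemma smoothM f g : smooth f -> smooth g -> smooth (fun x => f x * g x).
Proof. by move=> sf sg; apply/smooth_algP/alg_mul; exact: alg_gen. Qed.

Lemma smooth_prod (I : Type) (s : seq I) (F : I -> 'rV[R]_n -> R) :
  (forall k, smooth (F k)) -> smooth (fun x => \prod_(k <- s) F k x).
Proof.
move=> sF; elim: s => [|k s IH].
  under eq_fun do rewrite big_nil.
  exact: smooth_cst.
under eq_fun do rewrite big_cons.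
exact: smoothM.
Qed.

(** The class of admissible multipliers: multiplication by such a function preserves
    square-integrability and weak differentiability without any condition on its support. *)
Definition bsmooth f := smooth f /\ forall alpha, bounded (partials alpha f).

Lemma bsmooth_bounded f : bsmooth f -> bounded f.
Proof. by move=> [_ /(_ [::])]. Qed.

Lemma bsmooth_C1 f : bsmooth f -> C1 f.
Proof. by move=> [/smooth_C1]. Qed.

Lemma bsmooth_partial i f : bsmooth f -> bsmooth (partial i f).
Proof.
move=> [sf bf]; split; first exact: smooth_partial.
by move=> alpha; rewrite -partials_rcons; exact: bf.
Qed.

Lemma alg_bsmooth G : (forall g, G g -> C1 g) ->
  (forall g, G g -> bounded g) ->
  (forall g, G g -> forall i, alg G (partial i g)) ->
  forall f, alg G f -> bsmooth f.
Proof.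
move=> GC GB GP f Gf; split; first exact: alg_smooth Gf.
by move=> alpha; apply: (alg_bounded GB); exact: alg_partials.
Qed.

Lemma bsmooth_algP f : alg bsmooth f -> bsmooth f.
Proof.
apply: alg_bsmooth => [g|g|g sg i]; first exact: bsmooth_C1.
  exact: bsmooth_bounded.
exact/alg_gen/bsmooth_partial.
Qed.

Lemma bsmooth_cst (c : R) : bsmooth ((fun=> c) : 'rV[R]_n -> R).
Proof. exact/bsmooth_algP/alg_cst. Qed.

Lemma bsmoothD f g : bsmooth f -> bsmooth g -> bsmooth (fun x => f x + g x).
Proof. by move=> sf sg; apply/bsmooth_algP/alg_add; exact: alg_gen. Qed.

Lemma bsmoothM f g : bsmooth f -> bsmooth g -> bsmooth (fun x => f x * g x).
Proof. by move=> sf sg; apply/bsmooth_algP/alg_mul; exact: alg_gen. Qed.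

Lemma bsmoothZ (c : R) f : bsmooth f -> bsmooth (fun x => c * f x).
Proof. exact/bsmoothM/bsmooth_cst. Qed.

Lemma bsmooth_prod (I : Type) (s : seq I) (F : I -> 'rV[R]_n -> R) :
  (forall k, bsmooth (F k)) -> bsmooth (fun x => \prod_(k <- s) F k x).
Proof.
move=> sF; elim: s => [|k s IH].
  under eq_fun do rewrite big_nil.
  exact: bsmooth_cst.
under eq_fun do rewrite big_cons.
exact: bsmoothM.
Qed.

(** In finite dimension a closed set is compact as soon as it is bounded, so only a radius has to be
    tracked through sums, products and translations. *)
Lemma test_functionP phi : test_function phi <->
  smooth phi /\ exists M : R, forall x, M < `|x| -> phi x = 0.
Proof.
split=> -[sphi].
  move=> /compact_bounded[M [_ HM]]; split => //; exists (M + 1) => x Mx.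
  apply/eqP; apply: contraT => x0.
  have := HM (M + 1); rewrite ltrDl ltr01 => /(_ isT) /(_ x) /=.
  have xS : closure [set x | phi x != 0] x by exact: subset_closure.
  by move=> /(_ xS); rewrite leNgt Mx.
move=> [M HM]; split => //; apply: bounded_closed_compact; last exact: closed_closure.
have sub : closure [set x | phi x != 0] `<=` [set x | `|x| <= M].
  rewrite closureE; apply: smallest_sub; last first.
    by move=> x /=; apply: contraNT; rewrite -ltNge => /HM ->.
  apply: (@preimage_closed _ _ (fun x : 'rV[R]_n => `|x|) [set y : R | y <= M]).
    by move=> x _; exact: norm_continuous.
  exact: closed_le.
exists M; split; first exact: num_real.
by move=> y My x /sub /= xM; exact: le_trans xM (ltW My).
Qed.

Lemma test_smooth phi : test_function phi -> smooth phi.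
Proof. by case. Qed.

Lemma testMl f phi : smooth f -> test_function phi ->
  test_function (fun x => f x * phi x).
Proof.
move=> sf /test_functionP[sphi [M HM]]; apply/test_functionP.
by split; [exact: smoothM|exists M => x /HM ->; rewrite mulr0].
Qed.

Lemma testD phi psi : test_function phi -> test_function psi ->
  test_function (fun x => phi x + psi x : R).
Proof.
move=> /test_functionP[sphi [M HM]] /test_functionP[spsi [P HP]].
apply/test_functionP.
split; [exact: smoothD|exists (Num.max M P) => x].
by rewrite gt_max => /andP[/HM -> /HP ->]; rewrite addr0.
Qed.

Lemma testZ (c : R) phi : test_function phi -> test_function (fun x => c * phi x).
Proof. exact/testMl/smooth_cst. Qed.

Lemma test0 : test_function ((fun=> 0) : 'rV[R]_n -> R).
Proof. by apply/test_functionP; split; [exact: smooth_cst|exists 0]. Qed.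

Lemma test_partial i phi : test_function phi -> test_function (partial i phi).
Proof.
move=> /test_functionP[sphi [M HM]]; apply/test_functionP.
split; first exact: smooth_partial.
exists M => x Mx; rewrite /partial.
(* The condition [M < |x|] is open, so [phi] vanishes on a whole neighbourhood of [x] and not merely
   at [x]. *)
rewrite -[RHS](derive_cst (0 : R) x (delta_mx ord0 i)); apply: near_eq_derive.
have : \forall y \near x, M < `|y| by exact: (cvgr_gt _ (@norm_continuous _ _ x)).
by apply: filterS => y /= /HM ->.
Qed.

Lemma derive_translate (v w x : 'rV[R]_n) f :
  'D_v (fun y => f (y + w)) x = 'D_v f (x + w).
Proof.
rewrite /derive; set F := (X in lim (X @ _)); set G := (X in _ = lim (X @ _)).
suff -> : F = G by [].
by apply/funext => h; rewrite /F /G /= addrA.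
Qed.

Lemma derivable_translate (v w x : 'rV[R]_n) f :
  derivable f (x + w) v -> derivable (fun y => f (y + w)) x v.
Proof.
rewrite /derivable (_ : (fun h : R => _) = (fun h => h^-1 *: ((f (h *: v + x + w)) - f (x + w)))) //.
by apply/funext => h /=; rewrite addrA.
Qed.

Lemma partials_translate alpha (w : 'rV[R]_n) f :
  partials alpha (fun y => f (y + w)) = (fun y => partials alpha f (y + w)).
Proof.
elim: alpha => //= i alpha ->; apply/funext => x.
by rewrite /partial derive_translate.
Qed.

Lemma test_translate (w : 'rV[R]_n) phi : test_function phi ->
  test_function (fun y => phi (y + w)).
Proof.
move=> /test_functionP[sphi [M HM]]; apply/test_functionP; split.
  move=> alpha; rewrite partials_translate; split.
    move=> x; have [c _] := sphi alpha.
    apply: (@cvg_comp _ _ _ (fun y : 'rV[R]_n => y + w)); last exact: c.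
    by apply: (@cvgD _ _ _ (nbhs x)); [exact: cvg_id|exact: cvg_cst].
  by move=> i x; apply: derivable_translate; have [_] := sphi alpha; exact.
exists (M + `|w|) => x h; apply: HM.
rewrite -(ltrD2r `|w|); apply: lt_le_trans h _.
by rewrite -[X in `|X| <= _](addrK w) ler_normB.
Qed.

Lemma test_bounded phi : test_function phi -> bounded phi.
Proof.
move=> /test_functionP[sphi [M HM]].
have [[cphi _] _] := (sphi [::], tt).
have K : compact [set x : 'rV[R]_n | `|x| <= M].
  apply: bounded_closed_compact.
    exists M; split; first exact: num_real.
    by move=> y My x /= xM; exact: le_trans xM (ltW My).
  apply: (@preimage_closed _ _ (fun x : 'rV[R]_n => `|x|) [set y : R | y <= M]).
    by move=> x _; exact: norm_continuous.
  exact: closed_le.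
have := @continuous_compact _ _ phi _ (continuous_subspaceT cphi) K.
move=> /compact_bounded[C [_ HC]]; exists (Num.max 0 (C + 1)) => x.
rewrite le_max; have [xM|/HM ->] := leP `|x| M; last by rewrite normr0 lexx.
apply/orP; right; apply: (HC (C + 1)); first by rewrite ltrDl.
by exists x.
Qed.

End smooth_functions.

(** * Functions of one variable *)

Section smooth_functions_of_one_variable.
Context {R : realType}.
Implicit Types (t : R) (m : nat).

(** The derivative of [atan]. Together with [odd_lorentz1] it generates an algebra stable under
    differentiation, in which each derivative of [lorentz1] is [lorentz1] times a bounded factor. *)
Definition lorentz1 t : R := (1 + t ^+ 2)^-1.

Definition odd_lorentz1 t : R := t * lorentz1 t.

(* The span of these functions is stable under differentiation, and
   [flat 0 (k * t)] increases to the indicator of [0 < t]; products of such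
   factors are test functions approximating the indicator of a box. *)
Definition flat m t : R := if 0 < t then t ^- m * expR (- t^-1) else 0.

Lemma onepsqr_gt0 t : 0 < 1 + t ^+ 2.
Proof. by rewrite ltr_wpDr ?sqr_ge0. Qed.

Lemma lorentz1_gt0 t : 0 < lorentz1 t.
Proof. by rewrite invr_gt0 onepsqr_gt0. Qed.

Lemma lorentz1_le1 t : lorentz1 t <= 1.
Proof. by rewrite invf_le1 ?onepsqr_gt0// lerDl sqr_ge0. Qed.

(** With [t = tan a], [2 * odd_lorentz1 t] is [sin (2 a)], and the square exhibited in the proof is
    that of [cos (2 a)]. *)
Lemma odd_lorentz1_sqr_le t : 4 * odd_lorentz1 t ^+ 2 <= 1.
Proof.
rewrite -subr_ge0 (_ : 1 - _ = ((1 - t ^+ 2) * lorentz1 t) ^+ 2) ?sqr_ge0//.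
rewrite /odd_lorentz1 /lorentz1; field.
by rewrite gt_eqF// onepsqr_gt0.
Qed.

Lemma flat_ge0 m t : 0 <= flat m t.
Proof.
rewrite /flat; case: ifPn => // t0.
by rewrite mulr_ge0 ?expR_ge0// invr_ge0 exprn_ge0// ltW.
Qed.

(** A single term of the exponential series is enough: [exp (1 / t) >= t^-m / m!]. *)
Lemma flat_le m t : flat m t <= (m`!)%:R.
Proof.
rewrite /flat; case: ifPn => [t0|_]; last exact: ler0n.
case: m => [|m].
  by rewrite expr0 invr1 mul1r fact0 expR_le1 oppr_le0 invr_ge0 ltW.
rewrite expRN -exprVn ler_pdivrMr ?expR_gt0// mulrC -ler_pdivrMr ?ltr0n ?fact_gt0//.
have := @expR_ge1Dxn R t^-1 m; rewrite invr_ge0 (ltW t0) => /(_ isT).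
by apply: le_trans; rewrite lerDr.
Qed.

Lemma flat0_le1 t : flat 0 t <= 1.
Proof. by have := flat_le 0 t; rewrite fact0. Qed.

Lemma is_derive_lorentz1 t : is_derive t 1 lorentz1 (- 2 * (lorentz1 t * odd_lorentz1 t)).
Proof.
have t0 : 1 + t ^+ 2 != 0 by rewrite gt_eqF// onepsqr_gt0.
have : is_derive t 1 (fun y : R => 1 + y ^+ 2) (2 * t).
  by apply: is_derive_eq; rewrite /GRing.scale /=; ring.
move=> /(@is_deriveV _ (fun y => 1 + y ^+ 2) _ _ _ t0) dV; apply: is_derive_eq.
by rewrite /odd_lorentz1 /lorentz1 /GRing.scale /=; field.
Qed.

Lemma is_derive_odd_lorentz1 t :
  is_derive t 1 odd_lorentz1 (lorentz1 t + - 2 * (odd_lorentz1 t * odd_lorentz1 t)).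
Proof.
have db := is_derive_lorentz1 t.
rewrite /odd_lorentz1; apply: is_derive_eq.
by rewrite /GRing.scale /= /odd_lorentz1; ring.
Qed.

Lemma is_derive_flat m t :
  is_derive t 1 (flat m) (flat m.+2 t + - m%:R * flat m.+1 t).
Proof.
have [t0|t0|->] := ltgtP t 0.
- have -> : flat m.+2 t + - m%:R * flat m.+1 t = 0.
    by rewrite /flat ltNge (ltW t0) mulr0 addr0.
  apply: (@near_eq_is_derive _ _ _ (cst 0)).
  have : \forall y \near t, y < 0 by exact: lt_nbhsl.
  by apply: filterS => y y0 /=; rewrite /flat ltNge (ltW y0).
- have tn0 : t != 0 by rewrite gt_eqF.
  have near_t : \forall y \near t, (y^-1) ^+ m * expR (- y^-1) = flat m y.
    have : \forall y \near t, 0 < y by exact: lt_nbhsr.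
    by apply: filterS => y y0; rewrite /flat y0 exprVn.
  have dV : is_derive t 1 (fun y : R => y^-1) (- t ^- 2).
    apply: (is_derive_eq (@is_deriveV _ id _ _ _ tn0 (is_derive_id _ _))).
    by rewrite /= [_ *: _]mulr1.
  have dE : is_derive t 1 (fun y : R => expR (- y^-1)) (t ^- 2 * expR (- t^-1)).
    have dN : is_derive t 1 (fun y : R => - y^-1) (t ^- 2).
      by apply: is_derive_eq; rewrite opprK.
    by rewrite mulrC; exact: is_derive1_comp.
  apply: (near_eq_is_derive near_t).
  have := is_deriveX m dV; rewrite exprfctE => dX.
  apply: (is_derive_eq (is_deriveM dX dE)).
  rewrite /flat t0 /GRing.scale /= -!exprVn; clear near_t dX; case: m => [|m] /=.
    by rewrite mulr0n; ring.
  by rewrite -mulr_natl !exprS; ring.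
- have -> : flat m.+2 0 + - m%:R * flat m.+1 0 = 0.
    by rewrite /flat ltxx mulr0 addr0.
  (* For [h > 0] the difference quotient at 0 is [h * flat m.+2 h], because lowering the power of
     [h] raises the index. As [flat m.+2] is bounded by [(m.+2)!], the quotient is O(h). *)
  have cv : h^-1 *: (flat m (h *: 1 + 0) - flat m 0) @[h --> 0^'] --> (0 : R).
    apply: (@cvg_to_0_linear _ _ ((m.+2)`!)%:R 1) => // h /andP[h0 _].
    rewrite /flat ltxx subr0 addr0 /GRing.scale /= mulr1.
    case: ifPn => [hp|_]; last by rewrite mulr0 normr0 mulr_ge0.
    rewrite (_ : _ * _ = h * flat m.+2 h).
      by rewrite normrM mulrC ler_wpM2r// ger0_norm ?flat_ge0// flat_le.
    by rewrite /flat hp !exprS; field; rewrite expf_neq0 gt_eqF.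
  split; first by apply/cvg_ex; exists 0; exact: cv.
  exact: cvg_lim cv.
Qed.

(** A concrete list, closed under differentiation, of the profiles that occur: [cos] and [sin] for
    the oscillation of the wave packets, [atan] and its derivatives for the multipliers and weights,
    [flat] for the density of test functions. *)
Inductive bsmooth1 : (R -> R) -> Prop :=
| bsmooth1_cst c : bsmooth1 (fun=> c)
| bsmooth1_add f g : bsmooth1 f -> bsmooth1 g -> bsmooth1 (fun t => f t + g t)
| bsmooth1_mul f g : bsmooth1 f -> bsmooth1 g -> bsmooth1 (fun t => f t * g t)
| bsmooth1_cos : bsmooth1 cos
| bsmooth1_sin : bsmooth1 sin
| bsmooth1_atan : bsmooth1 atan
| bsmooth1_lorentz1 : bsmooth1 lorentz1
| bsmooth1_odd_lorentz1 : bsmooth1 odd_lorentz1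
| bsmooth1_flat m : bsmooth1 (flat m).

Lemma atan_le2 t : `|atan t| <= 2.
Proof.
have pi2 : pi / 2 <= 2 :> R.
  by have /ltW/= := @pihalf_lt2 R.
rewrite ler_norml; apply/andP; split.
  by apply/ltW/(le_lt_trans _ (atan_gtNpi2 t)); rewrite lerN2.
exact/ltW/(lt_le_trans (atan_ltpi2 t)).
Qed.

Lemma bsmooth1_bounded f : bsmooth1 f -> exists C : R, forall t, `|f t| <= C.
Proof.
elim=> [c|g h _ [C gC] _ [D hD]|g h _ [C gC] _ [D hD]|||| | |m].
- by exists `|c|.
- by exists (C + D) => t; exact: le_trans (ler_normD _ _) (lerD (gC t) (hD t)).
- by exists (C * D) => t; rewrite normrM ler_pM.
- by exists 1; exact: cos_max.
- by exists 1; exact: sin_max.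
- by exists 2; exact: atan_le2.
- by exists 1 => t; rewrite ger0_norm ?lorentz1_le1// ltW// lorentz1_gt0.
- exists 1 => t; rewrite -[leRHS]normr1 -ler_sqr ?nnegrE ?normr_ge0// !real_normK ?num_real//.
  by have := odd_lorentz1_sqr_le t; have := sqr_ge0 (odd_lorentz1 t); lra.
- by exists (m`!)%:R => t; rewrite ger0_norm ?flat_le ?flat_ge0.
Qed.

Lemma bsmooth1_derive f : bsmooth1 f ->
  exists2 df, bsmooth1 df & forall t, is_derive t 1 f (df t).
Proof.
elim=> [c|g h bg [dg bdg gdg] bh [dh bdh hdh]|g h bg [dg bdg gdg] bh [dh bdh hdh]|||| | |m].
- by exists (fun=> 0); [exact: bsmooth1_cst|move=> t; exact: is_derive_cst].
- by exists (fun t => dg t + dh t); [exact: bsmooth1_add|move=> t; exact: is_deriveD].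
- exists (fun t => g t * dh t + h t * dg t).
    by apply: bsmooth1_add; exact: bsmooth1_mul.
  by move=> t; exact: is_deriveM.
- exists (fun t => -1 * sin t).
    by apply: bsmooth1_mul; [exact: bsmooth1_cst|exact: bsmooth1_sin].
  by move=> t; rewrite mulN1r; exact: is_derive_cos.
- by exists cos; [exact: bsmooth1_cos|move=> t; exact: is_derive_sin].
- by exists lorentz1; [exact: bsmooth1_lorentz1|move=> t; exact: is_derive1_atan].
- exists (fun t => - 2 * (lorentz1 t * odd_lorentz1 t)); last exact: is_derive_lorentz1.
  apply: bsmooth1_mul; first exact: bsmooth1_cst.
  by apply: bsmooth1_mul; [exact: bsmooth1_lorentz1|exact: bsmooth1_odd_lorentz1].
- exists (fun t => lorentz1 t + - 2 * (odd_lorentz1 t * odd_lorentz1 t)); last exact: is_derive_odd_lorentz1.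
  apply: bsmooth1_add; first exact: bsmooth1_lorentz1.
  apply: bsmooth1_mul; first exact: bsmooth1_cst.
  by apply: bsmooth1_mul; exact: bsmooth1_odd_lorentz1.
- exists (fun t => flat m.+2 t + - m%:R * flat m.+1 t); last exact: is_derive_flat.
  apply: bsmooth1_add; first exact: bsmooth1_flat.
  by apply: bsmooth1_mul; [exact: bsmooth1_cst|exact: bsmooth1_flat].
Qed.

End smooth_functions_of_one_variable.

(** * Composition with an affine function of one coordinate *)

Section functions_of_one_coordinate.
Context {R : realType} {n : nat}.
Implicit Types (f : 'rV[R]_n -> R) (x v : 'rV[R]_n) (i j : 'I_n) (d a : R).

Lemma derive_line f v x : 'D_v f x = 'D_1 (fun h : R => f (h *: v + x)) 0.
Proof.
rewrite /derive; set F := (X in lim (X @ _)); set G := (X in _ = lim (X @ _)).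
suff -> : F = G by [].
by apply/funext => h; rewrite /F /G /= addr0 [h *: 1]mulr1 scale0r add0r.
Qed.

Definition affine i d a x : R := d * (x ord0 i - a).

(** The factor [d *+ (j == i)] is [d] or 0, so that a single chain rule serves the direction [i] and
    all the others. *)
Lemma is_derive_affine (eta : R -> R) i j d a x l :
  is_derive (affine i d a x) 1 eta l ->
  is_derive x (delta_mx ord0 j) (fun y => eta (affine i d a y)) (d *+ (j == i) * l).
Proof.
move=> deta.
set v : 'rV[R]_n := delta_mx ord0 j.
have E : (fun h : R => eta (affine i d a (h *: v + x))) =
    eta \o (fun h : R => d *+ (j == i) * h + affine i d a x).
  apply/funext => h /=; congr eta; rewrite /affine !mxE eqxx /= eq_sym.
  by case: eqP => _ /=; rewrite ?mulr1n ?mulr0n; ring.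
have dF : is_derive (0 : R) 1 (fun h : R => eta (affine i d a (h *: v + x)))
    (d *+ (j == i) * l).
  rewrite E mulrC; apply: is_derive1_comp; first by rewrite /= mulr0 add0r.
  move: (d *+ (j == i)) => e.
  by apply: is_derive_eq; rewrite /GRing.scale /=; ring.
split; first by apply/derivable1P; exact: ex_derive.
by rewrite derive_line derive_val.
Qed.

(** The generators are the composites with this one affine coordinate: a partial derivative of a
    generator is a constant times another generator. *)
Lemma bsmooth_coord (eta : R -> R) i d a : bsmooth1 eta ->
  bsmooth (fun x => eta (affine i d a x)).
Proof.
move=> beta.
pose G (g : 'rV[R]_n -> R) := exists2 e : R -> R, bsmooth1 e & g = e \o affine i d a.
have GP g : G g -> forall j, alg G (partial j g).
  move=> [e /bsmooth1_derive[de bde ede] ->] j.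
  have -> : partial j (e \o affine i d a) =
      (fun x => d *+ (j == i) * de (affine i d a x)).
    apply/funext => x; rewrite /partial.
    by have [_ ->] := is_derive_affine j (ede (affine i d a x)).
  by apply: alg_mul; [exact: alg_cst|apply: alg_gen; exists de].
apply: (@alg_bsmooth _ _ G) => //; last by apply: alg_gen; exists eta.
- move=> g [e /bsmooth1_derive[de bde ede] ->]; split.
    move=> x; apply: continuous_comp.
      rewrite /affine; apply: (@cvgM _ _ (nbhs x)); first exact: cvg_cst.
      apply: (@cvgB _ _ _ (nbhs x)); last exact: cvg_cst.
      exact: coord_continuous.
    apply: differentiable_continuous; apply/derivable1_diffP.
    exact: (@ex_derive _ _ _ _ _ _ _ (ede _)).
  by move=> j x; have [] := is_derive_affine j (ede (affine i d a x)).
- move=> g [e /bsmooth1_bounded[C eC] ->]; exists C => x; exact: eC.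
Qed.

Lemma partial_coord (eta deta : R -> R) i j d a :
  (forall t : R, is_derive t 1 eta (deta t)) ->
  partial j (fun x => eta (affine i d a x)) =
  (fun x => d *+ (j == i) * deta (affine i d a x)).
Proof.
move=> ede; apply/funext => x; rewrite /partial.
by have [_ ->] := is_derive_affine j (ede (affine i d a x)).
Qed.

End functions_of_one_coordinate.

(** * Lebesgue measure on R^n *)

Section lebesgue_rV_theory.
Context {R : realType} {n : nat}.
Implicit Types (x v : 'rV[R]_n) (i j : 'I_n).

Local Notation mu := (@lebesgue_rV R n).

Definition obox (a b : 'I_n -> R) : set 'rV[R]_n :=
  [set x | forall i, `]a i, b i[%classic (x ord0 i)].

(** A pi-system of sets of known finite measure that generates the sigma-algebra. Translation
    invariance and the density of test functions are both propagated from it. *)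
Definition oboxes : set (set 'rV[R]_n) := [set obox ab.1 ab.2 | ab in setT].

Lemma measurable_obox a b : measurable (obox a b).
Proof.
rewrite (_ : obox a b = \bigcap_(i in [set: 'I_n])
    (fun x : 'rV[R]_n => x ord0 i) @^-1` `]a i, b i[%classic).
  apply: fin_bigcap_measurable => // i _; rewrite -[X in measurable X]setTI.
  exact: measurable_rV_coord.
by apply/seteqP; split=> x /= h i; [move=> _; exact: h|exact: h].
Qed.

Lemma setI_closed_oboxes : setI_closed oboxes.
Proof.
move=> _ _ [[a b] _ <-] [[c d] _ <-] /=.
exists ((fun i => Num.max (a i) (c i)), (fun i => Num.min (b i) (d i))) => //=.
apply/seteqP; split=> [x h|x [h1 h2] i].
  by split=> i; have := h i; rewrite /= !in_itv /= gt_max lt_min => /andP[/andP[h1 h2] /andP[h3 h4]]; apply/andP.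
have := h1 i; have := h2 i; rewrite /= !in_itv /= gt_max lt_min.
by move=> /andP[-> ->] /andP[-> ->].
Qed.

Lemma rV_norm_le x i : `|x ord0 i| <= `|x|.
Proof. by rewrite [leRHS]/Num.norm /= mx_normrE; apply/bigmax_geP; right; exists (ord0, i). Qed.

Lemma rV_norm_lt x (e : R) : 0 < e -> (forall i, `|x ord0 i| < e) -> `|x| < e.
Proof.
move=> e0 xe; rewrite [ltLHS]/Num.norm /= mx_normrE; apply: bigmax_lt => // -[k i] _ /=.
by rewrite (ord1 k).
Qed.

Definition cube (M : R) := obox (fun=> - M) (fun=> M).

Lemma cubeP (M : R) x : cube M x <-> forall i, `|x ord0 i| < M.
Proof. by split=> h i; have := h i; rewrite /= in_itv /= ltr_norml. Qed.

Lemma norm_cube (M : R) x : `|x| < M -> cube M x.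
Proof. by move=> xM; apply/cubeP => i; exact: le_lt_trans (rV_norm_le x i) xM. Qed.

Lemma bigcup_cube : \bigcup_k cube k%:R = setT.
Proof.
apply/seteqP; split=> // x _; exists (Num.truncn `|x|).+1 => //.
by apply: norm_cube; rewrite truncnS_gt.
Qed.

Lemma measurable_oboxesE : @measurable _ 'rV[R]_n = <<s oboxes>>.
Proof.
apply/seteqP; split; last first.
  by apply: smallest_sub; [exact: sigma_algebra_measurable|move=> _ [[a b] _ <-]; exact: measurable_obox].
have mcoord i : measurable_fun setT
    (fun x : g_sigma_algebraType oboxes => (x : 'rV[R]_n) ord0 i).
  apply: (measurability _ (RGenOInfty.measurableE R)) => _ [_ [a ->] <-].
  (* The half-space [a < x_i] is exhausted by boxes that grow in every direction except downwards
     along [i], where they stop at [a]. *)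
  rewrite setTI (_ : _ @^-1` _ = \bigcup_k obox (fun j => if j == i then a else - k%:R) (fun=> k%:R)).
    apply: bigcup_measurable => k _; apply: sub_sigma_algebra.
    by exists (fun j => if j == i then a else - k%:R, fun=> k%:R).
  apply/seteqP; split=> [x /=|x [k _ /(_ i)]]; rewrite /= !in_itv /= andbT; last first.
    by rewrite eqxx => /andP[].
  move=> ax; have : setT (x : 'rV[R]_n) by [].
  rewrite -bigcup_cube => -[k _ xk]; exists k => // j.
  by have := xk j; rewrite /= !in_itv /= => /andP[h1 ->]; case: eqP => [->|_]; rewrite ?ax// h1.
apply: smallest_sub; first exact: smallest_sigma_algebra.
move=> A; rewrite -bigcup_seq => -[i _ [B mB <-]].
exact: (mcoord i measurableT B mB).
Qed.

Lemma lebesgue_obox a b :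
  mu (obox a b) = (\prod_(i < n) lebesgue_measure `]a i, b i[%classic)%E.
Proof.
by apply: (@lebesgue_rV_box R n (fun i => `]a i, b i[%classic)) => i; exact: measurable_itv.
Qed.

Lemma lebesgue_obox_lty a b : (mu (obox a b) < +oo)%E.
Proof.
rewrite lebesgue_obox.
have [r [r0 ->]] : exists r : R, 0 <= r /\
    (\prod_(i < n) lebesgue_measure `]a i, b i[%classic)%E = r%:E.
  elim/big_ind : _ => [|_ _ [r [r0 ->]] [s [s0 ->]]|i _].
  - by exists 1.
  - by exists (r * s); rewrite mulr_ge0// EFinM.
  - rewrite lebesgue_measure_itv /= lte_fin; case: ifPn => ab.
      by exists (b i - a i); rewrite subr_ge0 (ltW ab).
    by exists 0.
exact: ltry.
Qed.

Lemma measurable_translate v : measurable_fun setT (fun x : 'rV[R]_n => x + v).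
Proof.
apply/measurable_fun_rVP => i; under eq_fun do rewrite mxE.
by apply: measurable_funD; [exact: measurable_rV_coord|exact: measurable_cst].
Qed.

Definition translate_measure v : {measure set 'rV[R]_n -> \bar R} :=
  measure_function_pushforward__canonical__measure_function_Measure
    mu (measurable_translate v).

(** Both measures agree on open boxes, a pi-system containing an exhaustion of the space by cubes of
    finite measure, hence they agree everywhere. *)
Lemma lebesgue_translate v A : measurable A ->
  translate_measure v A = mu A.
Proof.
move=> mA.
apply: (@g_sigma_algebra_measure_unique _ _ _ oboxes _ (fun k => cube k%:R) _ _ (translate_measure v) mu).
- by move=> _ [[a b] _ <-]; exact: measurable_obox.
- by move=> k; exists (fun=> - k%:R, fun=> k%:R).
- exact: bigcup_cube.
- exact: setI_closed_oboxes.
- move=> _ [[a b] _ <-]; rewrite /translate_measure /= /pushforward.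
  rewrite (_ : _ @^-1` _ = obox (fun i => a i - v ord0 i) (fun i => b i - v ord0 i)).
    rewrite !lebesgue_obox; apply: eq_bigr => i _; rewrite !lebesgue_measure_itv /= !lte_fin.
    rewrite ltrD2r; case: ifPn => // _; rewrite -!EFinD; congr _%:E; ring.
  apply/seteqP; split=> x h i; have := h i; rewrite /= !in_itv /= !mxE.
    by rewrite ltrBlDr ltrBrDr.
  by rewrite ltrBlDr ltrBrDr.
- move=> k; rewrite /translate_measure /= /pushforward.
  rewrite (_ : _ @^-1` _ = obox (fun i => - k%:R - v ord0 i) (fun i => k%:R - v ord0 i)).
    exact: lebesgue_obox_lty.
  apply/seteqP; split=> x h i; have := h i; rewrite /= !in_itv /= !mxE.
    by rewrite ltrBlDr ltrBrDr.
  by rewrite ltrBlDr ltrBrDr.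
- by rewrite -measurable_oboxesE.
Qed.

Lemma ge0_integral_translate v (f : 'rV[R]_n -> \bar R) :
  measurable_fun setT f -> (forall x, 0 <= f x)%E ->
  (\int[mu]_x f (x + v)%R = \int[mu]_x f x)%E.
Proof.
move=> mf f0.
have := @ge0_integral_pushforward _ _ _ _ _ _ (measurable_translate v) mu setT f
  measurableT mf (fun y _ => f0 y).
rewrite preimage_setT /comp => <-.
refine (@eq_measure_integral _ _ _ setT mu (translate_measure v) _ _) => A mA _; by exact: lebesgue_translate.
Qed.

Lemma integrable_translate v (f : 'rV[R]_n -> \bar R) :
  mu.-integrable setT f -> mu.-integrable setT (fun x => f (x + v)).
Proof.
move=> /integrableP[mf fi]; apply/integrableP; split.
  exact: (measurableT_comp mf (measurable_translate v)).
rewrite (ge0_integral_translate v (f := fun x => `|f x|%E))//.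
exact: measurableT_comp.
Qed.

Lemma Rintegral_translate v (f : 'rV[R]_n -> R) :
  mu.-integrable setT (EFin \o f) ->
  \int[mu]_x f (x + v) = \int[mu]_x f x.
Proof.
move=> fi; congr fine.
have mf := measurable_int _ fi.
have := @integral_pushforward _ _ _ _ _ _ (measurable_translate v) mu setT (EFin \o f)
  mf (integrable_translate v fi) measurableT.
rewrite preimage_setT => <-.
refine (@eq_measure_integral _ _ _ setT mu (translate_measure v) _ _) => A mA _; by exact: lebesgue_translate.
Qed.

(** The sigma-algebra is generated by the coordinates and not by the open sets, so an open set has
    to be written as the countable union of the boxes with rational endpoints that it contains. *)
Lemma continuous_measurable_rV (f : 'rV[R]_n -> R) :
  continuous f -> measurable_fun setT f.
Proof.
move=> cf; apply: (measurability _ (RGenOInfty.measurableE R)) => _ [_ [a ->] <-].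
rewrite setTI; set U := _ @^-1` _.
have oU : open U by move/continuousP : cf; apply; exact: interval_open.
pose B (q : {ffun 'I_n -> rat * rat}) :=
  obox (fun i => ratr (q i).1) (fun i => ratr (q i).2).
rewrite (_ : U = \bigcup_(q in [set: {ffun 'I_n -> rat * rat}])
   (if `[< B q `<=` U >] then B q else set0)).
  apply: countable_bigcupT_measurable; first exact: countableP.
  by move=> q; case: ifPn => // _; exact: measurable_obox.
apply/seteqP; split; last first.
  by move=> x [q _]; case: ifPn => // /asboolP; exact.
move=> x Ux.
have [e /= e0 eU] : exists2 e : R, 0 < e & forall y, `|x - y| < e -> U y.
  have : nbhs x U by exact: open_nbhs_nbhs.
  by move=> /nbhs_ballP[e e0 h]; exists e => // y xy; apply: h; rewrite -ball_normE.
have /choice[q qP] : forall i, exists q : rat * rat,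
    x ord0 i - e < ratr q.1 < x ord0 i /\ x ord0 i < ratr q.2 < x ord0 i + e.
  move=> i.
  have [|q] := @rat_in_itvoo R (x ord0 i - e) (x ord0 i); first by rewrite ltrBlDr ltrDl.
  have [|p] := @rat_in_itvoo R (x ord0 i) (x ord0 i + e); first by rewrite ltrDl.
  by rewrite !in_itv /=; exists (q, p).
exists [ffun i => q i] => //.
have sub : B [ffun i => q i] `<=` U.
  move=> y By; apply: eU; apply: rV_norm_lt => // i; rewrite !mxE.
  have := By i; rewrite /= ffunE in_itv /= => /andP[h1 h2].
  have [/andP[h3 h4] /andP[h5 h6]] := qP i.
  rewrite ltr_norml; apply/andP; split; lra.
rewrite ifT; last exact/asboolP.
move=> i; rewrite /= ffunE in_itv /=.
by have [/andP[_ ->] /andP[-> _]] := qP i.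
Qed.

End lebesgue_rV_theory.

(** * Integrals of products of functions of one coordinate *)

Section product_integral.
Context {R : realType}.

(** The measure in dimension [n.+1] is by definition the image of a product under [cons_rV], so
    Tonelli splits off the first coordinate. It serves to show that [lorentzian] is
    square-integrable. *)
Lemma ge0_integral_prod n (g : 'I_n -> R -> R) :
  (forall i, measurable_fun setT (g i)) -> (forall i t, 0 <= g i t) ->
  (\int[@lebesgue_rV R n]_x (\prod_i g i (x ord0 i))%:E =
   \prod_i \int[lebesgue_measure]_t (g i t)%:E)%E.
Proof.
elim: n g => [|n IH] g mg g0.
  rewrite big_ord0; under eq_integral do rewrite big_ord0.
  by rewrite integral_cst//= mul1e diracT.
have mprod m (h : 'I_m -> R -> R) : (forall i, measurable_fun setT (h i)) ->
    measurable_fun setT (fun x : 'rV[R]_m => \prod_i h i (x ord0 i)).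
  by move=> mh; apply: measurable_prod => i _; apply: measurableT_comp => //; exact: measurable_rV_coord.
rewrite big_ord_recl -IH//; set P := (X in (_ * X)%E).
rewrite [LHS](@ge0_integral_pushforward _ _ _ _ _ _ (@measurable_cons_rV R n)
  (lebesgue_measure \x @lebesgue_rV R n)%E)//; last 2 first.
- by apply/measurable_EFinP; exact: (mprod n.+1 g).
- by move=> x _; rewrite lee_fin prodr_ge0.
rewrite preimage_setT.
pose F (p : measurableTypeR R * 'rV[R]_n) :=
  ((g ord0 p.1)%:E * (\prod_i g (lift ord0 i) (p.2 ord0 i))%:E)%E.
rewrite (@eq_integral _ _ _ _ _ F); last first.
  move=> p _; rewrite /F /= big_ord_recl EFinM mxE unlift_none; congr (_ * _%:E)%E.
  by apply: eq_bigr => i _; rewrite mxE liftK.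
have mt := mprod _ (fun i => g (lift ord0 i)) (fun i => mg _).
rewrite fubini_tonelli1/=; last 2 first.
- apply: emeasurable_funM; apply/measurable_EFinP.
    exact: measurableT_comp (mg ord0) measurable_fst.
  exact: measurableT_comp mt measurable_snd.
- by move=> p; rewrite mule_ge0// lee_fin ?prodr_ge0.
rewrite /fubini_F -ge0_integralZr//; last 3 first.
- by apply/measurable_EFinP; exact: mg.
- by move=> t _; rewrite lee_fin.
- by apply: integral_ge0 => x _; rewrite lee_fin prodr_ge0.
apply: eq_integral => t _; rewrite /F /= ge0_integralZl//.
- by apply/measurable_EFinP; exact: mt.
- by move=> x _; rewrite lee_fin prodr_ge0.
- by rewrite lee_fin.
Qed.

End product_integral.

(** * Square-integrable functions *)

Section square_integrable.
Context d (T : measurableType d) {R : realType} (mu : {measure set T -> \bar R}).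
Implicit Types (f g h w : T -> R).

Definition intg f := mu.-integrable setT (EFin \o f).

Definition sq_int f := measurable_fun setT f /\ intg (fun x => f x ^+ 2).

Lemma intgD f g : intg f -> intg g -> intg (fun x => f x + g x).
Proof. by move=> fi gi; have := integrableD measurableT fi gi. Qed.

Lemma intgZ (c : R) f : intg f -> intg (fun x => c * f x).
Proof. by move=> fi; have := integrableZl measurableT c fi. Qed.

Lemma intg_le f g : measurable_fun setT f -> (forall x, `|f x| <= g x) ->
  intg g -> intg f.
Proof.
move=> mf fg; apply: le_integrable => //; first exact/measurable_EFinP.
by move=> x _; rewrite lee_fin (le_trans (fg x))// ler_norm.
Qed.

Lemma intg_sum (I : Type) (s : seq I) (F : I -> T -> R) :
  (forall i, intg (F i)) -> intg (fun x => \sum_(i <- s) F i x).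
Proof.
move=> Fi; elim: s => [|i s IH].
  by under eq_fun do rewrite big_nil; exact: integrable0.
by under eq_fun do rewrite big_cons; exact: intgD.
Qed.

Lemma Rintegral_sum (I : Type) (s : seq I) (F : I -> T -> R) :
  (forall i, intg (F i)) ->
  \int[mu]_x (\sum_(i <- s) F i x) = \sum_(i <- s) \int[mu]_x F i x.
Proof.
move=> Fi; elim: s => [|i s IH].
  rewrite big_nil; under eq_Rintegral do rewrite big_nil.
  by rewrite /Rintegral integral0.
rewrite big_cons -IH -RintegralD//; [|exact: Fi|exact: intg_sum].
by apply: eq_Rintegral => x _; rewrite big_cons.
Qed.

Lemma measurable_sqr f : measurable_fun setT f -> measurable_fun setT (fun x => f x ^+ 2).
Proof. exact: measurable_funX. Qed.

Lemma sq_intP f : measurable_fun setT f ->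
  intg (fun x => f x ^+ 2) <-> (\int[mu]_x (f x ^+ 2)%:E < +oo)%E.
Proof.
move=> mf; split=> [/integrableP[_]|fi].
  by under eq_integral do rewrite /= ger0_norm ?sqr_ge0//.
apply/integrableP; split; first exact/measurable_EFinP/measurable_sqr.
by under eq_integral do rewrite /= ger0_norm ?sqr_ge0//.
Qed.

Lemma sq_intM f g : sq_int f -> sq_int g -> intg (fun x => f x * g x).
Proof.
move=> [mf fi] [mg gi]; apply: (intg_le _ _ (intgD fi gi)).
  exact: measurable_funM.
move=> x; rewrite ler_norml; apply/andP; split.
  by have := sqr_ge0 (f x + g x); have := sqr_ge0 (f x); have := sqr_ge0 (g x); nra.
by have := sqr_ge0 (f x - g x); have := sqr_ge0 (f x); have := sqr_ge0 (g x); nra.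
Qed.

Lemma sq_intD f g : sq_int f -> sq_int g -> sq_int (fun x => f x + g x).
Proof.
move=> [mf fi] [mg gi]; split; first exact: measurable_funD.
apply: (intg_le _ _ (intgD (intgZ 2 fi) (intgZ 2 gi))).
  exact/measurable_sqr/measurable_funD.
by move=> x; rewrite ger0_norm ?sqr_ge0//; have := sqr_ge0 (f x - g x); nra.
Qed.

Lemma sq_int_bounded w f C : measurable_fun setT w -> (forall x, `|w x| <= C) ->
  sq_int f -> sq_int (fun x => w x * f x).
Proof.
move=> mw wC [mf fi]; split; first exact: measurable_funM.
apply: (intg_le _ _ (intgZ (C ^+ 2) fi)); first exact/measurable_sqr/measurable_funM.
move=> x; rewrite ger0_norm ?sqr_ge0// exprMn ler_wpM2r ?sqr_ge0//.
by rewrite -real_normK ?num_real// lerXn2r ?nnegrE// (le_trans _ (wC x)).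
Qed.

Lemma sq_intZ (c : R) f : sq_int f -> sq_int (fun x => c * f x).
Proof. by apply: (@sq_int_bounded (fun=> c) f `|c|). Qed.

Lemma sq_intB f g : sq_int f -> sq_int g -> sq_int (fun x => f x - g x).
Proof.
move=> fi /(sq_intZ (-1)) gi; have := sq_intD fi gi.
by under eq_fun do rewrite mulN1r.
Qed.

Lemma sq_int0 : sq_int (fun=> 0).
Proof.
split; first exact: measurable_cst.
by under eq_fun do rewrite expr0n; exact: integrable0.
Qed.

Lemma sq_int_sum (I : Type) (s : seq I) (F : I -> T -> R) :
  (forall i, sq_int (F i)) -> sq_int (fun x => \sum_(i <- s) F i x).
Proof.
move=> Fi; elim: s => [|i s IH].
  by under eq_fun do rewrite big_nil; exact: sq_int0.
by under eq_fun do rewrite big_cons; exact: sq_intD.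
Qed.

Lemma sq_int_sqr f : sq_int f -> intg (fun x => f x ^+ 2).
Proof. by case. Qed.

Lemma sq_int_le f g : measurable_fun setT f -> (forall x, `|f x| <= g x) ->
  sq_int g -> sq_int f.
Proof.
move=> mf fg [mg gi]; split => //; apply: (intg_le _ _ gi); first exact: measurable_sqr.
move=> x; rewrite ger0_norm ?sqr_ge0// -real_normK ?num_real//.
by rewrite lerXn2r ?nnegrE// (le_trans _ (fg x)).
Qed.

Lemma sq_int_indic A : measurable A -> (mu A < +oo)%E -> sq_int (\1_A).
Proof.
move=> mA Aoo; split; first exact: measurable_funTS.
apply: (@intg_le _ (\1_A)); first exact/measurable_sqr/measurable_funTS.
  by move=> x; rewrite indicE; case: (_ \in _); rewrite ?expr0n ?expr1n ?normr0 ?normr1.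
apply/integrableP; split; first exact/measurable_EFinP/measurable_funTS.
rewrite (eq_integral (fun x => (\1_A x)%:E)); last by move=> t _; rewrite gee0_abs// lee_fin.
by rewrite integral_indic// setIT.
Qed.

(** The squared L^2 distance avoids square roots, at the price of a factor 2 in the triangle
    inequality. *)
Definition sqr_dist f g := \int[mu]_x (f x - g x) ^+ 2.

Lemma sqr_dist_ge0 f g : 0 <= sqr_dist f g.
Proof. by apply: Rintegral_ge0 => x _; exact: sqr_ge0. Qed.

Lemma sqr_distD f1 f2 g1 g2 : sq_int f1 -> sq_int f2 -> sq_int g1 -> sq_int g2 ->
  sqr_dist (fun x => f1 x + f2 x) (fun x => g1 x + g2 x) <=
  2 * sqr_dist f1 g1 + 2 * sqr_dist f2 g2.
Proof.
move=> f1i f2i g1i g2i.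
have i1 : intg (fun x => (f1 x - g1 x) ^+ 2) by apply/sq_int_sqr/sq_intB.
have i2 : intg (fun x => (f2 x - g2 x) ^+ 2) by apply/sq_int_sqr/sq_intB.
rewrite /sqr_dist -!RintegralZl// -RintegralD//; [|exact: intgZ..].
apply: le_Rintegral => //.
- by apply/sq_int_sqr/sq_intB; exact: sq_intD.
- by apply: intgD; exact: intgZ.
- by move=> x _; have := sqr_ge0 (f1 x - g1 x - (f2 x - g2 x)); nra.
Qed.

Lemma sqr_distZ (c : R) f g : sq_int f -> sq_int g ->
  sqr_dist (fun x => c * f x) (fun x => c * g x) = c ^+ 2 * sqr_dist f g.
Proof.
move=> fi gi; rewrite /sqr_dist -RintegralZl//; last exact/sq_int_sqr/sq_intB.
by apply: eq_Rintegral => x _; ring.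
Qed.

Lemma sqr_dist_trans f g h : sq_int f -> sq_int g -> sq_int h ->
  sqr_dist f h <= 2 * sqr_dist f g + 2 * sqr_dist g h.
Proof.
move=> fi gi hi.
have i1 : intg (fun x => (f x - g x) ^+ 2) by apply/sq_int_sqr/sq_intB.
have i2 : intg (fun x => (g x - h x) ^+ 2) by apply/sq_int_sqr/sq_intB.
rewrite /sqr_dist -!RintegralZl// -RintegralD//; [|exact: intgZ..].
apply: le_Rintegral => //.
- exact/sq_int_sqr/sq_intB.
- by apply: intgD; exact: intgZ.
- by move=> x _; have := sqr_ge0 (f x - 2 * g x + h x); nra.
Qed.

Lemma sq_int_dominated (f_ : nat -> T -> R) f g :
  (forall k, measurable_fun setT (f_ k)) -> (forall x, f_ ^~ x @ \oo --> f x) ->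
  (forall k x, `|f_ k x| <= g x) -> sq_int g ->
  sq_int f /\ sqr_dist f (f_ k) @[k --> \oo] --> 0.
Proof.
move=> mf_ f_f f_g gi.
have mf : measurable_fun setT f.
  by apply: (measurable_fun_cvg _ (fun x _ => f_f x)).
have fg x : `|f x| <= g x.
  have : `|f_ k x| @[k --> \oo] --> `|f x| by exact: cvg_norm (f_f x).
  by move=> h; apply: (cvgr_to_le h); apply: nearW => k; exact: f_g.
have fi : sq_int f by exact: sq_int_le fg gi.
split => //.
(* Both [f] and [f_ k] are at most [g] in absolute value, so [(2 g)^2] dominates the squared
   differences. *)
have i4 : intg (fun x => 4 * g x ^+ 2) by apply: intgZ; case: gi.
have [|||||_ _] := @dominated_convergence _ _ _ mu _ measurableT
  (fun k x => ((f x - f_ k x) ^+ 2)%:E) (fun=> 0%E) (fun x => (4 * g x ^+ 2)%:E).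
- by move=> k; apply/measurable_EFinP/measurable_sqr/measurable_funB.
- exact: measurable_cst.
- apply/aeW => x _; apply: cvg_EFin; first exact: nearW.
  rewrite /comp /=; rewrite [X in _ --> X](_ : _ = (f x - f x) ^+ 2); last by rewrite subrr expr0n.
  by apply: (@cvgM _ _ \oo); apply: (@cvgB _ _ _ \oo); [exact: cvg_cst|exact: f_f|exact: cvg_cst|exact: f_f].
- exact: i4.
- apply/aeW => x k _; rewrite lee_fin ger0_norm ?sqr_ge0//.
  have : `|f x - f_ k x| <= 2 * g x.
    by rewrite (le_trans (ler_normB _ _))// mulr_natl mulr2n lerD.
  rewrite -[(f x - _) ^+ 2]real_normK ?num_real// => h.
  by rewrite (_ : 4 * _ = (2 * g x) ^+ 2) ?lerXn2r ?nnegrE ?(le_trans _ h)//; ring.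
rewrite integral0 => h; rewrite /sqr_dist /Rintegral; exact: (fine_cvg h).
Qed.

End square_integrable.

Import HBNNSimple.

(** * Density of test functions in L^2 *)

Section test_functions_dense.
Context {R : realType} {n : nat}.
Implicit Types (f g phi : 'rV[R]_n -> R) (x : 'rV[R]_n) (a b : 'I_n -> R).

Local Notation mu := (@lebesgue_rV R n).

Lemma smooth_measurable f : smooth f -> measurable_fun setT f.
Proof. by move=> /smooth_C1[cf _]; exact: continuous_measurable_rV. Qed.

Lemma sq_int_cube M : sq_int mu (\1_(cube M)).
Proof. by apply: sq_int_indic; [exact: measurable_obox|exact: lebesgue_obox_lty]. Qed.

Lemma test_sq_int phi : test_function phi -> sq_int mu phi.
Proof.
move=> tphi; have [C phiC] := test_bounded tphi.
have /test_functionP[sphi [M HM]] := tphi.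
apply: (@sq_int_le _ _ _ _ _ (fun x => C * \1_(cube (M + 1)) x)).
- exact: smooth_measurable.
- move=> x; have [xM|/HM ->] := leP `|x| M.
    rewrite indicE mem_set ?mulr1//; apply: norm_cube.
    by rewrite (le_lt_trans xM)// ltrDl.
  by rewrite normr0 mulr_ge0// (le_trans _ (phiC 0)).
- exact/sq_intZ/sq_int_cube.
Qed.

(** The L^2 closure of the test functions. Being stable under linear combinations and dominated
    limits, it can be extended from boxes to measurable sets, then to simple functions, then to all
    of L^2. *)
Definition approximable f := sq_int mu f /\
  forall e : R, 0 < e -> exists2 phi, test_function phi & sqr_dist mu f phi <= e.

Lemma approximable_lim f : sq_int mu f ->
  (forall e : R, 0 < e -> exists2 g, approximable g & sqr_dist mu f g <= e) ->
  approximable f.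
Proof.
move=> fi fg; split => // e e0.
have [|g [gi gphi] fge] := fg (e / 4); first by rewrite divr_gt0.
have [|phi tphi phie] := gphi (e / 4); first by rewrite divr_gt0.
exists phi => //.
have := sqr_dist_trans fi gi (test_sq_int tphi).
by lra.
Qed.

Lemma approximable_cvg f (f_ : nat -> 'rV[R]_n -> R) g :
  (forall k, approximable (f_ k)) -> (forall x, f_ ^~ x @ \oo --> f x) ->
  (forall k x, `|f_ k x| <= g x) -> sq_int mu g -> approximable f.
Proof.
move=> Af f_f f_g gi.
have [fi f0] := sq_int_dominated (fun k => (Af k).1.1) f_f f_g gi.
apply: approximable_lim => // e e0.
have /cvgrPdist_le/(_ _ e0) [k _ /(_ k (leqnn k))] := f0.
by rewrite sub0r normrN ger0_norm ?sqr_dist_ge0// => h; exists (f_ k).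
Qed.

Lemma approximableD f g : approximable f -> approximable g ->
  approximable (fun x => f x + g x).
Proof.
move=> [fi Af] [gi Ag]; split; first exact: sq_intD.
move=> e e0.
have [|phi tphi phie] := Af (e / 4); first by rewrite divr_gt0.
have [|psi tpsi psie] := Ag (e / 4); first by rewrite divr_gt0.
exists (fun x => phi x + psi x); first exact: testD.
have := sqr_distD fi gi (test_sq_int tphi) (test_sq_int tpsi).
by lra.
Qed.

Lemma approximableZ (c : R) f : approximable f -> approximable (fun x => c * f x).
Proof.
move=> [fi Af]; split; first exact: sq_intZ.
move=> e e0.
have c0 : 0 < c ^+ 2 + 1 by rewrite ltr_wpDl ?sqr_ge0.
have [|phi tphi phie] := Af (e / (c ^+ 2 + 1)); first by rewrite divr_gt0.
exists (fun x => c * phi x); first exact: testZ.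
rewrite sqr_distZ//; last exact: test_sq_int.
move: phie; rewrite ler_pdivlMr// => h; apply: le_trans h.
by rewrite mulrC ler_wpM2l ?sqr_dist_ge0// lerDl.
Qed.

Lemma approximableB f g : approximable f -> approximable g ->
  approximable (fun x => f x - g x).
Proof.
move=> Af /(approximableZ (-1)) Ag; have := approximableD Af Ag.
by under eq_fun do rewrite mulN1r.
Qed.

Lemma approximable0 : approximable (fun=> 0).
Proof.
split; first exact: sq_int0.
move=> e e0; exists (fun=> 0); first exact: test0.
rewrite /sqr_dist; under eq_Rintegral do rewrite subrr expr0n/=.
by rewrite /Rintegral integral0 ltW.
Qed.

Lemma approximable_sum (I : Type) (s : seq I) (F : I -> 'rV[R]_n -> R) :
  (forall i, approximable (F i)) -> approximable (fun x => \sum_(i <- s) F i x).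
Proof.
move=> AF; elim: s => [|i s IH].
  by under eq_fun do rewrite big_nil; exact: approximable0.
by under eq_fun do rewrite big_cons; exact: approximableD.
Qed.

Lemma flat0_cvg (t : R) : flat 0 (k.+1%:R * t) @[k --> \oo] --> (((0 < t)%R)%:R : R).
Proof.
case: ltP => t0; last first.
  under eq_fun => k do rewrite /flat ltNge mulr_ge0_le0//=.
  exact: cvg_cst.
under eq_fun => k do rewrite /flat pmulr_rgt0// t0 expr0 invr1 mul1r invfM.
rewrite (_ : true%:R = expR (- (0 * t^-1))); last by rewrite mul0r oppr0 expR0.
apply: (@cvg_comp _ _ _ _ expR _ (nbhs (- (0 * t^-1)))); last exact: continuous_expR.
apply: (@cvgN _ _ _ \oo); apply: (@cvgM _ _ \oo); last exact: cvg_cst.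
exact: cvg_harmonic.
Qed.

Lemma approximable_obox a b : approximable (\1_(obox a b)).
Proof.
pose phi k x := \prod_i (flat 0 (affine i k.+1%:R (a i) x) *
                         flat 0 (affine i (- k.+1%:R) (b i) x)).
have bi : sq_int mu (\1_(obox a b)).
  by apply: sq_int_indic; [exact: measurable_obox|exact: lebesgue_obox_lty].
have phi_out k x : ~ obox a b x -> phi k x = 0.
  move=> xab; have [ i ] : exists i, ~ (`]a i, b i[%classic (x ord0 i)) by exact/existsNP.
  rewrite /= in_itv/= => /negP; rewrite negb_and -!leNgt => h.
  rewrite /phi (bigD1 i)//= /flat /affine.
  case/orP: h => h.
    by rewrite ltNge mulr_ge0_le0 ?subr_le0//= !mul0r.
  by rewrite [X in _ * (if X then _ else _)]ltNge mulr_le0_ge0 ?subr_ge0 ?oppr_le0//= mulr0 mul0r.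
apply: (@approximable_cvg _ phi (\1_(obox a b))) => //.
- move=> k.
  suff tphi : test_function (phi k).
    split; first exact: test_sq_int.
    move=> e e0; exists (phi k) => //; rewrite /sqr_dist.
    under eq_Rintegral do rewrite subrr expr0n/=.
    by rewrite /Rintegral integral0 ltW.
  apply/test_functionP; split.
    apply: smooth_prod => i; apply: smoothM.
      by have [] := bsmooth_coord i k.+1%:R (a i) (bsmooth1_flat 0).
    by have [] := bsmooth_coord i (- k.+1%:R) (b i) (bsmooth1_flat 0).
  (* The sum dominates every coordinate of a point of the box; the 1 keeps the radius positive even
     in dimension 0. *)
  exists (1 + \sum_i (`|a i| + `|b i|)) => x xM; apply: phi_out => xab.
  move: xM; apply/negP; rewrite -leNgt ltW//; apply: rV_norm_lt.
    by rewrite ltr_wpDr// sumr_ge0// => i _; rewrite addr_ge0.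
  move=> i; rewrite (bigD1 i)//=.
  have : 0 <= \sum_(j < n | j != i) (`|a j| + `|b j|).
    by apply: sumr_ge0 => j _; rewrite addr_ge0.
  have := xab i; rewrite /= in_itv/= => /andP[h1 h2] s0.
  have := ler_norm (b i); have := ler_norm (- a i); rewrite normrN.
  have := normr_ge0 (b i); have := normr_ge0 (a i).
  by move=> *; rewrite ltr_norml; apply/andP; split; lra.
- move=> x.
  rewrite (_ : \1_(obox a b) x =
      \prod_i (((0 < x ord0 i - a i)%R)%:R * ((0 < b i - x ord0 i)%R)%:R)); last first.
    rewrite indicE; case: (boolP (x \in _)) => [/set_mem xab|/negP xab].
      rewrite big1// => i _; have := xab i.
      by rewrite /= in_itv/= -(subr_gt0 (a i)) -(subr_gt0 _ (b i)) => /andP[-> ->]; rewrite mulr1.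
    have [ i ] : exists i, ~ (`]a i, b i[%classic (x ord0 i)).
      by apply/existsNP => h; apply: xab; exact: mem_set.
    rewrite /= in_itv/= => /negP h; rewrite (bigD1 i)//=.
    rewrite -natrM mulnb !subr_gt0 (negbTE h) mul0r//.
  apply: cvg_big => //; first exact: mul_continuous.
  move=> i _; apply: (@cvgM _ _ \oo).
    exact: flat0_cvg.
  rewrite /affine; under eq_fun do rewrite mulNr -mulrN opprB.
  exact: flat0_cvg.
- move=> k x; rewrite indicE; case: (boolP (x \in _)) => [/set_mem xab|/negP xab]; last first.
    by rewrite phi_out ?normr0// => h; apply: xab; exact: mem_set.
  have ge0 i : 0 <= flat 0 (affine i k.+1%:R (a i) x) * flat 0 (affine i (- k.+1%:R) (b i) x).
    by rewrite mulr_ge0// flat_ge0.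
  rewrite ger0_norm ?prodr_ge0//; apply: prodr_ile1 => i _; rewrite ge0/=.
  by rewrite mulr_ile1 ?flat_ge0 ?flat0_le1.
Qed.

(** Cutting by a cube keeps the complements square-integrable, which is what the induction from the
    pi-system of boxes requires. *)
Lemma approximable_setI_cube (A : set 'rV[R]_n) M : measurable A ->
  approximable (\1_(A `&` cube M)).
Proof.
move=> mA.
have cubeA : approximable (\1_(cube M)) by exact: approximable_obox.
apply: (@dynkin_induction _ 'rV[R]_n oboxes (fun A => approximable (\1_(A `&` cube M)))).
- exact: measurable_oboxesE.
- exact: setI_closed_oboxes.
- by rewrite setTI.
- move=> _ [[a b] _ <-].
  have [[c d] _ <-] : oboxes (obox a b `&` cube M).
    by apply: setI_closed_oboxes; [exists (a, b)|exists (fun=> - M, fun=> M)].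
  exact: approximable_obox.
- move=> S mS AS; have := approximableB cubeA AS.
  rewrite (_ : (fun x => _) = \1_(~` S `&` cube M))//; apply/funext => x.
  rewrite !indicE !in_setI in_setC.
  by case: (x \in S); case: (x \in cube M); rewrite /= ?subr0 ?subrr.
- move=> F mF tF AF.
  (* By disjointness the partial sums are themselves indicators, hence dominated by the indicator of
     the cube. *)
  pose s k x := \sum_(j <- iota 0 k) \1_(F j `&` cube M) x : R.
  have sE k x : s k x = ((x \in cube M) && [exists j : 'I_k, x \in F j])%:R.
    rewrite /s (_ : iota 0 k = index_iota 0 k) ?big_mkord; last by rewrite /index_iota subn0.
    case: (boolP (x \in cube M)) => xM /=; last first.
      by apply: big1 => j _; rewrite indicE in_setI (negbTE xM) andbF.
    case: (boolP [exists j : 'I_k, x \in F j]) => [/existsP[j xj]|/existsPn xF]; last first.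
      by apply: big1 => j _; rewrite indicE in_setI (negbTE (xF j)).
    rewrite (bigD1 j)//= indicE in_setI xj xM big1 ?addr0// => i ij.
    rewrite indicE in_setI; case: (boolP (x \in F i)) => //= xi.
    have := tF i j I I; move=> /(_ _)/val_inj h.
    have /h/eqP : F i `&` F j !=set0 by exists x; split; exact: set_mem.
    by rewrite (negbTE ij).
  apply: (@approximable_cvg _ s (\1_(cube M))); last exact: sq_int_cube.
  + by move=> k; exact: approximable_sum.
  + move=> x; rewrite indicE in_setI andbC.
    case: (boolP (x \in \bigcup_k F k)) => [/set_mem[j _ xj]|xF].
      apply: cvg_near_cst; exists j.+1 => // k /= jk; rewrite sE; congr (_ && _)%:R.
      by apply/existsP; exists (Ordinal jk); exact: mem_set.
    apply: cvg_near_cst; apply: nearW => k; rewrite sE; congr (_ && _)%:R.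
    apply/negbTE/existsPn => j; apply: contra xF => /set_mem xj; apply/mem_set.
    by exists j.
  + move=> k x; rewrite sE indicE; case: (x \in cube M) => /=; last by rewrite normr0.
    by case: existsP => _; rewrite ?normr1 ?normr0.
- by rewrite -measurable_oboxesE.
Qed.

Lemma cvg_indic_cube x : \1_(cube k%:R) x @[k --> \oo] --> (1 : R).
Proof.
apply: cvg_near_cst; exists (Num.truncn `|x|).+1 => // k /= xk.
rewrite indicE mem_set//; apply: norm_cube.
by rewrite (lt_le_trans (truncnS_gt _))// ler_nat.
Qed.

(** Simple functions increasing to [f] are truncated to growing cubes; each is then a finite
    combination of indicators already treated, and [f] itself dominates. *)
Lemma approximable_ge0 f : sq_int mu f -> (forall x, 0 <= f x) -> approximable f.
Proof.
move=> fi f0.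
have mf : measurable_fun setT (EFin \o f) by apply/measurable_EFinP; case: fi.
have f0' x : setT x -> (0 <= (EFin \o f) x)%E by move=> _; rewrite lee_fin.
pose hs k := nnsfun_approx measurableT mf k.
pose h k : 'rV[R]_n -> R := hs k.
have hf k x : 0 <= h k x <= f x.
  by rewrite /h fun_ge0/= -lee_fin /hs nnsfun_approxE; exact: le_approx.
apply: (@approximable_cvg _ (fun k x => h k x * \1_(cube k%:R) x) f) => //.
- move=> k.
  have -> : (fun x => h k x * \1_(cube k%:R) x) = (fun x =>
      \sum_(y <- finmap.enum_fset (fset_set (range (h k))))
         y * \1_((h k @^-1` [set y]) `&` cube k%:R) x).
    apply/funext => x; rewrite [h k x]fimfunE fsbig_finite//= mulr_suml.
    by apply: eq_bigr => y _; rewrite indicI/= mulrA.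
  by apply: approximable_sum => y; exact/approximableZ/approximable_setI_cube.
- move=> x; rewrite -[f x]mulr1; apply: (@cvgM _ _ \oo); last exact: cvg_indic_cube.
  have := cvg_nnsfun_approx measurableT mf f0' (x := x) I.
  exact: fine_cvg.
- move=> k x; have /andP[h0 hle] := hf k x.
  rewrite indicE ger0_norm ?mulr_ge0//.
  by case: (_ \in _); rewrite ?mulr1 ?mulr0// (le_trans h0).
Qed.

Theorem test_functions_dense f (e : R) : sq_int mu f -> 0 < e ->
  exists2 phi, test_function phi & sqr_dist mu f phi <= e.
Proof.
move=> fi e0; suff [_ ] : approximable f by exact.
have mf : measurable_fun setT f by case: fi.
have -> : f = (fun x => Num.max (f x) 0 - Num.max (- f x) 0).
  by apply/funext => x; rewrite !maxEle oppr_le0; case: (leP (f x) 0); case: (leP 0 (f x)); lra.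
apply: approximableB; apply: approximable_ge0.
- apply: (@sq_int_le _ _ _ _ _ (fun x => `|f x|)).
  + by apply: measurable_maxr => //; exact: measurable_cst.
  + by move=> x; rewrite maxEle; case: ifPn => _; rewrite ?normr0.
  + split; first exact: measurableT_comp.
    by under eq_fun do rewrite real_normK ?num_real//; case: fi.
- by move=> x; rewrite le_max lexx orbT.
- apply: (@sq_int_le _ _ _ _ _ (fun x => `|f x|)).
  + by apply: measurable_maxr; [exact: measurableT_comp|exact: measurable_cst].
  + by move=> x; rewrite maxEle; case: ifPn => _; rewrite ?normr0 ?normrN.
  + split; first exact: measurableT_comp.
    by under eq_fun do rewrite real_normK ?num_real//; case: fi.
- by move=> x; rewrite le_max lexx orbT.
Qed.

End test_functions_dense.

(** * Weak derivatives and integration by parts *)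

Section weak_derivatives.
Context {R : realType} {n : nat}.
Implicit Types (f g w phi : 'rV[R]_n -> R) (x : 'rV[R]_n) (i j : 'I_n).

Local Notation mu := (@lebesgue_rV R n).
Local Notation e_ i := (delta_mx ord0 i : 'rV[R]_n).

(** It comes from expanding [(eta |f| - |g|)^2 >= 0]. Used in place of the Cauchy-Schwarz
    inequality, it keeps every estimate linear in the squared norms, and [eta] decides which factor
    gets the small coefficient. *)
Lemma young_Rintegral f g (eta : R) : sq_int mu f -> sq_int mu g -> 0 < eta ->
  `|\int[mu]_x (f x * g x)| <=
  eta / 2 * \int[mu]_x (f x ^+ 2) + (2 * eta)^-1 * \int[mu]_x (g x ^+ 2).
Proof.
move=> fi gi eta0.
have fgi := sq_intM fi gi; have [_ f2] := fi; have [_ g2] := gi.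
apply: (le_trans (le_normr_Rintegral measurableT fgi)).
rewrite -!RintegralZl// -RintegralD//; [|exact: intgZ..].
apply: le_Rintegral => //.
- by have := integrable_norm fgi.
- by apply: intgD; exact: intgZ.
move=> x _.
have fg0 : 0 <= (2 * eta)^-1 * (eta * `|f x| - `|g x|) ^+ 2.
  by rewrite mulr_ge0 ?sqr_ge0// invr_ge0 mulr_ge0 ?ltW.
rewrite -[f x ^+ 2]real_normK ?num_real// -[g x ^+ 2]real_normK ?num_real// normrM.
rewrite -subr_ge0; apply: le_trans fg0 _; rewrite le_eqVlt; apply/orP; left; apply/eqP.
by field; rewrite gt_eqF.
Qed.

(** Local integrability is asked for, and not L^2, so that [f = 1] is allowed in
    [is_derive_pairing]; this case gives [Rintegral_partial]. *)
Definition loc_int f := measurable_fun setT f /\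
  forall M : R, intg mu (fun x => `|f x| * \1_(cube M) x).

Lemma loc_int_cst (c : R) : loc_int (fun=> c).
Proof.
split; first exact: measurable_cst.
move=> M; apply: intgZ; have [_ ci] := @sq_int_cube R n M.
apply: (intg_le _ _ ci); first by have [] := @sq_int_cube R n M.
by move=> x; rewrite indicE; case: (_ \in _); rewrite ?expr1n ?expr0n ?normr0 ?normr1.
Qed.

Lemma sq_int_loc_int f : sq_int mu f -> loc_int f.
Proof.
move=> [mf fi]; split => // M; apply: sq_intM; last exact: sq_int_cube.
split; first exact: measurableT_comp.
by under eq_fun do rewrite real_normK ?num_real//.
Qed.

Lemma is_derive_line f (v x : 'rV[R]_n) (s : R) : derivable f (s *: v + x) v ->
  is_derive s 1 (fun h : R => f (h *: v + x)) ('D_v f (s *: v + x)).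
Proof.
have E : (fun h : R => h^-1 *: (f ((h *: (1 : R) + s) *: v + x) - f (s *: v + x))) =
         (fun h : R => h^-1 *: (f (h *: v + (s *: v + x)) - f (s *: v + x))).
  by apply/funext => h; rewrite [h *: 1]mulr1 scalerDl addrA.
by move=> df; split; [move: df|]; rewrite /derivable /derive /= /shift /=  E.
Qed.

(** Differentiation under the integral sign. The translation acts on the test function, so nothing
    is asked of the regularity of [f]. *)
Lemma is_derive_pairing i f phi (s : R) : loc_int f -> test_function phi ->
  is_derive s 1 (fun t => \int[mu]_x (f x * phi (t *: e_ i + x)))
    (\int[mu]_x (f x * partial i phi (s *: e_ i + x))).
Proof.
move=> [mf fi] tphi.
have tdphi := test_partial i tphi.
have /test_functionP[_ [M0 HM0]] := tphi.
have /test_functionP[_ [M1 HM1]] := tdphi.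
have [C phiC] := test_bounded tphi; have [C1 dphiC] := test_bounded tdphi.
(* For [|t - s| < 1] a shift by [t] moves the supports by at most [|s| + 1]; the remaining 1 makes
   the inequality strict. All integrands thus live in one cube, as domination requires. *)
pose M := Num.max M0 M1 + `|s| + 2.
have out psi (t : R) x (P : R) : (forall x, P < `|x| -> psi x = 0) -> P <= Num.max M0 M1 ->
    `]s - 1, s + 1[%classic t -> ~ cube M x -> psi (t *: e_ i + x) = 0 :> R.
  move=> HP PM; rewrite /= in_itv/= => /andP[t1 t2] xM; apply: HP.
  rewrite ltNge; apply/negP => le; apply: xM; apply/cubeP => j.
  have := le_trans (rV_norm_le _ j) le; rewrite !mxE eqxx/= => h.
  have tn : `|t * (j == i)%:R| <= `|s| + 1.
    rewrite normrM normr_nat (@le_trans _ _ `|t|)//.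
      by case: (j == i); rewrite ?mulr1 ?mulr0.
    by have := ler_norm s; have := ler_norm (- s); rewrite normrN => *; rewrite ler_norml; apply/andP; split; lra.
  have : `|x ord0 j| <= P + (`|s| + 1).
    rewrite -[x ord0 j](addKr (t * (j == i)%:R)) addrC.
    by rewrite (le_trans (ler_normB _ _))// lerD.
  by rewrite /M; lra.
have mint psi (t : R) : test_function psi ->
    measurable_fun setT (fun x => f x * psi (t *: e_ i + x)).
  move=> tpsi; apply: measurable_funM => //.
  have := smooth_measurable (test_smooth (test_translate (t *: e_ i) tpsi)).
  by congr (measurable_fun _ _); apply/funext => x; rewrite addrC.
have bnd psi (K : R) (t : R) x (P : R) : (forall x, `|psi x| <= K) ->
    (forall x, P < `|x| -> psi x = 0) -> P <= Num.max M0 M1 ->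
    `]s - 1, s + 1[%classic t ->
    `|f x * psi (t *: e_ i + x)| <= K * (`|f x| * \1_(cube M) x).
  move=> psiK HP PM st; rewrite indicE normrM.
  have [xM|xM] := boolP (x \in cube M).
    by rewrite mulr1 mulrC ler_wpM2r.
  rewrite (out psi t x P)// ?normr0 ?mulr0 ?mul0r//.
  by move=> h; move/negP: xM; apply; exact: mem_set.
have dline (t : R) x : is_derive t 1 (fun h : R => f x * phi (h *: e_ i + x))
    (f x * partial i phi (t *: e_ i + x)).
  have d1 : is_derive t 1 (fun h : R => phi (h *: e_ i + x)) (partial i phi (t *: e_ i + x)).
    by apply: is_derive_line; have [_] := smooth_C1 (test_smooth tphi); exact.
  have := @is_deriveZ _ _ _ _ (f x) _ _ _ d1; exact.
have si : `]s - 1, s + 1[%classic s by rewrite /= in_itv/=; apply/andP; split; lra.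
have h1 : forall t : R, `]s - 1, s + 1[%classic t ->
    intg mu (fun x => f x * phi (t *: e_ i + x)).
  move=> t st; apply: (@intg_le _ _ _ _ _ (fun x => C * (`|f x| * \1_(cube M) x))).
  - exact: mint.
  - by move=> x; apply: (bnd _ _ _ _ M0) => //; rewrite le_max lexx.
  - exact: intgZ.
have h2 : forall (t : R) x, `]s - 1, s + 1[%classic t -> setT x ->
    derivable (fun t : R => f x * phi (t *: e_ i + x)) t 1.
  by move=> t x _ _; exact: (@ex_derive _ _ _ _ _ _ _ (dline t x)).
have h3 : forall x, 0 <= C1 * (`|f x| * \1_(cube M) x).
  by move=> x; rewrite !mulr_ge0// (le_trans _ (dphiC 0)).
have h4 : intg mu (fun x => C1 * (`|f x| * \1_(cube M) x)) by exact: intgZ.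
have dE (t : R) x : partial1of2 (fun (t : R) x => f x * phi (t *: e_ i + x)) t x =
    f x * partial i phi (t *: e_ i + x).
  by rewrite partial1of2E; exact: (@derive_val _ _ _ _ _ _ _ (dline t x)).
have h5 : forall (t : R) x, `]s - 1, s + 1[%classic t -> setT x ->
    `|partial1of2 (fun (t : R) x => f x * phi (t *: e_ i + x)) t x| <= C1 * (`|f x| * \1_(cube M) x).
  by move=> t x st _; rewrite dE; apply: (bnd _ _ _ _ M1) => //; rewrite le_max lexx orbT.
have := @cvg_differentiation_under_integral R _ _ mu
  (fun (t : R) x => f x * phi (t *: e_ i + x)) setT measurableT s (s - 1) (s + 1) si
  h1 h2 (fun x => C1 * (`|f x| * \1_(cube M) x)) h3 h4 h5.
rewrite (_ : \int[mu]_x partial1of2 _ s x = \int[mu]_x (f x * partial i phi (s *: e_ i + x))); last first.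
  by apply: eq_Rintegral => x _; exact: dE.
move=> Hcv.
have Hcv' : h^-1 *: (\int[mu]_x (f x * phi ((h *: (1 : R) + s) *: e_ i + x)) -
     \int[mu]_x (f x * phi (s *: e_ i + x))) @[h --> 0^'] -->
     \int[mu]_x (f x * partial i phi (s *: e_ i + x)).
  by under eq_fun do rewrite [_ *: (1 : R)]mulr1; exact: Hcv.
split; first by apply/cvg_ex; eexists; exact: Hcv'.
exact: cvg_lim Hcv'.
Qed.

Lemma test_intg phi : test_function phi -> intg mu phi.
Proof.
move=> tphi; have [C phiC] := test_bounded tphi.
have /test_functionP[sphi [M HM]] := tphi.
have [_ /(_ (M + 1)) ci] := loc_int_cst C.
apply: (intg_le _ _ ci); first exact: smooth_measurable.
move=> x; rewrite indicE; have [xM|/HM ->] := leP `|x| M; last by rewrite normr0 mulr_ge0.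
rewrite mem_set ?mulr1; first exact: le_trans (phiC x) (ler_norm _).
by apply: norm_cube; rewrite (le_lt_trans xM)// ltrDl.
Qed.

(** By translation invariance the integral of [phi(. + t e_i)] does not depend on [t], and the
    integral of the partial derivative is its derivative at [t = 0]. *)
Lemma Rintegral_partial i phi : test_function phi -> \int[mu]_x partial i phi x = 0.
Proof.
move=> tphi.
have d := is_derive_pairing i 0 (loc_int_cst 1) tphi.
have E : (fun t : R => \int[mu]_x (1 * phi (t *: e_ i + x))) = (fun=> \int[mu]_x phi x).
  apply/funext => t; under eq_Rintegral do rewrite mul1r addrC.
  by rewrite Rintegral_translate//; exact: test_intg.
rewrite E in d.
have := @derive_val _ _ _ _ _ _ _ d; rewrite derive_cst => /esym.
by under eq_Rintegral do rewrite mul1r scale0r add0r.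
Qed.

Definition weak_partial i f g := [/\ sq_int mu f, sq_int mu g &
  forall phi, test_function phi ->
    \int[mu]_x (f x * partial i phi x) = - \int[mu]_x (g x * phi x)].

Lemma sq_int_test f phi : sq_int mu f -> test_function phi ->
  intg mu (fun x => f x * phi x).
Proof. by move=> fi /test_sq_int; exact: sq_intM. Qed.

Lemma weak_partial_smooth i f : smooth f -> sq_int mu f -> sq_int mu (partial i f) ->
  weak_partial i f (partial i f).
Proof.
move=> sf fi dfi; split => // phi tphi.
have := Rintegral_partial i (testMl sf tphi).
rewrite partialM; [|exact: smooth_C1|exact/smooth_C1/test_smooth].
rewrite RintegralD//.
- move/eqP; rewrite addr_eq0 => /eqP ->; congr (- _).
  by apply: eq_Rintegral => x _; rewrite mulrC.
- exact: (sq_int_test fi (test_partial i tphi)).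
- by have := sq_int_test dfi tphi; under eq_fun do rewrite mulrC.
Qed.

(** Test the definition of the weak derivative of [f] with [w * phi], which is again a test
    function. *)
Lemma weak_partialM i w f g : bsmooth w -> weak_partial i f g ->
  weak_partial i (fun x => w x * f x) (fun x => w x * g x + partial i w x * f x).
Proof.
move=> bw [fi gi fg].
have [C wC] := bsmooth_bounded bw; have [C' wC'] := bsmooth_bounded (bsmooth_partial i bw).
have [sw _] := bw; have [sdw _] := bsmooth_partial i bw.
have mw := smooth_measurable sw; have mdw := smooth_measurable sdw.
have wgi := sq_int_bounded mw wC gi; have dwf := sq_int_bounded mdw wC' fi.
have wfi := sq_int_bounded mw wC fi.
split => //; first exact: sq_intD.
move=> phi tphi.
have := fg _ (testMl sw tphi).
rewrite partialM; [|exact: smooth_C1|exact/smooth_C1/test_smooth].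
move=> H.
rewrite (_ : \int[mu]_x ((w x * g x + partial i w x * f x) * phi x) =
   \int[mu]_x (g x * (w x * phi x)) + \int[mu]_x (partial i w x * f x * phi x)); last first.
  rewrite -RintegralD//.
  - by apply: eq_Rintegral => x _; ring.
  - by have := sq_int_test wgi tphi; congr (intg _ _); apply/funext => x; ring.
  - exact: sq_int_test.
rewrite opprD -H.
rewrite (_ : \int[mu]_x (f x * (w x * partial i phi x + phi x * partial i w x)) =
   \int[mu]_x (w x * f x * partial i phi x) + \int[mu]_x (partial i w x * f x * phi x)).
  by rewrite addrK.
rewrite -RintegralD//.
- by apply: eq_Rintegral => x _; ring.
- exact: (sq_int_test wfi (test_partial i tphi)).
- exact: sq_int_test.
Qed.

Lemma sq_int_translate (v : 'rV[R]_n) f : sq_int mu f -> sq_int mu (fun x => f (x + v)).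
Proof.
move=> [mf fi]; split; first exact: (measurableT_comp mf (measurable_translate v)).
exact: (integrable_translate v fi).
Qed.

Lemma Rintegral_sqr_translate (v : 'rV[R]_n) f : sq_int mu f ->
  \int[mu]_x (f (x + v) ^+ 2) = \int[mu]_x (f x ^+ 2).
Proof. by move=> [mf fi]; exact: (Rintegral_translate v fi). Qed.

(** The shift by [- h] makes this the adjoint of the usual quotient with step [h]; it therefore
    tends to minus the weak derivative. *)
Definition diff_quot i (h : R) f x := h^-1 * (f (x - h *: e_ i) - f x).

Lemma sq_int_diff_quot i h f : sq_int mu f -> sq_int mu (diff_quot i h f).
Proof. by move=> fi; apply: sq_intZ; apply: sq_intB => //; exact: sq_int_translate. Qed.

Lemma diff_quot_pairing i h f g : sq_int mu f -> sq_int mu g ->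
  \int[mu]_x (diff_quot i h f x * g x) =
  h^-1 * (\int[mu]_x (f x * g (h *: e_ i + x)) - \int[mu]_x (f x * g x)).
Proof.
move=> fi gi.
have i1 := sq_intM fi gi.
have i2 : intg mu (fun x => f x * g (x + h *: e_ i)).
  by apply: sq_intM => //; exact: sq_int_translate.
have i3 : intg mu (fun x => f (x - h *: e_ i) * g x).
  by apply: sq_intM => //; exact: sq_int_translate.
under [X in _ * (X - _)]eq_Rintegral do rewrite addrC.
rewrite -(Rintegral_translate (- (h *: e_ i)) i2).
under [X in _ * (X - _)]eq_Rintegral do rewrite subrK.
rewrite -RintegralB// -RintegralZl//.
  by apply: eq_Rintegral => x _; rewrite /diff_quot; ring.
by have := intgD i3 (intgZ (-1) i1); under eq_fun do rewrite mulN1r.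
Qed.

(* The pairing [t |-> \int f(x) phi(x + t e_i)] has derivative bounded by the
   right-hand side at every [t], because [phi(. + t e_i)] is a test function
   with the same L^2 norm; then apply the mean value theorem. *)
Lemma diff_quot_test_bound i h f f' phi : weak_partial i f f' -> test_function phi ->
  h != 0 -> `|\int[mu]_x (diff_quot i h f x * phi x)| <=
    2^-1 * \int[mu]_x (f' x ^+ 2) + 2^-1 * \int[mu]_x (phi x ^+ 2).
Proof.
move=> [fi f'i ff'] tphi h0.
rewrite diff_quot_pairing//; last exact: test_sq_int.
pose G t := \int[mu]_x (f x * phi (t *: e_ i + x)).
pose dG t := \int[mu]_x (f x * partial i phi (t *: e_ i + x)).
set K := (X in _ <= X).
have GdG t : is_derive t (1 : R) G (dG t).
  exact: is_derive_pairing (sq_int_loc_int fi) tphi.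
have dGK t : `|dG t| <= K.
  have tphit := test_translate (t *: e_ i) tphi.
  rewrite /dG; under eq_Rintegral do rewrite addrC.
  have := ff' _ tphit; have := partials_translate [:: i] (t *: e_ i) phi => /= ->.
  move=> ->; rewrite normrN.
  have := young_Rintegral f'i (test_sq_int tphit) ltr01.
  rewrite Rintegral_sqr_translate; last exact: test_sq_int.
  by rewrite mulr1 mul1r.
have cG : continuous G.
  move=> t; apply: differentiable_continuous; apply/derivable1_diffP.
  exact: (@ex_derive _ _ _ _ _ _ _ (GdG t)).
have -> : \int[mu]_x (f x * phi x) = G 0.
  by apply: eq_Rintegral => x _; rewrite scale0r add0r.
rewrite -/(G h) normrM normfV ler_pdivrMl ?normr_gt0// mulrC.
have [hn|hp|h00] := ltgtP h 0; last by rewrite h00 eqxx in h0.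
- have [c _] := MVT hn (fun t _ => GdG t) (continuous_subspaceT cG).
  rewrite sub0r => Gh; rewrite distrC Gh normrM normrN ler_wpM2r//.
- have [c _] := MVT hp (fun t _ => GdG t) (continuous_subspaceT cG).
  by rewrite subr0 => ->; rewrite normrM ler_wpM2r.
Qed.

(* Test the previous bound with [phi] close to the difference quotient itself. *)
Lemma diff_quot_bound i f f' : weak_partial i f f' ->
  exists K : R, forall h, h != 0 -> \int[mu]_x (diff_quot i h f x ^+ 2) <= K.
Proof.
move=> ff'; have [fi f'i _] := ff'.
(* Let [Q], [P], [G] be the squared norms of [q], [phi], [f'], with [phi] at squared distance at
   most 1 from [q]. Then [Q <= G/2 + P/2 + Q/8 + 2] and [P <= 5Q/4 + 5], so the right-hand side
   contains [3Q/4]; absorbing it leaves [Q <= 2G + 18]. *)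
exists (2 * \int[mu]_x (f' x ^+ 2) + 18) => h h0.
have qi := sq_int_diff_quot i h fi; set q := diff_quot i h f in qi *.
have [phi tphi qphi] := test_functions_dense qi ltr01.
have phii := test_sq_int tphi.
have B := diff_quot_test_bound ff' tphi h0; rewrite -/q in B.
have di := sq_intB qi phii.
have E1 : \int[mu]_x (q x ^+ 2) = \int[mu]_x (q x * phi x) + \int[mu]_x (q x * (q x - phi x)).
  rewrite -RintegralD//; [|exact: sq_intM..].
  by apply: eq_Rintegral => x _; ring.
have E2 : \int[mu]_x (phi x ^+ 2) <= 5 / 4 * \int[mu]_x (q x ^+ 2) + 5 * sqr_dist mu q phi.
  rewrite /sqr_dist -!RintegralZl//; [|by case: di|by case: qi].
  rewrite -RintegralD//; [|by apply: intgZ; case: di qi => ? ? [? ?]..].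
  apply: le_Rintegral => //.
  - by case: phii.
  - by apply: intgD; apply: intgZ; [case: qi|case: di].
  - by move=> x _; have := sqr_ge0 (5 * (phi x - q x) - phi x); nra.
have e4 : (0 : R) < 4^-1 by rewrite invr_gt0.
have Y := young_Rintegral qi di e4.
have := ler_norm (\int[mu]_x (q x * (q x - phi x))).
have := ler_norm (\int[mu]_x (q x * phi x)).
move: Y; rewrite -/(sqr_dist mu q phi).
have -> : (2 * 4^-1)^-1 = 2 :> R by field.
have -> : 4^-1 / 2 = 8^-1 :> R by field.
by lra.
Qed.

Lemma diff_quot_cvg i f f' g : weak_partial i f f' -> sq_int mu g ->
  \int[mu]_x (diff_quot i h f x * g x) @[h --> 0^'] --> - \int[mu]_x (f' x * g x).
Proof.
move=> ff' gi; have [fi f'i ff'E] := ff'.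
have [K0 HK0] := diff_quot_bound ff'.
have [K KE] : exists K : R, K = 2 * K0 + 2 * \int[mu]_x (f' x ^+ 2) + 1 by eexists.
have K0ge : 0 <= K0.
  by apply: le_trans (HK0 1 (oner_neq0 _)); apply: Rintegral_ge0 => x _; exact: sqr_ge0.
have f'ge : 0 <= \int[mu]_x (f' x ^+ 2) by apply: Rintegral_ge0 => x _; exact: sqr_ge0.
have Kgt : 0 < K.
  rewrite KE; move: f'ge K0ge; clear; move: (\int[mu]_x (f' x ^+ 2)) => I; lra.
apply/cvgrPdist_le => e e0.
(* [K] bounds the squared norm of [diff_quot i h f + f']. Young's inequality with weight [e / K],
   for [phi] within [eta * (e / 2)] of [g], costs [e/2 + e/4]; the last [e/4] is left for the
   convergence tested on [phi]. *)
have [eta etaE] : exists eta : R, eta = e / K by eexists.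
have eta0 : 0 < eta by rewrite etaE divr_gt0.
have [|phi tphi phie] := test_functions_dense gi (_ : 0 < eta * (e / 2)).
  by rewrite mulr_gt0// divr_gt0.
have phii := test_sq_int tphi; have di := sq_intB gi phii.
have cvphi : \int[mu]_x (diff_quot i h f x * phi x) @[h --> 0^'] --> - \int[mu]_x (f' x * phi x).
  have [/cvg_ex[l lcv] lE] := is_derive_pairing i 0 (sq_int_loc_int fi) tphi.
  have := etrans (esym (cvg_lim (@Rhausdorff R) lcv)) lE.
  under eq_Rintegral do rewrite scale0r add0r.
  rewrite ff'E// => <-; apply: cvg_trans lcv; apply: near_eq_cvg; apply: nearW => h.
  rewrite diff_quot_pairing//= addr0 [h *: (1 : R)]mulr1.
  congr (_ * (_ - _)); apply: eq_Rintegral => x _; by rewrite scale0r add0r.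
have e4 : 0 < e / 4 by rewrite divr_gt0.
have /cvgrPdist_le/(_ _ e4) near1 := cvphi.
near=> h.
have h0 : h != 0 by near: h; exact: nbhs_dnbhs_neq.
have qi := sq_int_diff_quot i h fi.
have B1 : `|(- \int[mu]_x (f' x * phi x)) - \int[mu]_x (diff_quot i h f x * phi x)| <= e / 4.
  by near: h.
have si := sq_intD qi f'i.
have Y := young_Rintegral si di eta0.
have S : \int[mu]_x ((diff_quot i h f x + f' x) ^+ 2) <= K.
  apply: (@le_trans _ _ (2 * \int[mu]_x (diff_quot i h f x ^+ 2) + 2 * \int[mu]_x (f' x ^+ 2))).
    rewrite -!RintegralZl//; [|by case: f'i|by case: qi].
    rewrite -RintegralD//; [|by apply: intgZ; case: qi f'i => ? ? [? ?]..].
    apply: le_Rintegral => //.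
    - by case: si.
    - by apply: intgD; apply: intgZ; [case: qi|case: f'i].
    - by move=> x _; have := sqr_ge0 (diff_quot i h f x - f' x); nra.
  move: (HK0 h h0); rewrite KE; clear.
  move: (\int[mu]_x (diff_quot i h f x ^+ 2)) (\int[mu]_x (f' x ^+ 2)) => I J; lra.
have E : (- \int[mu]_x (f' x * g x)) - \int[mu]_x (diff_quot i h f x * g x) =
   ((- \int[mu]_x (f' x * phi x)) - \int[mu]_x (diff_quot i h f x * phi x)) -
   \int[mu]_x ((diff_quot i h f x + f' x) * (g x - phi x)).
  have -> : \int[mu]_x ((diff_quot i h f x + f' x) * (g x - phi x)) =
     (\int[mu]_x (diff_quot i h f x * g x) - \int[mu]_x (diff_quot i h f x * phi x)) +
     (\int[mu]_x (f' x * g x) - \int[mu]_x (f' x * phi x)).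
    rewrite -!RintegralB//; [|exact: sq_intM..].
    rewrite -RintegralD//.
    - by apply: eq_Rintegral => x _; ring.
    - have := sq_intM qi di; congr (intg _ _); apply/funext => x; ring.
    - have := sq_intM f'i di; congr (intg _ _); apply/funext => x; ring.
  by ring.
rewrite E (le_trans (ler_normB _ _))//.
rewrite (_ : e = e / 4 + 3 / 4 * e); last by field.
apply: lerD => //; apply: (le_trans Y).
have -> : 3 / 4 * e = eta / 2 * K + (2 * eta)^-1 * (eta * (e / 2)).
  by rewrite etaE; field; rewrite !gt_eqF.
apply: lerD; first by rewrite ler_wpM2l// divr_ge0// ltW.
by rewrite ler_wpM2l// invr_ge0 mulr_ge0// ltW.
Unshelve. all: end_near. Qed.

Lemma diff_quot_adjoint i h f g : sq_int mu f -> sq_int mu g ->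
  \int[mu]_x (diff_quot i h f x * g x) = - \int[mu]_x (diff_quot i (- h) g x * f x).
Proof.
move=> fi gi; rewrite [in RHS]diff_quot_pairing//.
have i1 : intg mu (fun x => g x * f x) by exact: sq_intM.
have i2 : intg mu (fun x => g x * f (- h *: e_ i + x)).
  have := sq_intM gi (sq_int_translate (- h *: e_ i) fi).
  by congr (intg _ _); apply/funext => x; rewrite addrC.
rewrite -RintegralB// invrN mulNr opprK -RintegralZl//.
  by apply: eq_Rintegral => x _; rewrite /diff_quot scaleNr (addrC x); ring.
by have := intgD i2 (intgZ (-1) i1); under eq_fun do rewrite mulN1r.
Qed.

Theorem weak_integration_by_parts i f f' g g' :
  weak_partial i f f' -> weak_partial i g g' ->
  \int[mu]_x (f' x * g x) = - \int[mu]_x (f x * g' x).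
Proof.
move=> ff' gg'; have [fi _ _] := ff'; have [gi _ _] := gg'.
have /cvgr_dnbhsP c1 := diff_quot_cvg ff' gi.
have /cvgr_dnbhsP c2 := diff_quot_cvg gg' fi.
(* The adjoint of the quotient with step [h] has step [- h]. Comparing the two limits along [u] and
   [- u] is enough, since both are known to exist. *)
pose u (k : nat) : R := k.+1%:R^-1.
have u0 : u @ \oo --> 0 by exact: cvg_harmonic.
have uP k : u k != 0 by rewrite invr_eq0 pnatr_eq0.
have {}c1 := c1 u (conj uP u0).
have {}c2 : \int[mu]_x (diff_quot i (- u k) g x * f x) @[k --> \oo] -->
    - (\int[mu]_x (g' x * f x)).
  apply: (c2 (fun k => - u k)); split; first by move=> k; rewrite oppr_eq0.
  by rewrite -oppr0; exact: cvgN.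
have c3 : \int[mu]_x (diff_quot i (u k) f x * g x) @[k --> \oo] -->
    \int[mu]_x (g' x * f x).
  rewrite -[X in _ --> X]opprK; under eq_fun do rewrite diff_quot_adjoint//.
  exact: cvgN.
have := cvg_lim (@Rhausdorff R) c3; rewrite (cvg_lim (@Rhausdorff R) c1) => E.
by under [in RHS]eq_Rintegral do rewrite mulrC; rewrite -E opprK.
Qed.

End weak_derivatives.

(** * Energy, Morawetz and virial identities *)

Section helmholtz.
Context {R : realType} {n : nat}.
Implicit Types (f g b w phi : 'rV[R]_n -> R) (x y : 'rV[R]_n) (i j p : 'I_n).

Local Notation mu := (@lebesgue_rV R n).

Lemma sq_int_bsmooth b f : bsmooth b -> sq_int mu f -> sq_int mu (fun x => b x * f x).
Proof.
move=> bb fi; have [C bC] := bsmooth_bounded bb; have [sb _] := bb.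
exact: sq_int_bounded (smooth_measurable sb) bC fi.
Qed.

Lemma intg_bsmooth b f g : bsmooth b -> sq_int mu f -> sq_int mu g ->
  intg mu (fun x => b x * f x * g x).
Proof. by move=> bb fi gi; exact: (sq_intM (sq_int_bsmooth bb fi) gi). Qed.

Lemma weighted_integration_by_parts j b f f' g g' : bsmooth b ->
  weak_partial j f f' -> weak_partial j g g' ->
  \int[mu]_x (b x * f' x * g x) =
  - (\int[mu]_x (b x * f x * g' x) + \int[mu]_x (partial j b x * f x * g x)).
Proof.
move=> bb ff' gg'; have [fi f'i _] := ff'; have [gi g'i _] := gg'.
have := weak_integration_by_parts ff' (weak_partialM bb gg').
rewrite (_ : \int[mu]_x (b x * f' x * g x) = \int[mu]_x (f' x * (b x * g x))) => [->|]; last first.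
  by apply: eq_Rintegral => x _; ring.
rewrite -RintegralD//; [|exact: intg_bsmooth|exact: intg_bsmooth (bsmooth_partial j bb) fi gi].
by congr (- _); apply: eq_Rintegral => x _; ring.
Qed.

(* Differentiate [\int f d_j phi(. + t e_i) = - \int g phi(. + t e_i)] at [t = 0]. *)
Lemma weak_partial_mixed i j f g phi : weak_partial j f g -> test_function phi ->
  \int[mu]_x (f x * partial i (partial j phi) x) = - \int[mu]_x (g x * partial i phi x).
Proof.
move=> [fi gi fg] tphi.
have d1 := is_derive_pairing i 0 (sq_int_loc_int fi) (test_partial j tphi).
have d2 := is_derive_pairing i 0 (sq_int_loc_int gi) tphi.
have E : (fun t : R => \int[mu]_x (f x * partial j phi (t *: delta_mx ord0 i + x))) =
    - (fun t : R => \int[mu]_x (g x * phi (t *: delta_mx ord0 i + x))).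
  apply/funext => t; have := fg _ (test_translate (t *: delta_mx ord0 i) tphi).
  have /= -> := partials_translate [:: j] (t *: delta_mx ord0 i) phi; move=> H.
  under eq_Rintegral do rewrite addrC.
  rewrite H; congr (- _); apply: eq_Rintegral => x _; by rewrite addrC.
have at0 u psi : \int[mu]_x (u x * psi (0 *: delta_mx ord0 i + x)) =
    \int[mu]_x (u x * psi x) :> R.
  by apply: eq_Rintegral => x _; rewrite scale0r add0r.
rewrite -(at0 f) -(at0 g); apply: etrans (esym (@derive_val _ _ _ _ _ _ _ d1)) _.
by rewrite E; exact: (@derive_val _ _ _ _ _ _ _ (is_deriveN d2)).
Qed.

(* [H i j] is the weak derivative [d_j d_i f]; the last clause is the symmetry
   of mixed derivatives. *)
Definition sobolev2 f (D : 'I_n -> 'rV[R]_n -> R) (H : 'I_n -> 'I_n -> 'rV[R]_n -> R) :=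
  [/\ forall i, weak_partial i f (D i),
      forall i j, weak_partial j (D i) (H i j) &
      forall i j, weak_partial i (D j) (H i j)].

Variables (f : 'rV[R]_n -> R) (D : 'I_n -> 'rV[R]_n -> R)
  (H : 'I_n -> 'I_n -> 'rV[R]_n -> R).
Hypothesis fDH : sobolev2 f D H.
Hypothesis fi : sq_int mu f.

Let Di i : sq_int mu (D i). Proof. by have [/(_ i)[]] := fDH. Qed.
Let Hi i j : sq_int mu (H i j). Proof. by have [_ /(_ i j)[]] := fDH. Qed.
Let fD i : weak_partial i f (D i). Proof. by have [] := fDH. Qed.
Let DH i j : weak_partial j (D i) (H i j). Proof. by have [] := fDH. Qed.
Let DH' i j : weak_partial i (D j) (H i j). Proof. by have [] := fDH. Qed.

Definition helmholtz (k2 : R) x := \sum_j H j j x + k2 * f x.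

Lemma sq_int_helmholtz k2 : sq_int mu (helmholtz k2).
Proof. by apply: sq_intD; [exact: sq_int_sum|exact: sq_intZ]. Qed.

Lemma helmholtz_pairing k2 g : sq_int mu g ->
  \int[mu]_x (helmholtz k2 x * g x) =
  \sum_j \int[mu]_x (H j j x * g x) + k2 * \int[mu]_x (f x * g x).
Proof.
move=> gi; rewrite -RintegralZl//; last exact: sq_intM.
rewrite -Rintegral_sum; last by move=> j; exact: sq_intM.
rewrite -RintegralD//.
- by apply: eq_Rintegral => x _; rewrite /helmholtz mulrDl mulr_suml mulrA.
- by apply: intg_sum => j; exact: sq_intM.
- by apply: intgZ; exact: sq_intM.
Qed.

Lemma gradient_laplacian j :
  \int[mu]_x (D j x ^+ 2) = - \int[mu]_x (H j j x * f x).
Proof.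
rewrite (weak_integration_by_parts (DH j j) (fD j)) opprK.
by apply: eq_Rintegral => x _; rewrite expr2.
Qed.

Lemma Rintegral_helmholtz_sqr k2 :
  \int[mu]_x (helmholtz k2 x ^+ 2) = \int[mu]_x ((\sum_j H j j x) ^+ 2) -
    2 * k2 * \sum_j \int[mu]_x (D j x ^+ 2) + k2 ^+ 2 * \int[mu]_x (f x ^+ 2).
Proof.
have Li : sq_int mu (fun x => \sum_j H j j x) by exact: sq_int_sum.
under [X in _ - _ * X]eq_bigr do rewrite gradient_laplacian.
rewrite sumrN mulrN opprK.
have -> : \sum_j \int[mu]_x (H j j x * f x) = \int[mu]_x ((\sum_j H j j x) * f x).
  rewrite -Rintegral_sum; last by move=> j; exact: sq_intM.
  by apply: eq_Rintegral => x _; rewrite mulr_suml.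
have i1 := sq_int_sqr fi; have i2 := sq_intM Li fi; have i3 := sq_int_sqr Li.
have i4 := intgZ (2 * k2) i2; have i5 := intgZ (k2 ^+ 2) i1; have i6 := intgD i3 i4.
rewrite -!RintegralZl// -RintegralD// -RintegralD//.
by apply: eq_Rintegral => x _; rewrite /helmholtz; ring.
Qed.

(** [f * D j] is half the derivative of [f^2], expressed without differentiating the square. *)
Lemma weighted_self j b : bsmooth b ->
  2 * \int[mu]_x (b x * f x * D j x) = - \int[mu]_x (partial j b x * f x * f x).
Proof.
move=> bb; have := weighted_integration_by_parts bb (fD j) (fD j).
have -> : \int[mu]_x (b x * D j x * f x) = \int[mu]_x (b x * f x * D j x).
  by apply: eq_Rintegral => x _; ring.
by move: (Rintegral _ _ _) (Rintegral _ _ _) => I J; lra.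
Qed.

(** Integrating by parts along [j] produces [a * D j * H p j]. By the symmetry of the mixed
    derivatives [H p j] is also the derivative of [D j] along [p], so this product is [a / 2] times
    the derivative of [D j ^ 2]. *)
Lemma morawetz_term j p a : bsmooth a ->
  \int[mu]_x (a x * H j j x * D p x) =
  2^-1 * \int[mu]_x (partial p a x * D j x * D j x) -
  \int[mu]_x (partial j a x * D j x * D p x).
Proof.
move=> ba.
have E1 := weighted_integration_by_parts ba (DH j j) (DH p j).
have E2 := weighted_integration_by_parts ba (DH' p j) (DH' p j).
have E3 : \int[mu]_x (a x * H p j x * D j x) = \int[mu]_x (a x * D j x * H p j x).
  by apply: eq_Rintegral => x _; ring.
rewrite E3 in E2; move: E1 E2.
move: (Rintegral _ _ _) (Rintegral _ _ _) (Rintegral _ _ _) (Rintegral _ _ _) => I J K L.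
by lra.
Qed.

(* The multiplier [a D_p f + (1/2) (d_p a) f] is skew-adjoint up to its
   commutator with the Laplacian, which cancels the zeroth order term [k2 f]. *)
Lemma morawetz_identity k2 p a : bsmooth a ->
  (forall j, j != p -> partial j a = fun=> 0) ->
  (forall j, j != p -> partial j (partial p a) = fun=> 0) ->
  \int[mu]_x (helmholtz k2 x * (a x * D p x + 2^-1 * (partial p a x * f x))) =
  4^-1 * \int[mu]_x (partial p (partial p (partial p a)) x * f x * f x) -
  \int[mu]_x (partial p a x * D p x * D p x).
Proof.
move=> ba a0 w0.
set w := partial p a; have bw : bsmooth w by exact: bsmooth_partial.
have bw' : bsmooth (partial p w) by exact: bsmooth_partial.
have aDi := sq_int_bsmooth ba (Di p); have wfi := sq_int_bsmooth bw fi.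
rewrite helmholtz_pairing; last by apply: sq_intD => //; exact: sq_intZ.
have split_ g : sq_int mu g ->
    \int[mu]_x (g x * (a x * D p x + 2^-1 * (w x * f x))) =
    \int[mu]_x (a x * g x * D p x) + 2^-1 * \int[mu]_x (w x * g x * f x).
  move=> gi; rewrite -RintegralZl//; last exact: intg_bsmooth.
  rewrite -RintegralD//; [|exact: intg_bsmooth|exact/intgZ/intg_bsmooth].
  by apply: eq_Rintegral => x _; ring.
rewrite split_//.
have zero b u v : b = (fun=> 0) -> \int[mu]_x (b x * u x * v x) = 0 :> R.
  move=> ->; under eq_Rintegral do rewrite !mul0r.
  by rewrite /Rintegral integral0.
(* The coefficient 1/2 in the multiplier is the one for which the [D j ^ 2] terms cancel when
   [j != p]. For [j = p] the two halves contribute [-1/2] each. *)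
have T j : \int[mu]_x (H j j x * (a x * D p x + 2^-1 * (w x * f x))) =
    - (if j == p then \int[mu]_x (w x * D p x * D p x) +
         2^-1 * \int[mu]_x (partial p w x * f x * D p x) else 0).
  rewrite split_// morawetz_term//.
  have := weighted_integration_by_parts bw (DH j j) (fD j).
  have [->|jp] := eqVneq j p.
    rewrite -/w => ->.
    have -> : \int[mu]_x (partial p w x * D p x * f x) = \int[mu]_x (partial p w x * f x * D p x).
      by apply: eq_Rintegral => x _; ring.
    by move: (Rintegral _ _ _) (Rintegral _ _ _) => I J; lra.
  move=> ->; rewrite (zero (partial j a))//; last exact: a0.
  rewrite (zero (partial j w))//; last exact: w0.
  by move: (Rintegral _ _ _) => I; lra.
under eq_bigr do rewrite T.
rewrite sumrN -big_mkcond /= big_pred1_eq.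
have := weighted_self p ba; have := weighted_self p bw'; rewrite -/w.
move: (\int[mu]_x (partial p (partial p w) x * f x * f x))
  (\int[mu]_x (partial p w x * f x * D p x)) (\int[mu]_x (w x * f x * f x))
  (\int[mu]_x (w x * D p x * D p x)) (\int[mu]_x (a x * f x * D p x)) => I1 I2 I3 I4 I5.
move=> E1 E2; have -> : I1 = - 2 * I2 by lra.
(* This makes the zeroth order contribution [k2 * (I5 + I3 / 2)] vanish, so the identity no longer
   involves [k2] on its right-hand side. *)
have -> : I3 = - 2 * I5 by lra.
by field.
Qed.

(** One derivative moves from [H j j] to [b * f]; the remainder [d_j b * f * D j] is half a weighted
    derivative of [f^2] and becomes the second derivative of [b]. *)
Lemma virial_identity k2 b : bsmooth b ->
  \int[mu]_x (helmholtz k2 x * (b x * f x)) =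
  k2 * \int[mu]_x (b x * f x * f x) - \sum_j \int[mu]_x (b x * D j x * D j x) +
  2^-1 * \sum_j \int[mu]_x (partial j (partial j b) x * f x * f x).
Proof.
move=> bb; rewrite helmholtz_pairing; last exact: sq_int_bsmooth.
have T j : \int[mu]_x (H j j x * (b x * f x)) =
   (- \int[mu]_x (b x * D j x * D j x)) + 2^-1 * \int[mu]_x (partial j (partial j b) x * f x * f x).
  have := weighted_integration_by_parts bb (DH j j) (fD j).
  have -> : \int[mu]_x (H j j x * (b x * f x)) = \int[mu]_x (b x * H j j x * f x).
    by apply: eq_Rintegral => x _; ring.
  have := weighted_self j (bsmooth_partial j bb).
  have -> : \int[mu]_x (partial j b x * D j x * f x) = \int[mu]_x (partial j b x * f x * D j x).
    by apply: eq_Rintegral => x _; ring.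
  move=> E ->; move: E; move: (Rintegral _ _ _) (Rintegral _ _ _) (Rintegral _ _ _) => I J K; lra.
under eq_bigr do rewrite T.
rewrite big_split /= sumrN -mulr_sumr.
have -> : \int[mu]_x (f x * (b x * f x)) = \int[mu]_x (b x * f x * f x).
  by apply: eq_Rintegral => x _; ring.
by ring.
Qed.

End helmholtz.

(** * Local estimates *)

Section lorentz_weight.
Context {R : realType} {n : nat}.
Implicit Types (f g : 'rV[R]_n -> R) (x y : 'rV[R]_n) (i j p : 'I_n) (d : R).

Lemma partialZ i (c : R) f : C1 f -> partial i (fun x => c * f x) = (fun x => c * partial i f x).
Proof.
move=> cf; rewrite partialM//; last exact: C1_cst.
by rewrite partial_cst; apply/funext => x; rewrite mulr0 addr0.
Qed.

Lemma partial_indep j f : (forall (h : R) x, f (h *: delta_mx ord0 j + x) = f x) ->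
  partial j f = fun=> 0.
Proof.
move=> fj; apply/funext => x; rewrite /partial derive_line.
by under eq_fun do rewrite fj; exact: derive_cst.
Qed.

Lemma partial_atan j p d (a : R) :
  partial j (fun x => atan (affine p d a x)) = (fun x => d *+ (j == p) * lorentz1 (affine p d a x)).
Proof. by apply: partial_coord => t; exact: is_derive1_atan. Qed.

Lemma partial_lorentz1 j p d (a : R) :
  partial j (fun x => lorentz1 (affine p d a x)) =
  (fun x => d *+ (j == p) * (- 2 * (lorentz1 (affine p d a x) * odd_lorentz1 (affine p d a x)))).
Proof. by rewrite (partial_coord _ _ _ _ is_derive_lorentz1). Qed.

Lemma partial_odd_lorentz1 j p d (a : R) :
  partial j (fun x => odd_lorentz1 (affine p d a x)) =
  (fun x => d *+ (j == p) * (lorentz1 (affine p d a x) +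
    - 2 * (odd_lorentz1 (affine p d a x) * odd_lorentz1 (affine p d a x)))).
Proof. by rewrite (partial_coord _ _ _ _ is_derive_odd_lorentz1). Qed.

Lemma bsmooth_atan p d (a : R) : bsmooth (fun x => atan (affine p d a x)).
Proof. exact/bsmooth_coord/bsmooth1_atan. Qed.

Lemma bsmooth_lorentz1 p d (a : R) : bsmooth (fun x => lorentz1 (affine p d a x)).
Proof. exact/bsmooth_coord/bsmooth1_lorentz1. Qed.

Lemma bsmooth_odd_lorentz1 p d (a : R) : bsmooth (fun x => odd_lorentz1 (affine p d a x)).
Proof. exact/bsmooth_coord/bsmooth1_odd_lorentz1. Qed.

(* Its derivatives are bounded by multiples of [d] times itself, it lies below
   each of its one-coordinate factors, and it is square-integrable. *)
Definition lorentzian d y x := \prod_j lorentz1 (affine j d (y ord0 j) x).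

Lemma bsmooth_lorentzian d y : bsmooth (lorentzian d y).
Proof. by apply: bsmooth_prod => j; exact: bsmooth_lorentz1. Qed.

Lemma lorentzian_gt0 d y x : 0 < lorentzian d y x.
Proof. by apply: prodr_gt0 => j _; exact: lorentz1_gt0. Qed.

Lemma lorentzian_le1 d y x : lorentzian d y x <= 1.
Proof. by apply: prodr_ile1 => j _; rewrite lorentz1_le1 ltW ?lorentz1_gt0. Qed.

Lemma lorentzian_le_lorentz1 d y x p : lorentzian d y x <= lorentz1 (affine p d (y ord0 p) x).
Proof.
rewrite /lorentzian (bigD1 p)//= ler_piMr ?(ltW (lorentz1_gt0 _))//.
by apply: prodr_ile1 => j _; rewrite lorentz1_le1 ltW ?lorentz1_gt0.
Qed.

Lemma partial_lorentzian j d y : partial j (lorentzian d y) =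
  (fun x => - 2 * d * odd_lorentz1 (affine j d (y ord0 j) x) * lorentzian d y x).
Proof.
pose g x := \prod_(k < n) (if k != j then lorentz1 (affine k d (y ord0 k) x) else 1).
have bE : lorentzian d y = (fun x => lorentz1 (affine j d (y ord0 j) x) * g x).
  by apply/funext => x; rewrite /lorentzian (bigD1 j)//= /g -big_mkcond.
have bg : bsmooth g.
  by apply: bsmooth_prod => k; case: (k != j); [exact: bsmooth_lorentz1|exact: bsmooth_cst].
have dg : partial j g = fun=> 0.
  apply: partial_indep => h x; apply: eq_bigr => k _; case: ifPn => // kj.
  by rewrite /affine !mxE eqxx (negbTE kj) mulr0 add0r.
rewrite bE partialM; [|exact/bsmooth_C1/bsmooth_lorentz1|exact: bsmooth_C1].
by rewrite dg partial_lorentz1 eqxx; apply/funext => x; rewrite mulr1n; ring.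
Qed.

Lemma partial2_lorentzian j d y : partial j (partial j (lorentzian d y)) =
  (fun x => d ^+ 2 * (8 * odd_lorentz1 (affine j d (y ord0 j) x) ^+ 2 -
                      2 * lorentz1 (affine j d (y ord0 j) x)) * lorentzian d y x).
Proof.
rewrite partial_lorentzian partialM; [|exact/bsmooth_C1/bsmoothZ/bsmooth_odd_lorentz1|exact/bsmooth_C1/bsmooth_lorentzian].
rewrite partialZ; last exact/bsmooth_C1/bsmooth_odd_lorentz1.
rewrite partial_lorentzian partial_odd_lorentz1 eqxx; apply/funext => x; rewrite mulr1n; ring.
Qed.

(** Both terms lie between 0 and 2. Their difference is the quotient of the second derivative of
    [lorentz1] by [lorentz1]. *)
Lemma odd_lorentz1_lorentz1_le (t : R) : `|8 * odd_lorentz1 t ^+ 2 - 2 * lorentz1 t| <= 2.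
Proof.
have := odd_lorentz1_sqr_le t; have := sqr_ge0 (odd_lorentz1 t).
have := lorentz1_le1 t; have := lorentz1_gt0 t.
by move=> h1 h2 h3 h4; rewrite ler_norml; apply/andP; split; lra.
Qed.

Lemma partial2_lorentzian_le j d y x : `|partial j (partial j (lorentzian d y)) x| <= 2 * d ^+ 2.
Proof.
rewrite partial2_lorentzian /= normrM normrM (ger0_norm (sqr_ge0 d)) (gtr0_norm (lorentzian_gt0 _ _ _)).
rewrite -[leRHS]mulr1 (mulrC 2 (d ^+ 2)); apply: ler_pM => //.
- by rewrite mulr_ge0 ?sqr_ge0.
- exact/ltW/lorentzian_gt0.
- by rewrite ler_wpM2l ?sqr_ge0// odd_lorentz1_lorentz1_le.
- exact: lorentzian_le1.
Qed.

Lemma partial_atan1 p d (a : R) :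
  partial p (fun x => atan (affine p d a x)) = (fun x => d * lorentz1 (affine p d a x)).
Proof. by rewrite partial_atan eqxx. Qed.

Lemma partial_atan3_le p d (a : R) x : 0 <= d ->
  `|partial p (partial p (partial p (fun x => atan (affine p d a x)))) x| <= 2 * d ^+ 3.
Proof.
move=> d0; rewrite partial_atan1 partialZ; last exact/bsmooth_C1/bsmooth_lorentz1.
rewrite partial_lorentz1 eqxx mulr1n.
have -> : (fun x => d * (d * (- 2 * (lorentz1 (affine p d a x) * odd_lorentz1 (affine p d a x))))) =
   (fun x => - 2 * d ^+ 2 * (lorentz1 (affine p d a x) * odd_lorentz1 (affine p d a x))).
  by apply/funext => z; ring.
have b1 := @bsmooth_lorentz1 p d a; have b2 := @bsmooth_odd_lorentz1 p d a.
rewrite partialZ; last exact/bsmooth_C1/bsmoothM.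
rewrite partialM; [|exact: bsmooth_C1..].
rewrite partial_lorentz1 partial_odd_lorentz1 eqxx mulr1n.
set r := lorentz1 _; set s := odd_lorentz1 _.
have -> : - 2 * d ^+ 2 * (r * (d * (r + - 2 * (s * s))) + s * (d * (- 2 * (r * s)))) =
  d ^+ 3 * (r * (8 * s ^+ 2 - 2 * r)) by ring.
rewrite normrM ger0_norm ?exprn_ge0// mulrC ler_wpM2r ?exprn_ge0//.
rewrite normrM (gtr0_norm (lorentz1_gt0 _)) -[leRHS]mul1r.
apply: ler_pM => //; [exact/ltW/lorentz1_gt0|exact: lorentz1_le1|exact: odd_lorentz1_lorentz1_le].
Qed.

End lorentz_weight.

(** * Weighted estimates with explicit constants *)

Section local_estimate.
Context {R : realType} {n : nat}.
Implicit Types (x y : 'rV[R]_n) (i j p : 'I_n).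

Local Notation mu := (@lebesgue_rV R n).

Lemma weighted_le (C : R) (b f : 'rV[R]_n -> R) : bsmooth b -> (forall x, `|b x| <= C) ->
  sq_int mu f -> `|\int[mu]_x (b x * f x * f x)| <= C * \int[mu]_x (f x ^+ 2).
Proof.
move=> bb bC fi; have i1 := intg_bsmooth bb fi fi; have i2 := sq_int_sqr fi.
apply: (le_trans (le_normr_Rintegral measurableT i1)).
rewrite -RintegralZl//; apply: le_Rintegral => //.
- by have := integrable_norm i1.
- exact: intgZ.
- by move=> x _; rewrite -mulrA -expr2 normrM (ger0_norm (sqr_ge0 _)) ler_wpM2r ?sqr_ge0.
Qed.

Section estimates.
Variables (f : 'rV[R]_n -> R) (D : 'I_n -> 'rV[R]_n -> R)
  (H : 'I_n -> 'I_n -> 'rV[R]_n -> R).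
Hypothesis fDH : sobolev2 f D H.
Hypothesis fi : sq_int mu f.
Variable k2 : R.

Let Di i : sq_int mu (D i). Proof. by have [/(_ i)[]] := fDH. Qed.
Let F := helmholtz f H k2.
Let Fi : sq_int mu F. Proof. exact: sq_int_helmholtz fDH fi k2. Qed.
Let A := \int[mu]_x (f x ^+ 2).
Let B := \int[mu]_x (F x ^+ 2).

(** Pairing [F] with [f] gives [k2 A] minus the squared norm of the gradient, and Young's inequality
    with weight 1 bounds that pairing. *)
Lemma gradient_le :
  \sum_j \int[mu]_x (D j x ^+ 2) <= (k2 + 2^-1) * A + 2^-1 * B.
Proof.
under eq_bigr do rewrite (gradient_laplacian fDH).
have := helmholtz_pairing fDH fi k2 fi; rewrite -/F.
have -> : \int[mu]_x (f x * f x) = A by apply: eq_Rintegral => x _; rewrite expr2.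
have := young_Rintegral Fi fi ltr01; rewrite -/A -/B.
rewrite sumrN mulr1 mul1r ler_norml.
move: (\int[mu]_x (F x * f x)) (\sum_j _) => I J.
by move=> /andP[h1 h2]; lra.
Qed.

(** The weight is of order 1 on the slab [|x_p - a| <= 1 / d], and the bound does not depend on [a].
    A large [th] makes the global terms small and charges [B]. *)
Lemma slab_estimate p (d th a : R) : 0 < d <= 1 -> 0 < th ->
  \int[mu]_x (lorentz1 (affine p d a x) * D p x * D p x) <=
  2^-1 * d ^+ 2 * A +
  d^-1 * (th / 2 * B + (2 * th)^-1 * (8 * \int[mu]_x (D p x ^+ 2) + A)).
Proof.
move=> /andP[d0 d1] th0.
pose b x := atan (affine p d a x).
have bb : bsmooth b by exact: bsmooth_atan.
have br := @bsmooth_lorentz1 R n p d a.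
have b1E : partial p b = (fun x => d * lorentz1 (affine p d a x)) by exact: partial_atan1.
have a0 j : j != p -> partial j b = fun=> 0.
  move=> jp; rewrite /b partial_atan (negbTE jp).
  by apply/funext => x; rewrite mulr0n mul0r.
have w0 j : j != p -> partial j (partial p b) = fun=> 0.
  move=> jp; rewrite b1E partialZ; last exact: bsmooth_C1.
  rewrite partial_lorentz1 (negbTE jp).
  by apply/funext => x; rewrite mulr0n mul0r mulr0.
have E := morawetz_identity fDH fi k2 bb a0 w0; rewrite -/F in E.
pose g x := b x * D p x + 2^-1 * (partial p b x * f x).
have bDi := sq_int_bsmooth bb (Di p).
have wfi := sq_int_bsmooth (bsmooth_partial p bb) fi.
have gi : sq_int mu g by apply: sq_intD => //; exact: sq_intZ.
have Y := young_Rintegral Fi gi th0.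
(* The 8 is twice the bound 4 for [atan^2]; the other half of the multiplier is at most [|f| / 2]
   since [d <= 1]. *)
have gA : \int[mu]_x (g x ^+ 2) <= 8 * \int[mu]_x (D p x ^+ 2) + A.
  have i1 := sq_int_sqr (Di p); have i2 := sq_int_sqr fi.
  rewrite /A -RintegralZl// -RintegralD//; last exact: intgZ.
  apply: le_Rintegral => //.
  - exact: sq_int_sqr.
  - by apply: intgD => //; exact: intgZ.
  move=> x _; rewrite /g b1E.
  have b2 : b x ^+ 2 <= 4.
    rewrite -real_normK ?num_real// (_ : 4 = 2 ^+ 2 :> R); last by ring.
    by rewrite lerXn2r ?nnegrE// atan_le2.
  set r := lorentz1 _; have r0 : 0 < r by exact: lorentz1_gt0.
  have r1 : r <= 1 by exact: lorentz1_le1.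
  have dr2 : (d * r) ^+ 2 <= 1.
    by apply: exprn_ile1; [apply: mulr_ge0; exact: ltW|apply: mulr_ile1 => //; exact: ltW].
  have h1 : b x ^+ 2 * D p x ^+ 2 <= 4 * D p x ^+ 2 by rewrite ler_wpM2r ?sqr_ge0.
  have h2 : (d * r) ^+ 2 * f x ^+ 2 <= 1 * f x ^+ 2 by rewrite ler_wpM2r ?sqr_ge0.
  have := sqr_ge0 (b x * D p x - 2^-1 * (d * r * f x)); have := sqr_ge0 (f x).
  by move: h1 h2 => *; lra.
have W := weighted_le (bsmooth_partial p (bsmooth_partial p (bsmooth_partial p bb)))
  (fun x => partial_atan3_le p a x (ltW d0)) fi.
have E2 : \int[mu]_x (partial p b x * D p x * D p x) =
    d * \int[mu]_x (lorentz1 (affine p d a x) * D p x * D p x).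
  rewrite -RintegralZl//; last exact: intg_bsmooth.
  by apply: eq_Rintegral => x _; rewrite b1E; ring.
rewrite E2 in E.
rewrite -(ler_pM2l d0) mulrDr (mulrA d d^-1) mulfV ?gt_eqF// mul1r.
have -> : d * (2^-1 * d ^+ 2 * A) = 4^-1 * (2 * d ^+ 3 * A) by field.
move: W; rewrite -/A ler_norml => /andP[_ W].
move: Y; rewrite ler_norml => /andP[Y _].
have T : 0 < (2 * th)^-1 by rewrite invr_gt0 mulr_gt0.
have {}gA := ler_wpM2l (ltW T) gA.
rewrite -[LHS]/(\int[mu]_x (F x * g x)) in E.
move: E Y W gA; by rewrite -/B => *; lra.
Qed.

(** The virial identity, with [|D j|^2] estimated by [slab_estimate] since [lorentzian] lies below
    its factor along [j]. In [3/2 n d^2], [n d^2 / 2] comes from the slabs and [n d^2] from the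
    second derivatives of the weight; [8 k2 + 4] and the last term of the coefficient of [B] come
    from 8 times [gradient_le]. *)
Lemma lorentzian_estimate y (d th th' : R) : 0 < d <= 1 -> 0 < th -> 0 < th' ->
  k2 * \int[mu]_x (lorentzian d y x * f x * f x) <=
  ((2 * th)^-1 + 3 / 2 * n%:R * d ^+ 2 +
     (2 * th' * d)^-1 * (8 * k2 + 4 + n%:R)) * A +
  (th / 2 + n%:R * th' / (2 * d) + 2 * (th' * d)^-1) * B.
Proof.
move=> dd th0 th'0; have /andP[d0 d1] := dd.
pose b := lorentzian d y; have bb : bsmooth b by exact: bsmooth_lorentzian.
have E := virial_identity fDH fi k2 bb; rewrite -/F in E.
have bfi := sq_int_bsmooth bb fi.
have Y := young_Rintegral Fi bfi th0.
have bA : \int[mu]_x ((b x * f x) ^+ 2) <= A.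
  apply: le_Rintegral => //; [exact: sq_int_sqr|exact: sq_int_sqr|].
  move=> x _; rewrite exprMn -[leRHS]mul1r ler_wpM2r ?sqr_ge0// expr_le1//.
    exact: lorentzian_le1.
  exact/ltW/lorentzian_gt0.
have S1 : \sum_j \int[mu]_x (b x * D j x * D j x) <=
  \sum_j (2^-1 * d ^+ 2 * A + d^-1 * (th' / 2 * B +
     (2 * th')^-1 * (8 * \int[mu]_x (D j x ^+ 2) + A))).
  apply: ler_sum => j _; apply: le_trans (slab_estimate j (y ord0 j) dd th'0).
  apply: le_Rintegral => //.
  - exact: intg_bsmooth.
  - exact: intg_bsmooth (@bsmooth_lorentz1 _ _ _ _ _) _ _.
  - by move=> x _; rewrite -!mulrA -expr2 ler_wpM2r ?sqr_ge0// lorentzian_le_lorentz1.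
have S2 : - (n%:R * (2 * d ^+ 2 * A)) <= \sum_j \int[mu]_x (partial j (partial j b) x * f x * f x).
  have -> : - (n%:R * (2 * d ^+ 2 * A)) = \sum_(j < n) - (2 * d ^+ 2 * A).
    by rewrite sumrN sumr_const card_ord mulr_natl.
  apply: ler_sum => j _.
  have := weighted_le (bsmooth_partial j (bsmooth_partial j bb)) (partial2_lorentzian_le j d y) fi.
  by rewrite ler_norml => /andP[].
have sumE : \sum_(j < n) (2^-1 * d ^+ 2 * A + d^-1 * (th' / 2 * B +
     (2 * th')^-1 * (8 * \int[mu]_x (D j x ^+ 2) + A))) =
   n%:R * (2^-1 * d ^+ 2 * A) + n%:R * (d^-1 * (th' / 2 * B)) +
   d^-1 * (2 * th')^-1 * 8 * (\sum_j \int[mu]_x (D j x ^+ 2)) +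
   d^-1 * ((2 * th')^-1 * (n%:R * A)).
  have cst (u : R) : n%:R * u = \sum_(j < n) u by rewrite sumr_const card_ord mulr_natl.
  rewrite !cst !mulr_sumr -!big_split /=; apply: eq_bigr => j _; ring.
rewrite sumE in S1.
have T : 0 < (2 * th)^-1 by rewrite invr_gt0 mulr_gt0.
have T' : 0 < d^-1 * (2 * th')^-1 * 8 by rewrite !mulr_gt0 ?invr_gt0 ?mulr_gt0.
have {}bA := ler_wpM2l (ltW T) bA.
have G := ler_wpM2l (ltW T') gradient_le.
move: Y; rewrite ler_norml => /andP[_ Y].
have -> : (th / 2 + n%:R * th' / (2 * d) + 2 * (th' * d)^-1) * B =
  th / 2 * B + n%:R * (d^-1 * (th' / 2 * B)) + d^-1 * (2 * th')^-1 * 8 * (2^-1 * B).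
  by field; rewrite !gt_eqF.
have -> : ((2 * th)^-1 + 3 / 2 * n%:R * d ^+ 2 + (2 * th' * d)^-1 * (8 * k2 + 4 + n%:R)) * A =
  (2 * th)^-1 * A + n%:R * (2^-1 * d ^+ 2 * A) + 2^-1 * (n%:R * (2 * d ^+ 2 * A)) +
  d^-1 * (2 * th')^-1 * 8 * ((k2 + 2^-1) * A) + d^-1 * ((2 * th')^-1 * (n%:R * A)).
  by field; rewrite !gt_eqF.
move: E Y S1 S2 bA G; rewrite -/b -/B.
by move=> *; lra.
Qed.

End estimates.

End local_estimate.

(** * Choice of the parameters *)

Section uniform_local_estimate.
Context {R : realType} {n : nat}.

Local Notation mu := (@lebesgue_rV R n).

(** [d] and [K] are fixed before the centre and the function. The bound [d0] lets the weight be made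
    as wide as a given ball demands. *)
Lemma uniform_lorentzian_estimate (k2 eps d0 : R) : 0 < k2 -> 0 < eps -> 0 < d0 ->
  exists d K : R, [/\ 0 < d, d <= d0, 0 <= K & forall (y : 'rV[R]_n) f D H,
    sobolev2 f D H -> sq_int mu f ->
    \int[mu]_x (lorentzian d y x * f x * f x) <=
    eps * \int[mu]_x (f x ^+ 2) + K * \int[mu]_x (helmholtz f H k2 x ^+ 2)].
Proof.
move=> k20 eps0 d00.
have n1 : 0 < 6 * (n%:R + 1) :> R by rewrite mulr_gt0// ltr_wpDl.
have ke : 0 < k2 * eps by rewrite mulr_gt0.
(* Each of the three coefficients of [A] becomes at most [k2 * eps / 4]: this [d] handles
   [3/2 n d^2], and [th] and [th'] below, the latter depending on [d], handle the other two. *)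
pose d := Num.min (Num.min 1 d0) (k2 * eps / (6 * (n%:R + 1))).
have dpos : 0 < d by rewrite !lt_min ltr01 d00 divr_gt0.
have d1 : d <= 1 by rewrite !ge_min lexx.
have dd0 : d <= d0 by rewrite !ge_min lexx orbT.
have dke : d * (6 * (n%:R + 1)) <= k2 * eps by rewrite -ler_pdivlMr// !ge_min lexx !orbT.
clearbody d.
pose M := 8 * k2 + 4 + n%:R : R.
have M0 : 0 < M.
  by rewrite /M ltr_wpDr// ltr_wpDr// mulr_gt0.
pose th := 2 / (k2 * eps); pose th' := 2 * M / (d * (k2 * eps)).
have th0 : 0 < th by rewrite divr_gt0.
have th'0 : 0 < th' by rewrite divr_gt0// mulr_gt0.
pose K := k2^-1 * (th / 2 + n%:R * th' / (2 * d) + 2 * (th' * d)^-1).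
have K0 : 0 <= K.
  rewrite mulr_ge0 ?invr_ge0 ?(ltW k20)// !addr_ge0//.
  - by rewrite divr_ge0// ltW.
  - by apply: divr_ge0; apply: mulr_ge0 => //; exact: ltW.
  - by apply: mulr_ge0 => //; rewrite invr_ge0 ltW// mulr_gt0.
exists d, K; split => // y f D H fDH fi.
have dd : 0 < d <= 1 by rewrite dpos d1.
have E := lorentzian_estimate fDH fi k2 y dd th0 th'0.
set A := \int[mu]_x (f x ^+ 2) in E *.
set B := \int[mu]_x (helmholtz f H k2 x ^+ 2) in E *.
have A0 : 0 <= A by apply: Rintegral_ge0 => x _; exact: sqr_ge0.
rewrite -(ler_pM2l k20); apply: (le_trans E).
rewrite [leRHS]mulrDr; apply: lerD; last by rewrite /K [leRHS]mulrA mulVKf ?gt_eqF.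
rewrite [leRHS]mulrA ler_wpM2r// -/M.
have -> : (2 * th)^-1 = k2 * eps / 4 by rewrite /th; field; rewrite !gt_eqF.
have -> : (2 * th' * d)^-1 * M = k2 * eps / 4 by rewrite /th'; field; rewrite !gt_eqF.
have d2 : n%:R * d ^+ 2 <= n%:R * d :> R.
  by rewrite ler_wpM2l// expr2 ler_piMr// ltW.
have -> : 3 / 2 * n%:R * d ^+ 2 = 3 / 2 * (n%:R * d ^+ 2) by ring.
by move: dke d2 dpos; lra.
Qed.

End uniform_local_estimate.

(** * Complex-valued functions *)

Section complex_valued.
Context {R : realType} {n : nat}.
Implicit Types (u v : 'rV[R]_n -> R[i]) (phi : 'rV[R]_n -> R) (alpha : seq 'I_n).

Local Notation mu := (@lebesgue_rV R n).
Local Notation re u := (fun x => complex.Re (u x)).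
Local Notation im u := (fun x => complex.Im (u x)).

Lemma sqr_normE (z : R[i]) : sqr_norm z = complex.Re z ^+ 2 + complex.Im z ^+ 2.
Proof. by case: z => a b; rewrite /sqr_norm /= sqr_sqrtr// addr_ge0 ?sqr_ge0. Qed.

Lemma sqr_norm_ge0 (z : R[i]) : 0 <= sqr_norm z.
Proof. exact: sqr_ge0. Qed.

Lemma L2P u : L2 u <-> sq_int mu (re u) /\ sq_int mu (im u).
Proof.
split=> [[mr mi fin]|[[mr ri] [mi ii]]].
  have i1 : intg mu (fun x => sqr_norm (u x)).
    apply/integrableP; split.
      apply/measurable_EFinP; under eq_fun do rewrite sqr_normE.
      by apply: measurable_funD; exact: measurable_sqr.
    by under eq_integral do rewrite /= ger0_norm ?sqr_ge0//.
  by split; split => //; apply: (intg_le _ _ i1); first [exact: measurable_sqr|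
    move=> x; rewrite sqr_normE ger0_norm ?sqr_ge0// ?lerDl ?lerDr sqr_ge0].
split => //.
have /integrableP[_] := intgD ri ii.
under eq_integral do rewrite /= ger0_norm ?addr_ge0 ?sqr_ge0// -sqr_normE.
by [].
Qed.

Lemma Rintegral_sqr_norm u : L2 u -> \int[mu]_x sqr_norm (u x) =
  \int[mu]_x (complex.Re (u x) ^+ 2) + \int[mu]_x (complex.Im (u x) ^+ 2).
Proof.
move=> /L2P[[_ ri] [_ ii]]; rewrite -RintegralD//.
by apply: eq_Rintegral => x _; rewrite sqr_normE.
Qed.

Lemma CintegralM u phi : Cintegral (fun x => u x * (phi x)%:C%C) =
  Complex (\int[mu]_x (complex.Re (u x) * phi x)) (\int[mu]_x (complex.Im (u x) * phi x)).
Proof.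
by congr Complex; apply: eq_Rintegral => x _; case: (u x) => a b /=; rewrite mulr0 ?subr0 ?add0r.
Qed.

Lemma weak_derivative1P i u v : is_weak_derivative [:: i] u v <->
  L2 v /\ forall phi, test_function phi ->
    \int[mu]_x (complex.Re (u x) * partial i phi x) = - (\int[mu]_x (complex.Re (v x) * phi x)) /\
    \int[mu]_x (complex.Im (u x) * partial i phi x) = - \int[mu]_x (complex.Im (v x) * phi x).
Proof.
split=> -[Lv h]; split => // phi /h; rewrite !CintegralM expr1 mulN1r /=.
  by move=> [-> ->].
by move=> [-> ->].
Qed.

Lemma weak_derivative2P i j u v : is_weak_derivative [:: i; j] u v <->
  L2 v /\ forall phi, test_function phi ->
    \int[mu]_x (complex.Re (u x) * partial i (partial j phi) x) =
      \int[mu]_x (complex.Re (v x) * phi x) /\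
    \int[mu]_x (complex.Im (u x) * partial i (partial j phi) x) =
      \int[mu]_x (complex.Im (v x) * phi x).
Proof.
split=> -[Lv h]; split => // phi /h; rewrite !CintegralM sqrrN expr1n mul1r /=.
  by move=> [-> ->].
by move=> [-> ->].
Qed.

Lemma weak_derivativeP alpha u : H2 u -> (size alpha <= 2)%N ->
  is_weak_derivative alpha u (weak_derivative alpha u).
Proof.
move=> [_ h] /h[v uv].
exact: (@xgetPex _ (fun=> 0) [set v | is_weak_derivative alpha u v] (ex_intro _ v uv)).
Qed.

Definition wd1 u i := weak_derivative [:: i] u.
Definition wd2 u i j := weak_derivative [:: i; j] u.

(** A second weak derivative is defined by testing [u], not by differentiating [wd1 u i]. Testing
    the first order identity with [partial j phi] relates it to [wd1 u i], and [weak_partial_mixed]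
    relates it to [wd1 u j]. *)
Lemma H2_sobolev2_re u : H2 u ->
  sobolev2 (re u) (fun i => re (wd1 u i)) (fun i j => re (wd2 u i j)).
Proof.
move=> H2u; have [/L2P[ri ii] _] := H2u.
have w1 i := (weak_derivative1P i u _).1 (weak_derivativeP (alpha := [:: i]) H2u isT).
have w2 i j := (weak_derivative2P i j u _).1 (weak_derivativeP (alpha := [:: i; j]) H2u isT).
have P1 i : weak_partial i (re u) (re (wd1 u i)).
  by have [/L2P[? _] h] := w1 i; split => // phi /h[].
split=> // i j.
  have [/L2P[D1 _] h1] := w1 i; have [/L2P[D2 _] h2] := w2 i j.
  split => // phi tphi; have [E1 _] := h1 _ (test_partial j tphi).
  by have [<- _] := h2 _ tphi; rewrite E1 opprK.
have [/L2P[D1 _] h1] := w1 j; have [/L2P[D2 _] h2] := w2 i j.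
split => // phi tphi; have [E1 _] := h2 _ tphi.
by rewrite -E1 (weak_partial_mixed i (P1 j) tphi) opprK.
Qed.

Lemma H2_sobolev2_im u : H2 u ->
  sobolev2 (im u) (fun i => im (wd1 u i)) (fun i j => im (wd2 u i j)).
Proof.
move=> H2u; have [/L2P[ri ii] _] := H2u.
have w1 i := (weak_derivative1P i u _).1 (weak_derivativeP (alpha := [:: i]) H2u isT).
have w2 i j := (weak_derivative2P i j u _).1 (weak_derivativeP (alpha := [:: i; j]) H2u isT).
have P1 i : weak_partial i (im u) (im (wd1 u i)).
  by have [/L2P[_ ?] h] := w1 i; split => // phi /h[].
split=> // i j.
  have [/L2P[_ D1] h1] := w1 i; have [/L2P[_ D2] h2] := w2 i j.
  split => // phi tphi; have [_ E1] := h1 _ (test_partial j tphi).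
  by have [_ <-] := h2 _ tphi; rewrite E1 opprK.
have [/L2P[_ D1] h1] := w1 j; have [/L2P[_ D2] h2] := w2 i j.
split => // phi tphi; have [_ E1] := h2 _ tphi.
by rewrite -E1 (weak_partial_mixed i (P1 j) tphi) opprK.
Qed.

(* [defect k2 u] is the square of the L^2 norm of [laplacian u + k2 * u]. *)
Definition defect (k2 : R) u :=
  \int[mu]_x (helmholtz (re u) (fun i j => re (wd2 u i j)) k2 x ^+ 2) +
  \int[mu]_x (helmholtz (im u) (fun i j => im (wd2 u i j)) k2 x ^+ 2).

Lemma defect_ge0 k2 u : 0 <= defect k2 u.
Proof. by apply: addr_ge0; apply: Rintegral_ge0 => x _; exact: sqr_ge0. Qed.

(** With [k2 = beta / (2 gamma)], the coefficient [gamma / 2 * 2 * k2] of the gradient is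
    [beta / 2], and [gamma / 2 * k2^2] is [beta^2 / (8 gamma)]. *)
Lemma energyE (gamma beta : R) u : 0 < gamma -> H2 u ->
  energy gamma beta u = gamma / 2 * defect (beta / (2 * gamma)) u -
    beta ^+ 2 / (8 * gamma) * \int[mu]_x sqr_norm (u x).
Proof.
move=> gamma0 H2u; have [Lu _] := H2u; have /L2P[ri ii] := Lu.
have Sr := H2_sobolev2_re H2u; have Si := H2_sobolev2_im H2u.
have [Sr1 Sr2 _] := Sr; have [Si1 Si2 _] := Si.
rewrite /defect (Rintegral_helmholtz_sqr Sr)// (Rintegral_helmholtz_sqr Si)//.
rewrite Rintegral_sqr_norm// /energy.
have Re_sum (F : 'I_n -> R[i]) : complex.Re (\sum_j F j) = \sum_j complex.Re (F j).
  by apply: (big_morph (@complex.Re R)) => // -[a b] [c d].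
have Im_sum (F : 'I_n -> R[i]) : complex.Im (\sum_j F j) = \sum_j complex.Im (F j).
  by apply: (big_morph (@complex.Im R)) => // -[a b] [c d].
have -> : \int[mu]_x sqr_norm (laplacian u x) =
    \int[mu]_x ((\sum_j complex.Re (wd2 u j j x)) ^+ 2) +
    \int[mu]_x ((\sum_j complex.Im (wd2 u j j x)) ^+ 2).
  rewrite -RintegralD//.
  - by apply: eq_Rintegral => x _; rewrite sqr_normE /laplacian Re_sum Im_sum.
  - by apply: sq_int_sqr; apply: sq_int_sum => j; have [] := Sr2 j j.
  - by apply: sq_int_sqr; apply: sq_int_sum => j; have [] := Si2 j j.
have -> : \int[mu]_x sqr_norm_grad u x =
    \sum_j \int[mu]_x (complex.Re (wd1 u j x) ^+ 2) +
    \sum_j \int[mu]_x (complex.Im (wd1 u j x) ^+ 2).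
  have i1 j : intg mu (fun x => complex.Re (wd1 u j x) ^+ 2).
    by apply: sq_int_sqr; have [] := Sr1 j.
  have i2 j : intg mu (fun x => complex.Im (wd1 u j x) ^+ 2).
    by apply: sq_int_sqr; have [] := Si1 j.
  rewrite -!Rintegral_sum// -RintegralD//; [|exact: intg_sum..].
  apply: eq_Rintegral => x _; rewrite /sqr_norm_grad -big_split/=.
  by apply: eq_bigr => j _; rewrite sqr_normE.
by field; rewrite gt_eqF.
Qed.

Lemma energy_ge (gamma beta c : R) u : 0 < gamma -> mass_sphere n c u ->
  - (beta ^+ 2 / (8 * gamma)) * c <= energy gamma beta u.
Proof.
move=> gamma0 [H2u <-]; rewrite energyE// mulNr lerDr.
by rewrite mulr_ge0 ?defect_ge0// divr_ge0// ltW.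
Qed.

End complex_valued.

(** * Vanishing *)

Section vanishing.
Context {R : realType} {n : nat}.
Implicit Types (u : 'rV[R]_n -> R[i]) (x y : 'rV[R]_n).

Local Notation mu := (@lebesgue_rV R n).
Local Notation re u := (fun x => complex.Re (u x)).
Local Notation im u := (fun x => complex.Im (u x)).

Lemma euclidean_norm_coord x j : `|x ord0 j| <= euclidean_norm x.
Proof.
rewrite -sqrtr_sqr; apply: ler_wsqrtr; rewrite (bigD1 j)//= lerDl.
by apply: sumr_ge0 => k _; exact: sqr_ge0.
Qed.

Lemma measurable_euclidean_ball y (r : R) : measurable (euclidean_ball y r).
Proof.
have mN : measurable_fun setT (fun x : 'rV[R]_n => euclidean_norm (x - y)).
  apply: (measurableT_comp (f := @Num.sqrt R)).
    exact: (continuous_measurable_fun (@sqrt_continuous R)).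
  apply: measurable_sum => j; apply: measurable_funX.
  exact: (measurableT_comp (measurable_rV_coord j) (measurable_translate (- y))).
rewrite (_ : euclidean_ball y r = (fun x => euclidean_norm (x - y)) @^-1` `]-oo, r[%classic).
  by rewrite -[X in measurable X]setTI; exact: mN.
by apply/seteqP; split=> x /=; rewrite /euclidean_ball/= in_itv.
Qed.

(** On the ball each coordinate satisfies [d |x_j - y_j| <= d r <= 1], so each of the [n] factors is
    at least 1/2. *)
Lemma lorentzian_ball_ge (d r : R) x y : 0 < d -> d * r <= 1 -> euclidean_ball y r x ->
  2^-1 ^+ n <= lorentzian d y x.
Proof.
move=> d0 dr xy; rewrite /lorentzian -[n in leLHS]card_ord -prodr_const.
apply: ler_prod => j _; rewrite invr_ge0 ler0n /=.
rewrite lef_pV2 ?posrE ?onepsqr_gt0// -[leRHS]/(1 + 1 : R).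
rewrite lerD2l -real_normK ?num_real// exprn_ile1//.
rewrite normrM gtr0_norm// (le_trans _ dr)// ler_pM2l//.
have := euclidean_norm_coord (x - y) j; rewrite !mxE => /le_trans; apply.
exact: ltW.
Qed.

Lemma measurable_sqr_norm u : L2 u -> measurable_fun setT (fun x => (sqr_norm (u x))%:E).
Proof.
move=> [mr mi _]; apply/measurable_EFinP; under eq_fun do rewrite sqr_normE.
by apply: measurable_funD; exact: measurable_sqr.
Qed.

Lemma ball_mass_le (d r : R) u y : L2 u -> 0 < d -> d * r <= 1 ->
  (\int[mu]_(x in euclidean_ball y r) (sqr_norm (u x))%:E <=
   (2 ^+ n * (\int[mu]_x (lorentzian d y x * complex.Re (u x) * complex.Re (u x)) +
              \int[mu]_x (lorentzian d y x * complex.Im (u x) * complex.Im (u x))))%:E)%E.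
Proof.
move=> Lu d0 dr; have /L2P[ri ii] := Lu.
have bb : bsmooth (lorentzian d y) by exact: bsmooth_lorentzian.
have i1 := intg_bsmooth bb ri ri; have i2 := intg_bsmooth bb ii ii.
rewrite -RintegralD// -RintegralZl//; last exact: intgD.
set h := (X in Rintegral _ _ X).
have hi : intg mu h by apply: intgZ; exact: intgD.
have hfin := integrable_fin_num measurableT hi.
have hE x : h x = 2 ^+ n * (lorentzian d y x * sqr_norm (u x)).
  by rewrite /h sqr_normE; congr (_ * _); ring.
have h0 x : 0 <= h x.
  rewrite hE mulr_ge0 ?exprn_ge0// mulr_ge0 ?sqr_norm_ge0//.
  exact/ltW/lorentzian_gt0.
have mb := measurable_euclidean_ball y r.
have mh : measurable_fun setT (fun x => (h x)%:E) by have /integrableP[] := hi.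
rewrite /Rintegral fineK//.
apply: (@le_trans _ _ (\int[mu]_(x in euclidean_ball y r) (h x)%:E)%E).
  apply: ge0_le_integral => //.
  - by move=> x _; rewrite lee_fin sqr_norm_ge0.
  - exact: (measurable_funS measurableT (@subsetT _ _) (measurable_sqr_norm Lu)).
  - exact: (measurable_funS measurableT (@subsetT _ _) mh).
  move=> x xb; rewrite lee_fin hE mulrA ler_peMl ?sqr_norm_ge0//.
  have := ler_wpM2l (exprn_ge0 n (ler0n R 2)) (lorentzian_ball_ge d0 dr xb).
  by rewrite -exprMn mulfV ?expr1n// pnatr_eq0.
by apply: ge0_subset_integral => // x _; rewrite lee_fin.
Qed.

Lemma cvge0_le (s : nat -> \bar R) : (forall k, (0 <= s k)%E) ->
  (forall e : R, 0 < e -> \forall k \near \oo, (s k <= e%:E)%E) ->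
  s k @[k --> \oo] --> 0%E.
Proof.
move=> s0 se.
(* The bound with [e = 1] makes the terms eventually finite, so that convergence can be checked on
   real values. *)
have fin : \forall k \near \oo, s k \is a fin_num.
  by apply: filterS (se _ ltr01) => k sk; rewrite ge0_fin_numE// (le_lt_trans sk)// ltry.
apply/fine_cvgP; split => //.
apply/cvgrPdist_le => e e0; near=> k.
have fk : s k \is a fin_num by near: k.
rewrite sub0r normrN ger0_norm ?fine_ge0// -lee_fin fineK//.
by near: k; exact: se.
Unshelve. all: end_near. Qed.

Lemma vanishing_of_defect (k2 c : R) (u_ : nat -> 'rV[R]_n -> R[i]) : 0 < k2 ->
  (forall k, mass_sphere n c (u_ k)) -> defect k2 (u_ k) @[k --> \oo] --> 0 ->
  vanishing_sequence u_.
Proof.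
move=> k20 uc defect0 r r0.
have Lu k : L2 (u_ k) by have [[]] := uc k.
have c0 : 0 <= c.
  by have [_ <-] := uc 0%N; apply: Rintegral_ge0 => x _; exact: sqr_norm_ge0.
apply: cvge0_le => [k|e e0].
  apply: (@le_trans _ _ (\int[mu]_(x in euclidean_ball 0 r) (sqr_norm (u_ k x))%:E)%E).
    by apply: integral_ge0 => x _; rewrite lee_fin sqr_norm_ge0.
  by apply: ereal_sup_ubound; exists 0.
have p0 : 0 < 2 ^+ n :> R by rewrite exprn_gt0.
have c1 : 0 < c + 1 by rewrite ltr_wpDl.
(* After the factor [2^n] of [ball_mass_le], one half of [e] is spent on the mass [c] and the other
   on the defect; the added 1 here, and next to [K] below, keeps the denominators positive. *)
have eps0 : 0 < e / (2 * 2 ^+ n * (c + 1)) by rewrite divr_gt0// !mulr_gt0.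
(* Taking [d <= 1 / r] makes the weight bounded below by [2^-n] on balls of radius [r]. *)
have [|d [K [d0 dr K0 est]]] := @uniform_lorentzian_estimate R n k2 _ r^-1 k20 eps0.
  by rewrite invr_gt0.
have dr1 : d * r <= 1 by rewrite -ler_pdivlMr// div1r.
have eK0 : 0 < e / (2 * 2 ^+ n * (K + 1)) by rewrite divr_gt0// !mulr_gt0// ltr_wpDl.
near=> k.
have Dk : defect k2 (u_ k) <= e / (2 * 2 ^+ n * (K + 1)).
  rewrite -[leLHS]ger0_norm ?defect_ge0// -normrN -sub0r; near: k.
  by move/cvgrPdist_le : defect0; exact.
apply: ge_ereal_sup => _ [y _ <-]; apply: (le_trans (ball_mass_le y (Lu k) d0 dr1)).
have [H2u mass] := uc k; have /L2P[ri ii] := Lu k.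
have Er := est y _ _ _ (H2_sobolev2_re H2u) ri.
have Ei := est y _ _ _ (H2_sobolev2_im H2u) ii.
rewrite lee_fin; move: mass => /=; rewrite Rintegral_sqr_norm// => mass.
move: (lerD Er Ei) => {Er Ei}.
rewrite addrACA -mulrDr -mulrDr mass -/(defect k2 (u_ k)).
move: Dk (defect_ge0 k2 (u_ k)); move: (defect k2 (u_ k)) => B Dk B0.
move=> XB.
have h1 : 2 ^+ n * (e / (2 * 2 ^+ n * (c + 1)) * c) <= e / 2.
  have -> : 2 ^+ n * (e / (2 * 2 ^+ n * (c + 1)) * c) = e / 2 * (c / (c + 1)).
    by field; rewrite !gt_eqF.
  by rewrite ler_piMr ?divr_ge0 ?(ltW e0)// ler_pdivrMr// mul1r lerDl.
have h2 : 2 ^+ n * (K * B) <= e / 2.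
  have K1 : 0 < K + 1 by rewrite ltr_wpDl.
  have : 2 ^+ n * ((K + 1) * B) <= e / 2.
    move: Dk; rewrite ler_pdivlMr ?mulr_gt0// => Dk.
    rewrite ler_pdivlMr// (le_trans _ Dk)// le_eqVlt; apply/orP; left; apply/eqP; ring.
  apply: le_trans; rewrite ler_pM2l// ler_wpM2r// lerDl//.
apply: (le_trans (ler_wpM2l (ltW p0) XB)); rewrite mulrDr.
by move: h1 h2; clear; lra.
Unshelve. all: end_near. Qed.

(** For a constant sequence the supremum does not depend on the index, so its limit 0 is its value:
    every ball has mass 0, and the balls around 0 exhaust the space. *)
Lemma vanishing_constant u : L2 u -> vanishing_sequence (fun=> u) ->
  \int[mu]_x sqr_norm (u x) = 0.
Proof.
move=> Lu van; have /L2P[ri ii] := Lu.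
have ball0 (r : R) : 0 < r ->
    (\int[mu]_(x in euclidean_ball 0 r) (sqr_norm (u x))%:E = 0)%E.
  move=> r0; have /cvg_lim := van r r0; rewrite lim_cst// => /(_ (@ereal_hausdorff R)) S0.
  apply/eqP; rewrite eq_le integral_ge0 ?andbT; last by move=> x _; rewrite lee_fin sqr_norm_ge0.
  by rewrite -S0; apply: ereal_sup_ubound; exists 0.
have mu_ := measurable_sqr_norm Lu.
pose B (k : nat) := euclidean_ball (0 : 'rV[R]_n) k.+1%:R.
have BT : \bigcup_k B k = setT.
  apply/seteqP; split=> // x _; exists (Num.truncn (euclidean_norm x)) => //.
  by rewrite /B /euclidean_ball/= subr0 truncnS_gt.
have := @ge0_nondecreasing_set_cvg_integral _ _ R B (fun x => (sqr_norm (u x))%:E) mu.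
rewrite BT => h; have {}h : (\int[mu]_(x in B k) (sqr_norm (u x))%:E @[k --> \oo] -->
    \int[mu]_x (sqr_norm (u x))%:E)%E.
  apply: h.
  - move=> k l kl; apply/subsetPset => x; rewrite /B /euclidean_ball/= => /lt_le_trans; apply.
    by rewrite ler_nat.
  - by move=> k; exact: measurable_euclidean_ball.
  - by move=> k; exact: (measurable_funS measurableT (@subsetT _ _) mu_).
  - by move=> k x _; rewrite lee_fin sqr_norm_ge0.
rewrite /Rintegral.
suff -> : (\int[mu]_x (sqr_norm (u x))%:E = 0)%E by [].
have := cvg_lim (@ereal_hausdorff R) h => <-.
by under eq_fun do rewrite ball0//; rewrite lim_cst.
Qed.

End vanishing.

(** * Wave packets *)

Section wave_packet.
Context {R : realType} {n : nat}.
Implicit Types (f g th phi : 'rV[R]_n -> R) (x : 'rV[R]_n) (i j : 'I_n).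

Local Notation mu := (@lebesgue_rV R n).

Lemma continuous_lorentz1 : continuous (@lorentz1 R).
Proof.
move=> t; apply: differentiable_continuous; apply/derivable1_diffP.
exact: (@ex_derive _ _ _ _ _ _ _ (is_derive_lorentz1 _)).
Qed.

Lemma measurable_lorentz1 (c : R) : measurable_fun setT (fun t : R => lorentz1 (c * t)).
Proof.
apply: continuous_measurable_fun => t; apply: continuous_comp.
  exact: mulrl_continuous.
exact: continuous_lorentz1.
Qed.

(** For [d <= 1], [lorentz1 (d t)^2 <= lorentz1 (d t) <= d^-2 lorentz1 t], and [lorentz1] is
    integrable; this comparison replaces the substitution [t -> d t]. *)
Lemma integral_lorentz1_lty (d : R) : 0 < d <= 1 ->
  (\int[lebesgue_measure]_t (lorentz1 (d * t) ^+ 2)%:E < +oo)%E.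
Proof.
move=> /andP[d0 d1].
have l1 : (\int[@lebesgue_measure R]_t (lorentz1 t)%:E < +oo)%E.
  have l0 (t : R) : 0 <= lorentz1 t by exact/ltW/lorentz1_gt0.
  have lN : @lorentz1 R =1 lorentz1 \o -%R by move=> t /=; rewrite /lorentz1 sqrrN.
  have := @ge0_symfun_integralT R lorentz1 l0 continuous_lorentz1 lN.
  rewrite (_ : [set t : R | 0 <= t] = `[0, +oo[%classic); last first.
    by apply/seteqP; split=> t /=; rewrite in_itv/= andbT.
  have := @integral0y_oneDsqr R; rewrite /oneDsqr => -> E.
  have : (2%:E * (pi / 2 : R)%:E < +oo)%E by rewrite -EFinM ltry.
  by rewrite -E.
apply: (@le_lt_trans _ _ (\int[lebesgue_measure]_t ((d ^- 2)%:E * (lorentz1 t)%:E))%E).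
  apply: ge0_le_integral => //.
  - by move=> t _; rewrite lee_fin sqr_ge0.
  - apply/measurable_EFinP/measurable_funX; exact: measurable_lorentz1.
  - apply: measurable_funeM; apply/measurable_EFinP.
    by have := measurable_lorentz1 1; under eq_fun do rewrite mul1r.
  move=> t _; rewrite -EFinM lee_fin.
  have e1 := lorentz1_gt0 (d * t); have e2 := lorentz1_le1 (d * t).
  apply: (@le_trans _ _ (lorentz1 (d * t))); first by rewrite expr2 ler_piMr// ltW.
  rewrite -invfM lef_pV2 ?posrE ?mulr_gt0 ?exprn_gt0 ?onepsqr_gt0//.
  by rewrite mulrDr mulr1 exprMn lerD2r exprn_ile1// ltW.
rewrite ge0_integralZl//.
- by rewrite lte_mul_pinfty// lee_fin invr_ge0 exprn_ge0// ltW.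
- by apply/measurable_EFinP; have := measurable_lorentz1 1; under eq_fun do rewrite mul1r.
- by move=> t _; rewrite lee_fin ltW// lorentz1_gt0.
- by rewrite lee_fin invr_ge0 exprn_ge0// ltW.
Qed.

Lemma sq_int_lorentzian (d : R) : 0 < d <= 1 -> sq_int mu (lorentzian d 0).
Proof.
move=> dd; have [sl _] := @bsmooth_lorentzian R n d 0.
split; first exact: smooth_measurable.
apply/(sq_intP _ (smooth_measurable sl)).
have -> : (fun x : 'rV[R]_n => (lorentzian d 0 x ^+ 2)%:E) =
    (fun x => (\prod_i (lorentz1 (d * x ord0 i) ^+ 2))%:E).
  apply/funext => x; rewrite /lorentzian -prodrXl; congr _%:E.
  by apply: eq_bigr => i _; rewrite /affine mxE subr0.
rewrite (@ge0_integral_prod R n (fun _ t => lorentz1 (d * t) ^+ 2)).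
- have [r ->] : exists r : R, (\int[lebesgue_measure]_t (lorentz1 (d * t) ^+ 2)%:E)%E = r%:E.
    exists (fine (\int[lebesgue_measure]_t (lorentz1 (d * t) ^+ 2)%:E)%E).
    rewrite fineK// ge0_fin_numE; first exact: integral_lorentz1_lty.
    by apply: integral_ge0 => t _; rewrite lee_fin sqr_ge0.
  have [r' ->] : exists r' : R, (\prod_(i < n) r%:E)%E = r'%:E.
    elim/big_ind : _ => [|_ _ [a ->] [b ->]|i _]; [by exists 1|by exists (a * b)|by exists r].
  exact: ltry.
- by move=> i; apply: measurable_funX; exact: measurable_lorentz1.
- by move=> i t; exact: sqr_ge0.
Qed.

(** On the cube of half-side 1, which has positive measure, each factor is at least 1/2. Positivity
    allows the wave packet to be normalized. *)
Lemma Rintegral_lorentzian_gt0 (d : R) : 0 < d <= 1 ->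
  0 < \int[mu]_x (lorentzian d 0 x ^+ 2).
Proof.
move=> dd; have /andP[d0 d1] := dd.
have [_ ci] := @sq_int_cube R n 1; have [_ li] := sq_int_lorentzian dd.
pose q : R := (2^-1 ^+ n) ^+ 2.
have q0 : 0 < q by rewrite !exprn_gt0// invr_gt0.
apply: (@lt_le_trans _ _ (\int[mu]_x (q * \1_(cube 1) x ^+ 2))); last first.
  apply: le_Rintegral => //; first exact: intgZ.
  move=> x _; rewrite indicE; have [/set_mem xc|_] := boolP (x \in cube 1); last first.
    by rewrite expr0n mulr0 sqr_ge0.
  rewrite expr1n mulr1 /q lerXn2r ?nnegrE ?exprn_ge0 ?invr_ge0 ?(ltW (lorentzian_gt0 _ _ _))//.
  rewrite /lorentzian -[n in leLHS]card_ord -prodr_const.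
  apply: ler_prod => j _; rewrite invr_ge0 ler0n /=.
  rewrite lef_pV2 ?posrE ?onepsqr_gt0// -[leRHS]/(1 + 1 : R).
  rewrite lerD2l -real_normK ?num_real// exprn_ile1// normrM gtr0_norm//.
  rewrite mulr_ile1 ?(ltW d0)// !mxE subr0; have /cubeP/(_ j) := xc; exact: ltW.
rewrite RintegralZl// mulr_gt0// /Rintegral.
rewrite (eq_integral (fun x => (\1_(cube 1) x)%:E)); last first.
  by move=> x _; rewrite indicE; case: (_ \in _); rewrite ?expr1n ?expr0n.
rewrite integral_indic//; last exact: measurable_obox.
have [r r0 E] : exists2 r : R, 0 < r & mu (cube 1) = r%:E.
  rewrite /cube lebesgue_obox.
  elim/big_ind : _ => [|_ _ [a a0 ->] [b b0 ->]|i _].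
  - by exists 1.
  - by exists (a * b) => //; exact: mulr_gt0.
  - exists (1 + 1); first exact: addr_gt0.
    by rewrite lebesgue_measure_itv/= lte_fin (lt_trans (ltrN10 R) ltr01) -EFinD opprK.
by rewrite setIT -[X in fine X]/(mu (cube 1)) E.
Qed.

Section packet.
Variable d : R.
Hypothesis dd : 0 < d <= 1.

(* The operator [d_i] conjugated by multiplication by [lorentzian d 0]. *)
Definition wave_partial i th x :=
  - 2 * d * odd_lorentz1 (affine i d 0 x) * th x + partial i th x.

Lemma bsmooth_wave_partial i th : bsmooth th -> bsmooth (wave_partial i th).
Proof.
move=> bth; apply: bsmoothD; last exact: bsmooth_partial.
by apply: bsmoothM => //; exact/bsmoothZ/bsmooth_odd_lorentz1.
Qed.

Lemma partial_wave i th : bsmooth th ->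
  partial i (fun x => lorentzian d 0 x * th x) =
  (fun x => lorentzian d 0 x * wave_partial i th x).
Proof.
move=> bth; rewrite partialM; [|exact/bsmooth_C1/bsmooth_lorentzian|exact: bsmooth_C1].
by rewrite partial_lorentzian; apply/funext => x; rewrite /wave_partial mxE; ring.
Qed.

Lemma sq_int_wave th : bsmooth th -> sq_int mu (fun x => lorentzian d 0 x * th x).
Proof.
move=> bth; have := sq_int_bsmooth bth (sq_int_lorentzian dd).
by under eq_fun do rewrite mulrC.
Qed.

Lemma weak_partial_wave i th : bsmooth th ->
  weak_partial i (fun x => lorentzian d 0 x * th x)
    (fun x => lorentzian d 0 x * wave_partial i th x).
Proof.
move=> bth; rewrite -partial_wave//; apply: weak_partial_smooth.
- by have [] := bsmoothM (@bsmooth_lorentzian R n d 0) bth.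
- exact: sq_int_wave.
- by rewrite partial_wave//; exact/sq_int_wave/bsmooth_wave_partial.
Qed.

Definition wave (th1 th2 : 'rV[R]_n -> R) x : R[i] :=
  Complex (lorentzian d 0 x * th1 x) (lorentzian d 0 x * th2 x).

Lemma wave2P i j th phi : bsmooth th -> test_function phi ->
  \int[mu]_x (lorentzian d 0 x * th x * partial i (partial j phi) x) =
  \int[mu]_x (lorentzian d 0 x * wave_partial j (wave_partial i th) x * phi x).
Proof.
move=> bth tphi.
have [_ _ ->] := weak_partial_wave i bth; last exact: test_partial.
have [_ _ ->] := weak_partial_wave j (bsmooth_wave_partial i bth); last by [].
by rewrite opprK.
Qed.

Lemma L2_wave th1 th2 : bsmooth th1 -> bsmooth th2 -> L2 (wave th1 th2).
Proof. by move=> b1 b2; apply/L2P; split; exact: sq_int_wave. Qed.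

Lemma H2_wave th1 th2 : bsmooth th1 -> bsmooth th2 -> H2 (wave th1 th2).
Proof.
move=> b1 b2; split; first exact: L2_wave.
case=> [|i [|j [|//]]] _.
- exists (wave th1 th2); split; first exact: L2_wave.
  by move=> phi tphi /=; rewrite expr0 mul1r.
- exists (wave (wave_partial i th1) (wave_partial i th2)); apply/weak_derivative1P.
  split; first by apply: L2_wave; exact: bsmooth_wave_partial.
  move=> phi tphi; have [_ _ h1] := weak_partial_wave i b1; have [_ _ h2] := weak_partial_wave i b2.
  by split; [exact: h1|exact: h2].
- exists (wave (wave_partial j (wave_partial i th1)) (wave_partial j (wave_partial i th2))).
  apply/weak_derivative2P; split.
    by apply: L2_wave; do 2 apply: bsmooth_wave_partial.
  by move=> phi tphi; split; exact: wave2P.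
Qed.

(** The difference [w] is orthogonal to every test function. For [phi] close to [w], the squared
    norm of [w] is the integral of [w (w - phi)], and Young's inequality absorbs half of it. *)
Lemma weak_unique f g : sq_int mu f -> sq_int mu g ->
  (forall phi, test_function phi -> \int[mu]_x (f x * phi x) = \int[mu]_x (g x * phi x)) ->
  sqr_dist mu f g = 0.
Proof.
move=> fi gi fg; apply/eqP; rewrite eq_le sqr_dist_ge0 andbT.
apply/ler_addgt0Pr => e e0; rewrite add0r.
have wi := sq_intB fi gi.
have [phi tphi phie] := test_functions_dense wi e0.
have phii := test_sq_int tphi; have di := sq_intB wi phii.
have w0 : \int[mu]_x ((f x - g x) * phi x) = 0.
  have := fg _ tphi; move/eqP; rewrite -subr_eq0 -RintegralB//; [|exact: sq_intM..].
  by move/eqP => <-; apply: eq_Rintegral => x _; ring.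
have Y := young_Rintegral wi di ltr01.
have E : sqr_dist mu f g = \int[mu]_x ((f x - g x) * (f x - g x - phi x)).
  have -> : sqr_dist mu f g = sqr_dist mu f g - 0 by rewrite subr0.
  rewrite -w0 /sqr_dist -RintegralB//; [|by case: wi|exact: sq_intM].
  by apply: eq_Rintegral => x _; ring.
rewrite -E ger0_norm ?sqr_dist_ge0// in Y; move: Y phie.
rewrite -/(sqr_dist mu f g) -/(sqr_dist mu (fun x => f x - g x) phi); clear.
move: (sqr_dist _ _ _) (sqr_dist _ _ _) => A B; lra.
Qed.

(* [weak_derivative] selects an arbitrary representative, here [H'], whereas the
   explicit derivatives are [H]; the factor 2 is harmless. *)
Lemma helmholtz_sqr_le f (k2 : R) (H H' : 'I_n -> 'I_n -> 'rV[R]_n -> R) : sq_int mu f ->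
  (forall j, sq_int mu (H j j)) -> (forall j, sq_int mu (H' j j)) ->
  (forall j, sqr_dist mu (H' j j) (H j j) = 0) ->
  \int[mu]_x (helmholtz f H' k2 x ^+ 2) <= 2 * \int[mu]_x (helmholtz f H k2 x ^+ 2).
Proof.
move=> fi Hi H'i HH'.
have L0 (r : seq 'I_n) :
    sqr_dist mu (fun x => \sum_(j <- r) H' j j x) (fun x => \sum_(j <- r) H j j x) = 0.
  elim: r => [|j r IH].
    rewrite /sqr_dist; under eq_Rintegral do rewrite !big_nil subrr expr0n/=.
    by rewrite /Rintegral integral0.
  apply/eqP; rewrite eq_le sqr_dist_ge0 andbT.
  rewrite (_ : (fun x => _) = (fun x => H' j j x + \sum_(j <- r) H' j j x)); last first.
    by apply/funext => x; rewrite big_cons.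
  rewrite (_ : (fun x => \sum_(j <- _ :: _) _) = (fun x => H j j x + \sum_(j <- r) H j j x)); last first.
    by apply/funext => x; rewrite big_cons.
  apply: le_trans (sqr_distD _ _ _ _) _ => //; [exact: sq_int_sum..|].
  by rewrite HH' IH mulr0 addr0.
have Fi : sq_int mu (helmholtz f H k2) by apply: sq_intD; [exact: sq_int_sum|exact: sq_intZ].
have F'i : sq_int mu (helmholtz f H' k2) by apply: sq_intD; [exact: sq_int_sum|exact: sq_intZ].
have Li : sq_int mu (fun x => \sum_j H' j j x - \sum_j H j j x).
  by apply: sq_intB; exact: sq_int_sum.
have i1 := sq_int_sqr Fi; have i2 := sq_int_sqr F'i; have i3 := sq_int_sqr Li.
rewrite -[leRHS]addr0 -[X in _ + X](mulr0 2) -(L0 (index_enum _)) /sqr_dist.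
rewrite -!RintegralZl// -RintegralD//; [|exact: intgZ..].
apply: le_Rintegral => //; first by apply: intgD; exact: intgZ.
move=> x _; rewrite /helmholtz.
move: (\sum_j H' j j x) (\sum_j H j j x) (k2 * f x) => a b z.
by have := sqr_ge0 (b + z - (a - b)); nra.
Qed.

Lemma defect_wave (k2 : R) th1 th2 : bsmooth th1 -> bsmooth th2 ->
  defect k2 (wave th1 th2) <=
  2 * \int[mu]_x (helmholtz (fun x => lorentzian d 0 x * th1 x)
    (fun i j x => lorentzian d 0 x * wave_partial j (wave_partial i th1) x) k2 x ^+ 2) +
  2 * \int[mu]_x (helmholtz (fun x => lorentzian d 0 x * th2 x)
    (fun i j x => lorentzian d 0 x * wave_partial j (wave_partial i th2) x) k2 x ^+ 2).
Proof.
move=> b1 b2; have H2u := H2_wave b1 b2.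
have w2 j := (weak_derivative2P j j _ _).1 (weak_derivativeP (alpha := [:: j; j]) H2u isT).
have b1'' j := bsmooth_wave_partial j (bsmooth_wave_partial j b1).
have b2'' j := bsmooth_wave_partial j (bsmooth_wave_partial j b2).
apply: lerD; apply: helmholtz_sqr_le.
- exact: sq_int_wave.
- by move=> j; exact: sq_int_wave.
- by move=> j; have [/L2P[]] := w2 j.
- move=> j; have [/L2P[r1 _] h] := w2 j.
  apply: weak_unique => //; first exact: sq_int_wave.
  by move=> phi tphi; have [<- _] := h _ tphi; exact: wave2P.
- exact: sq_int_wave.
- by move=> j; exact: sq_int_wave.
- by move=> j; have [/L2P[]] := w2 j.
- move=> j; have [/L2P[_ r1] h] := w2 j.
  apply: weak_unique => //; first exact: sq_int_wave.
  by move=> phi tphi; have [_ <-] := h _ tphi; exact: wave2P.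
Qed.

(** Stated for an abstract pair so as to cover both [(cos, - sin)] and [(sin, cos)], multiplied by
    an amplitude [s]. The second derivative of [th] along [i0] is [- kappa^2 th], so only terms with
    a factor [d] remain. *)
Lemma helmholtz_wave_le (i0 : 'I_n) (kappa s : R) th th' : 0 <= kappa ->
  bsmooth th -> bsmooth th' -> (forall x, `|th x| <= s) -> (forall x, `|th' x| <= s) ->
  (forall j, partial j th = fun x => kappa *+ (j == i0) * th' x) ->
  (forall j, partial j th' = fun x => - (kappa *+ (j == i0) * th x)) ->
  \int[mu]_x (helmholtz (fun x => lorentzian d 0 x * th x)
    (fun i j x => lorentzian d 0 x * wave_partial j (wave_partial i th) x)
    (kappa ^+ 2) x ^+ 2) <=
  ((2 * n%:R * d ^+ 2 + 2 * d * kappa) * s) ^+ 2 * \int[mu]_x (lorentzian d 0 x ^+ 2).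
Proof.
move=> kappa0 bth bth' ths th's dth dth'.
have /andP[d0 d1] := dd.
have s0 : 0 <= s by apply: le_trans (ths 0).
have [_ li] := sq_int_lorentzian dd.
set C := _ * s.
have C0 : 0 <= C by rewrite mulr_ge0// addr_ge0// !mulr_ge0// ?sqr_ge0// ltW.
have wE j x : wave_partial j (wave_partial j th) x =
    d ^+ 2 * (8 * odd_lorentz1 (affine j d 0 x) ^+ 2 - 2 * lorentz1 (affine j d 0 x)) * th x
    - (4 * d * odd_lorentz1 (affine j d 0 x) * kappa *+ (j == i0) * th' x)
    - (kappa ^+ 2 *+ (j == i0) * th x).
  rewrite {1}/wave_partial.
  have bo := @bsmooth_odd_lorentz1 R n j d 0.
  rewrite [X in partial j X](_ : _ = (fun x => (- 2 * d * odd_lorentz1 (affine j d 0 x)) * th x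
    + kappa *+ (j == i0) * th' x)); last first.
    by apply/funext => y; rewrite /wave_partial dth.
  have bo' := bsmoothZ (- 2 * d) bo; have bk := bsmoothZ (kappa *+ (j == i0)) bth'.
  rewrite partialD; [|exact: bsmooth_C1 (bsmoothM bo' bth)|exact: bsmooth_C1].
  rewrite (partialM _ (bsmooth_C1 bo') (bsmooth_C1 bth)).
  rewrite (partialZ _ _ (bsmooth_C1 bo)) (partialZ _ _ (bsmooth_C1 bth')).
  rewrite dth' dth partial_odd_lorentz1 eqxx mulr1n /wave_partial dth.
  by case: (j == i0); rewrite ?mulr1n ?mulr0n; ring.
have FE x : `|helmholtz (fun x => lorentzian d 0 x * th x)
    (fun i j x => lorentzian d 0 x * wave_partial j (wave_partial i th) x)
    (kappa ^+ 2) x| <= C * lorentzian d 0 x.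
  have l0 := lorentzian_gt0 d 0 x.
  rewrite /helmholtz -mulr_sumr.
  have -> : \sum_j wave_partial j (wave_partial j th) x =
     \sum_j (d ^+ 2 * (8 * odd_lorentz1 (affine j d 0 x) ^+ 2 - 2 * lorentz1 (affine j d 0 x)) * th x)
     - 4 * d * odd_lorentz1 (affine i0 d 0 x) * kappa * th' x - kappa ^+ 2 * th x.
    under eq_bigr do rewrite wE.
    rewrite !big_split /= !sumrN; congr (_ - _ - _).
      rewrite (bigD1 i0)//= eqxx mulr1n big1 ?addr0// => j ji.
      by rewrite (negbTE ji) mulr0n mul0r.
    rewrite (bigD1 i0)//= eqxx mulr1n big1 ?addr0// => j ji.
    by rewrite (negbTE ji) mulr0n mul0r.
  set S := \sum_j _.
  (* Here the two terms in [kappa^2] cancel. *)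
  rewrite (_ : _ + _ = lorentzian d 0 x *
     (S - 4 * d * odd_lorentz1 (affine i0 d 0 x) * kappa * th' x)); last by ring.
  rewrite normrM gtr0_norm// mulrC ler_wpM2r ?(ltW l0)//.
  apply: (le_trans (ler_normB _ _)).
  rewrite /C [leRHS]mulrDl; apply: lerD.
    apply: (le_trans (ler_norm_sum _ _ _)).
    apply: (@le_trans _ _ (\sum_(j < n) (2 * d ^+ 2 * s))).
      apply: ler_sum => j _; rewrite normrM ler_pM// normrM (ger0_norm (sqr_ge0 _)).
      by rewrite mulrC ler_wpM2r ?sqr_ge0// odd_lorentz1_lorentz1_le.
    by rewrite sumr_const card_ord -(mulr_natl (2 * d ^+ 2 * s) n) le_eqVlt; apply/orP; left; apply/eqP; ring.
  rewrite normrM ler_pM//.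
  (* The grouping isolates [2 * odd_lorentz1], whose absolute value is at most 1. *)
  rewrite (_ : 4 * d * _ * kappa = 2 * odd_lorentz1 (affine i0 d 0 x) * (2 * d * kappa)); last by ring.
  have dk0 : 0 <= 2 * d * kappa by rewrite !mulr_ge0// ltW.
  rewrite normrM (ger0_norm dk0) ler_piMl//.
  rewrite -(@expr_le1 _ 2)// real_normK ?num_real// exprMn.
  by have := odd_lorentz1_sqr_le (affine i0 d 0 x); rewrite (_ : 2 ^+ 2 = 4 :> R)//; ring.
rewrite -RintegralZl//; apply: le_Rintegral => //.
- apply: sq_int_sqr; apply: sq_intD; last exact/sq_intZ/sq_int_wave.
  by apply: sq_int_sum => j; apply: sq_int_wave; do 2 apply: bsmooth_wave_partial.
- exact: intgZ.
- move=> x _; rewrite -exprMn -real_normK ?num_real//.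
  by rewrite lerXn2r ?nnegrE// mulr_ge0// ltW// lorentzian_gt0.
Qed.

End packet.

Lemma small_defect (c kappa eps : R) : (1 <= n)%N -> 0 < c -> 0 <= kappa -> 0 < eps ->
  exists2 u : 'rV[R]_n -> R[i], mass_sphere n c u & defect (kappa ^+ 2) u <= eps.
Proof.
move=> n1 c0 kappa0 eps0; pose i0 : 'I_n := Ordinal n1.
(* Two components, each with the factor 2 of [defect_wave], give [4 C] with
   [C = c (2 n d^2 + 2 d kappa)^2]; for [d <= 1] this is at most [M d]. *)
pose M := 4 * c * (2 * n%:R + 2 * kappa) ^+ 2 : R.
have M0 : 0 <= M by rewrite mulr_ge0 ?sqr_ge0// mulr_ge0// ltW.
pose d := Num.min 1 (eps / (M + 1)).
have M1 : 0 < M + 1 by rewrite ltr_wpDl.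
have d0 : 0 < d by rewrite lt_min ltr01 divr_gt0.
have d1 : d <= 1 by rewrite ge_min lexx.
have dM : d * (M + 1) <= eps by rewrite -ler_pdivlMr// ge_min lexx orbT.
clearbody d; have dd : 0 < d <= 1 by rewrite d0 d1.
have I0 := Rintegral_lorentzian_gt0 dd.
set I := \int[mu]_x _ in I0.
(* Since [cos^2 + sin^2 = 1], the squared modulus of the packet is [s^2 lorentzian^2], whose
   integral is [s^2 I]. *)
pose s := Num.sqrt (c / I).
have s2 : s ^+ 2 = c / I by rewrite sqr_sqrtr// divr_ge0// ltW.
have s0 : 0 <= s by exact: sqrtr_ge0.
pose th1 x := s * cos (affine i0 kappa 0 x); pose th2 x := s * sin (affine i0 kappa 0 x).
have bc : bsmooth (fun x : 'rV[R]_n => cos (affine i0 kappa 0 x)).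
  exact/bsmooth_coord/bsmooth1_cos.
have bs : bsmooth (fun x : 'rV[R]_n => sin (affine i0 kappa 0 x)).
  exact/bsmooth_coord/bsmooth1_sin.
have b1 : bsmooth th1 by exact: bsmoothZ.
have b2 : bsmooth th2 by exact: bsmoothZ.
have bN : bsmooth (fun x => - 1 * th2 x) by exact: bsmoothZ.
have dc j : partial j th1 = fun x => kappa *+ (j == i0) * (- 1 * th2 x).
  rewrite /th1 partialZ; last exact: bsmooth_C1.
  rewrite (@partial_coord _ _ cos (fun t => - sin t)).
  by apply/funext => x; rewrite /th2; ring.
have ds j : partial j th2 = fun x => kappa *+ (j == i0) * th1 x.
  rewrite /th2 partialZ; last exact: bsmooth_C1.
  rewrite (@partial_coord _ _ sin cos).
  by apply/funext => x; rewrite /th1; ring.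
have th1s x : `|th1 x| <= s.
  by rewrite normrM (ger0_norm s0) ler_piMr// cos_max.
have th2s x : `|th2 x| <= s.
  by rewrite normrM (ger0_norm s0) ler_piMr// sin_max.
exists (wave d th1 th2).
  split; first exact: H2_wave.
  rewrite /= Rintegral_sqr_norm; last exact: L2_wave.
  have w1 := sq_int_sqr (sq_int_wave dd b1); have w2 := sq_int_sqr (sq_int_wave dd b2).
  rewrite -RintegralD//.
  have [_ li] := sq_int_lorentzian dd.
  transitivity (\int[mu]_x (s ^+ 2 * lorentzian d 0 x ^+ 2)).
    apply: eq_Rintegral => x _; rewrite /= /th1 /th2.
    rewrite -[RHS]mulr1 -(cos2Dsin2 (affine i0 kappa 0 x)); ring.
  by rewrite RintegralZl// -/I s2 divfK// gt_eqF.
apply: (le_trans (defect_wave dd (kappa ^+ 2) b1 b2)).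
have B1 := @helmholtz_wave_le d dd i0 kappa s th1 (fun x => - 1 * th2 x) kappa0 b1 bN th1s.
have B2 := @helmholtz_wave_le d dd i0 kappa s th2 th1 kappa0 b2 b1 th2s th1s ds.
have {}B1 := B1 _ dc _; have {}B2 := B2 _.
set C := (_ * s) ^+ 2 * _ in B1 B2.
have CE : C = c * (2 * n%:R * d ^+ 2 + 2 * d * kappa) ^+ 2.
  by rewrite /C exprMn s2 -/I; field; rewrite gt_eqF.
have Cle : 4 * C <= M * d.
  have dn : 2 * n%:R * d ^+ 2 + 2 * d * kappa = d * (2 * n%:R * d + 2 * kappa) by ring.
  rewrite CE dn exprMn /M.
  have h1 : (2 * n%:R * d + 2 * kappa) ^+ 2 <= (2 * n%:R + 2 * kappa) ^+ 2.
    rewrite lerXn2r ?nnegrE ?addr_ge0 ?mulr_ge0 ?(ltW d0)//.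
    by rewrite lerD2r ler_piMr// mulr_ge0.
  have h2 : d ^+ 2 <= d by rewrite expr2 ler_piMr// ltW.
  have -> : 4 * (c * (d ^+ 2 * (2 * n%:R * d + 2 * kappa) ^+ 2)) =
    4 * c * (d ^+ 2 * (2 * n%:R * d + 2 * kappa) ^+ 2) by ring.
  have -> : 4 * c * (2 * n%:R + 2 * kappa) ^+ 2 * d =
    4 * c * (d * (2 * n%:R + 2 * kappa) ^+ 2) by ring.
  by rewrite ler_wpM2l ?mulr_ge0 ?(ltW c0)// ler_pM ?sqr_ge0.
have Md : M * d <= eps by rewrite mulrC; apply: le_trans dM; rewrite ler_pM2l// lerDl.
apply: le_trans Md; apply: le_trans Cle.
rewrite (_ : 4 * C = 2 * C + 2 * C); last by ring.
apply: lerD; rewrite ler_pM2l//.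
  apply: B1.
    by move=> x; rewrite normrM normrN normr1 mul1r.
  by move=> j; rewrite partialZ ?ds; [apply/funext => x; ring|exact: bsmooth_C1].
apply: B2 => j; rewrite dc; apply/funext => x; ring.
Qed.

End wave_packet.

Theorem lemma3p1 (R : realType) (N : nat) (hN : (1 <= N)%N)
    (gamma beta : R) (hgamma : 0 < gamma) (hbeta : 0 < beta)
    (c : R) (hc : 0 < c) :
  [/\ min_energy N gamma beta c = (- (beta ^+ 2 / (8 * gamma)) * c)%:E,
      ~ exists2 u : 'rV[R]_N -> R[i],
          mass_sphere N c u &
          (energy gamma beta u)%:E = min_energy N gamma beta c
    & forall u_ : nat -> 'rV[R]_N -> R[i],
        minimizing_sequence gamma beta c u_ -> vanishing_sequence u_].
Proof.
have k20 : 0 < beta / (2 * gamma) by rewrite divr_gt0// mulr_gt0.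
have minE : min_energy N gamma beta c = (- (beta ^+ 2 / (8 * gamma)) * c)%:E.
  apply/eqP; rewrite eq_le; apply/andP; split; last first.
    by apply: le_ereal_inf_tmp => _ [u uc <-]; rewrite lee_fin; exact: energy_ge.
  apply/lee_addgt0Pr => e e0.
  (* The energy exceeds the claimed infimum by [gamma / 2] times the defect, hence by at most
     [e]. *)
  have [||u uc ude] := @small_defect R N c (Num.sqrt (beta / (2 * gamma))) (2 / gamma * e) hN hc.
  - exact: sqrtr_ge0.
  - by rewrite mulr_gt0// divr_gt0.
  apply: (@le_trans _ _ (energy gamma beta u)%:E).
    by apply: ereal_inf_lbound; exists u.
  have [H2u mass] := uc; rewrite -EFinD lee_fin energyE// mass mulNr addrC lerD2l.
  move: ude; rewrite sqr_sqrtr ?(ltW k20)// => ude.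
  rewrite -[leRHS](_ : gamma / 2 * (2 / gamma * e) = e); last by field; rewrite gt_eqF.
  by rewrite ler_wpM2l// divr_ge0// ltW.
have vanish (u_ : nat -> 'rV[R]_N -> R[i]) :
    minimizing_sequence gamma beta c u_ -> vanishing_sequence u_.
  move=> [uc]; rewrite minE => /fine_cvgP[_ /= Icvg].
  apply: (vanishing_of_defect k20 uc).
  (* At fixed mass the defect is an affine function of the energy, so it tends to 0 along any
     minimizing sequence. *)
  have -> : (fun k => defect (beta / (2 * gamma)) (u_ k)) =
      (fun k => 2 / gamma * (energy gamma beta (u_ k) - - (beta ^+ 2 / (8 * gamma)) * c)).
    apply/funext => k; have [H2u mass] := uc k.
    by rewrite energyE// mass; field; rewrite gt_eqF.
  rewrite -(mulr0 (2 / gamma)); apply: cvgMr; apply/subr_cvg0; exact: Icvg.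
split => // -[u uc Iu].
have [[Lu _] mass] := uc.
have := vanishing_constant Lu (vanish (fun=> u) _).
move: mass => /= -> /(_ _)/eqP; rewrite (gt_eqF hc) => H; suff : false by [].
apply: H; split => //; rewrite Iu; exact: cvg_cst.
Qed.
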